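(* Let $\sigma,\zeta$ be the Weierstrass sigma and zeta functions for a lattice $2\omega_1\mathbb Z+2\omega_2\mathbb Z$ with $\mathrm{Im}(\omega_2/\omega_1)>0$. For every $n\ge1$ and $e\in\mathbb C$ with $\sigma(e)\ne0$, as an identity of meromorphic functions of $\alpha_1,\dots,\alpha_n$, $$\frac{\sigma\big(e-\sum_{j=1}^n\alpha_j\big)\prod_{1\le i<j\le n}\sigma(\alpha_i-\alpha_j)}{\sigma(e)\prod_{i=1}^n\sigma(\alpha_i)^{n-1}}=\det\big(\tilde\phi_i(\alpha_j)\big)_{1\le i,j\le n},\qquad\tilde\phi_i(\alpha_j)=\Big(\frac{\partial}{\partial v}+\zeta(\alpha_j)\Big)^{i-1}\Big(\frac{\sigma(v-\alpha_j)}{\sigma(v)}\Big)\Big|_{v=e}.$$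
   Context: $\sigma(u)$ is the Weierstrass sigma function of the lattice with periods $2\omega_1,2\omega_2$ and $\zeta(u)=\sigma'(u)/\sigma(u)$. *)

(* Defs.v *)
From HB Require Import structures.
From mathcomp Require Import all_boot all_order all_algebra.
From mathcomp Require Import all_classical all_reals all_analysis.
From mathcomp Require Import complex.
Set Implicit Arguments. Unset Strict Implicit. Unset Printing Implicit Defensive.
Import Order.TTheory GRing.Theory Num.Theory.
Import numFieldTopology.Exports numFieldNormedType.Exports.
Local Open Scope ring_scope.
Local Open Scope complex_scope.
Local Open Scope classical_set_scope.

Section Weierstrass.
Variable R : realType.
Local Notation C := (R[i]^o).

Definition cexp (z : C) : C :=
  (((expR (complex.Re z) * cos (complex.Im z)) +i* (expR (complex.Re z) * sin (complex.Im z))) : R[i]).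

Definition wfactor (t : C) : C := (1 - t) * cexp (t + t ^+ 2 / 2%:R).

Definition latpt (w1 w2 : C) (m n : int) : C :=
  2%:R * (m%:~R * w1) + 2%:R * (n%:~R * w2).

Definition sigma_partial (w1 w2 : C) (N : nat) (u : C) : C :=
  u * \prod_(i < (2 * N).+1) \prod_(j < (2 * N).+1 |
             ((i%:Z - N%:Z) != 0) || ((j%:Z - N%:Z) != 0))
        wfactor (u / latpt w1 w2 (i%:Z - N%:Z) (j%:Z - N%:Z)).

(* Weierstrass sigma function of the lattice 2 w1 Z + 2 w2 Z,
   sigma(u) = u prod_{w <> 0} (1 - u/w) exp(u/w + u^2/(2 w^2)) *)
Definition wsigma (w1 w2 : C) (u : C) : C :=
  lim ((fun N : nat => sigma_partial w1 w2 N u) @ \oo).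

Definition wzeta (w1 w2 : C) (u : C) : C :=
  derive1 (wsigma w1 w2) u / wsigma w1 w2 u.

Definition dplus (c : C) (g : C -> C) : C -> C := fun v => derive1 g v + c * g v.

(* tilde phi_i(a) = (d/dv + zeta(a))^(i) (sigma(v - a)/sigma(v)) |_{v = e},
   with i counted from 0 (i.e. exponent i-1 for the paper's 1-based i) *)
Definition phitilde (w1 w2 e : C) (i : nat) (a : C) : C :=
  iter i (dplus (wzeta w1 w2 a))
    (fun v => wsigma w1 w2 (v - a) / wsigma w1 w2 v) e.

End Weierstrass.

(* Main.v *)
Require Import Defs.
From HB Require Import structures.
From mathcomp Require Import all_boot all_order all_algebra.
From mathcomp Require Import all_classical all_reals all_analysis.
From mathcomp Require Import perm complex.
From mathcomp Require Import ring lra zify.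
Set Implicit Arguments.
Unset Strict Implicit.
Unset Printing Implicit Defensive.
Import Order.TTheory GRing.Theory Num.Theory.
Import numFieldTopology.Exports numFieldNormedType.Exports.
Local Open Scope ring_scope.
Local Open Scope complex_scope.

(* As a function of its last argument, the determinant, multiplied by powers of
   sigma to clear the poles, is an entire quasi-periodic function which vanishes
   when two arguments coincide modulo the lattice. Its quotient by the product of
   the sigma(alpha_i - x) has the multipliers of sigma(e - sum alpha_i - x), and
   quasi-periodic functions of this kind form a line. The constant is found at
   x = 0, where the determinant of size n + 1 reduces to the one of size n.
   Degenerate positions of the alpha_i are reached by continuity.

   The analytic input is Liouville's theorem. It follows from the weak
   maximum principle, proved from second order Taylor expansions: if
   f(z + h) = f + a h + b h^2 + O(h^3), then the mean of |f|^2 over the points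
   z + i^k t, k = 0, ..., 3, is |f|^2 + |a|^2 t^2 + O(t^3). *)

(** * Modulus and the maximum principle *)

(** The multipliers of sigma are usually read off from the periodicity of its second logarithmic
    derivative. Here they come from one identity between values of sigma: with r(u) = s(u + p) /
    s(u) it says r(u) r(v) = r(u + t) r(v - t). So r(u) r(v) depends only on u + v, which forces
    r(u) = k exp(A u). The constants k and A stay unevaluated; the one relation that enters is k^2 =
    exp(A p), a consequence of oddness. Divisions are by functions with simple zeros, so that
    vanishing of the numerator there is enough for a holomorphic quotient. Relations between
    quotients are kept in cross-multiplied form, valid at every point; isolated zeros and continuity
    then remove the extra factors. *)

Definition cmod (R : realType) (z : R[i]) : R := Normc.normc z.
Arguments cmod {R} z : simpl never.

Section ComplexModulus.
Variable R : realType.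
Local Notation C := R[i].
Local Notation N := (@cmod R).
Implicit Types (x y z : C).

Lemma normr_cmod z : `|z| = (N z)%:C.
Proof. by case: z. Qed.

Lemma cmod_ge0 z : 0 <= N z.
Proof. by case: z => a b; exact: sqrtr_ge0. Qed.

Lemma cmod0 : N 0 = 0.
Proof. exact: Normc.normc0. Qed.

Lemma cmod1 : N 1 = 1.
Proof. exact: Normc.normc1. Qed.

Lemma cmod_eq0 z : (N z == 0) = (z == 0).
Proof. by apply/eqP/eqP => [/Normc.eq0_normc //|->]; rewrite cmod0. Qed.

Lemma cmod_gt0 z : (0 < N z) = (z != 0).
Proof. by rewrite lt0r cmod_ge0 andbT cmod_eq0. Qed.

Lemma cmodM x y : N (x * y) = N x * N y.
Proof. exact: Normc.normcM. Qed.

Lemma cmodV x : N x^-1 = (N x)^-1.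
Proof. exact: Normc.normcV. Qed.

Lemma cmodN x : N (- x) = N x.
Proof. exact: normcN. Qed.

Lemma cmod_distC x y : N (x - y) = N (y - x).
Proof. by rewrite -cmodN opprB. Qed.

Lemma cmodD x y : N (x + y) <= N x + N y.
Proof. exact: le_normcD. Qed.

Lemma cmodB x y : N (x - y) <= N x + N y.
Proof. by rewrite -(cmodN y) cmodD. Qed.

Lemma cmodB_ge x y : N x - N y <= N (x - y).
Proof. by have := cmodD (x - y) y; rewrite subrK; lra. Qed.

Lemma cmodX x n : N (x ^+ n) = N x ^+ n.
Proof. by elim: n => [|n IH]; rewrite ?expr0 ?cmod1 // !exprS cmodM IH. Qed.

Lemma cmod_real (a : R) : N a%:C = `|a|.
Proof. by rewrite /cmod /= expr0n addr0 sqrtr_sqr. Qed.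

Lemma cmod_nat n : N (n%:R) = n%:R.
Proof. by have := cmod_real n%:R; rewrite rmorph_nat normr_nat. Qed.

Lemma sqr_cmod z : N z ^+ 2 = complex.Re z ^+ 2 + complex.Im z ^+ 2.
Proof. by case: z => a b; rewrite /cmod /= sqr_sqrtr // addr_ge0 ?sqr_ge0. Qed.

Lemma Re_le_cmod z : `|complex.Re z| <= N z.
Proof.
rewrite -(@ler_pXn2r _ 2%N) ?nnegrE ?cmod_ge0 ?normr_ge0 // sqr_cmod real_normK ?num_real //.
by rewrite lerDl sqr_ge0.
Qed.

Lemma Im_le_cmod z : `|complex.Im z| <= N z.
Proof.
rewrite -(@ler_pXn2r _ 2%N) ?nnegrE ?cmod_ge0 ?normr_ge0 // sqr_cmod real_normK ?num_real //.
by rewrite lerDr sqr_ge0.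
Qed.

Lemma cmod_le_ReIm z : N z <= `|complex.Re z| + `|complex.Im z|.
Proof.
rewrite -(@ler_pXn2r _ 2%N) ?nnegrE ?cmod_ge0 ?addr_ge0 ?normr_ge0 // sqr_cmod.
rewrite -(real_normK (num_real (complex.Re z))) -(real_normK (num_real (complex.Im z))).
have := normr_ge0 (complex.Re z); have := normr_ge0 (complex.Im z); nra.
Qed.

Lemma cmod_sum (I : Type) (s : seq I) (P : pred I) (F : I -> C) :
  N (\sum_(i <- s | P i) F i) <= \sum_(i <- s | P i) N (F i).
Proof.
elim/big_ind2: _ => [|a b c d h1 h2|//]; first by rewrite cmod0.
by apply: le_trans (cmodD _ _) _; exact: lerD.
Qed.

Definition ccont (f : C -> C) z := forall e : R, 0 < e ->
  exists2 d : R, 0 < d & forall y, N (y - z) < d -> N (f y - f z) < e.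

(** Compactness is taken in [R * R], where the disc is a closed part of a product of two
    segments. *)
Lemma disc_max (f : C -> R) (r : R) : 0 <= r ->
  (forall z (e : R), N z <= r -> 0 < e -> exists2 d : R, 0 < d &
     forall y, N (y - z) < d -> `|f y - f z| < e) ->
  exists2 z, N z <= r & forall y, N y <= r -> f y <= f z.
Proof.
move=> r0 cf.
pose h (p : R * R) : C := p.1 +i* p.2.
pose A : set (R * R) := [set p | N (h p) <= r]%classic.
have near_h (p : R * R) (d : R) : 0 < d ->
    \forall q \near p, N (h q - h p) < d.
  move=> d0; exists (ball p.1 (d / 2), ball p.2 (d / 2)) => /=.
    by split; apply: nbhsx_ballx; lra.
  move=> q [h1 h2]; rewrite /ball /= in h1 h2.
  apply: le_lt_trans (cmod_le_ReIm _) _; move: p q h1 h2 => [p1 p2] [a b] /= h1 h2.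
  by rewrite (distrC a) (distrC b); lra.
have cA : compact A.
  apply: (@subclosed_compact _ _ (`[(-r), r]%classic `*` `[(-r), r]%classic)%classic).
  - rewrite closedE => p /= np; apply/negP => /negP; rewrite -ltNge => lp.
    apply: np.
    have d0 : 0 < N (h p) - r by rewrite subr_gt0.
    near=> q => /= Aq.
    have : N (h q - h p) < N (h p) - r by near: q; exact: near_h.
    by rewrite cmod_distC; have := cmodB_ge (h p) (h q); rewrite /A /= in Aq; lra.
  - by apply: compact_setX; exact: segment_compact.
  - move=> [a b]; rewrite /A /= => lr.
    have := Re_le_cmod (a +i* b); have := Im_le_cmod (a +i* b) => /=.
    rewrite /h /= in lr; rewrite !in_itv /= !ler_norml => /andP[? ?] /andP[? ?].
    by split; apply/andP; split; lra.
have A0 : (A !=set0)%classic by exists (0, 0); rewrite /A /= /h /= cmod0.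
have cfA : ({within A, continuous (fun p => f (h p))})%classic.
  apply: continuous_in_subspaceT => p; rewrite inE => Ap.
  apply/cvgrPdist_lt => e e0; have [d d0 hd] := cf (h p) e Ap e0.
  near=> q; rewrite distrC; apply: hd; near: q; exact: near_h.
have [p] := compact_EVT_max A0 cA cfA; rewrite inE => Ap pm.
exists (h p) => // y ly.
have := pm (complex.Re y, complex.Im y); rewrite inE /A /= /h /=.
by case: y ly => a b /= ly; exact.
Unshelve. all: by end_near. Qed.

(** Holomorphy enters through the single complex coefficient at each order. The cubic remainder
    stays below the gain of order t^2 in the four-point mean. *)
Definition taylor2 (f : C -> C) z := exists (a b : C) (K d : R),
  [/\ 0 < d, 0 <= K &
  forall h, N h <= d -> N (f (z + h) - (f z + a * h + b * h ^+ 2)) <= K * N h ^+ 3].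

(** Orthogonality over the fourth roots of unity: the cross terms between different powers of h
    cancel in the sum. *)
Lemma four_point_mean (f0 a b : C) (t : R) :
  let q h := f0 + a * h + b * h ^+ 2 in
  N (q t%:C) ^+ 2 + N (q (- t%:C)) ^+ 2 + N (q (t *i)) ^+ 2 + N (q (- (t *i))) ^+ 2
  = 4 * (N f0 ^+ 2 + N a ^+ 2 * t ^+ 2 + N b ^+ 2 * t ^+ 4).
Proof.
rewrite /= !sqr_cmod; case: f0 a b => [x0 y0] [x1 y1] [x2 y2] /=; rewrite !expr2 /=.
ring.
Qed.

End ComplexModulus.

Section MaximumPrinciple.
Variable R : realType.
Local Notation C := R[i].
Local Notation N := (@cmod R).
Implicit Types (f : C -> C) (z : C).

Lemma sqr_near (b e : R) : 0 <= b -> 0 < e ->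
  exists2 d : R, 0 < d & forall a, `|a - b| < d -> `|a ^+ 2 - b ^+ 2| < e.
Proof.
move=> b0 e0; exists (Num.min 1 (e / (1 + 2 * b))).
  by rewrite lt_min ltr01 divr_gt0 //; lra.
move=> a; rewrite lt_min => /andP[h1 h2].
rewrite subr_sqr normrM.
have h3 : `|a + b| <= 1 + 2 * b.
  have -> : a + b = (a - b) + 2 * b by ring.
  apply: le_trans (ler_normD _ _) _; rewrite (ger0_norm (_ : 0 <= 2 * b)); lra.
apply: le_lt_trans (ler_wpM2l (normr_ge0 _) h3) _.
by rewrite -ltr_pdivlMr //; lra.
Qed.

Lemma dist_cmod_le (a b : C) : `|N a - N b| <= N (a - b).
Proof.
rewrite ler_norml; apply/andP; split; last exact: cmodB_ge.
by rewrite cmod_distC; have := cmodB_ge b a; lra.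
Qed.

(* By [four_point_mean], the mean of [|f|^2 + e|z|^2] over the four points
   [z + i^k t] exceeds its value at [z]. *)
Lemma taylor2_no_max f z (e rho : R) : taylor2 f z -> 0 < e -> 0 < rho ->
  exists2 y, N (y - z) < rho & N (f z) ^+ 2 + e * N z ^+ 2 < N (f y) ^+ 2 + e * N y ^+ 2.
Proof.
move=> [a [b [K [d [d0 K0 fe]]]]] e0 rho0.
pose S := N (f z) + N a + N b + 1.
have S0 : 0 < S by rewrite /S; have := cmod_ge0 (f z); have := cmod_ge0 a; have := cmod_ge0 b; lra.
(* The bounds 1 and [d] serve the expansion, rho / 2 keeps the points near [z], and the last one
   makes the error 2 S K t^3 smaller than the gain e t^2. *)
pose t := Num.min (Num.min 1 d) (Num.min (rho / 2) (e / (4 * S * (K + 1)))).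
have SK : 0 < 4 * S * (K + 1) by rewrite !mulr_gt0 //; lra.
have [t0 t1 td trho te] : [/\ 0 < t, t <= 1, t <= d, t < rho & t * (4 * S * (K + 1)) <= e].
  split; rewrite /t.
  - by rewrite !lt_min ltr01 d0 !divr_gt0.
  - by rewrite !ge_min lexx.
  - by rewrite !ge_min lexx orbT.
  - by rewrite !gt_min (_ : rho / 2 < rho) ?orbT //; lra.
  - by rewrite -ler_pdivlMr // !ge_min lexx !orbT.
pose q h := f z + a * h + b * h ^+ 2.
have key h : N h = t -> N (q h) ^+ 2 - 2 * S * K * t ^+ 3 <= N (f (z + h)) ^+ 2.
  move=> ht; have := fe h; rewrite ht => /(_ td) h1.
  have qS : N (q h) <= S.
    apply: le_trans (cmodD _ _) _; rewrite cmodM cmodX ht.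
    apply: le_trans (lerD (cmodD _ _) (lexx _)) _; rewrite cmodM ht.
    have : N a * t <= N a by rewrite ler_piMr // cmod_ge0.
    have : N b * t ^+ 2 <= N b by rewrite ler_piMr ?cmod_ge0 // exprn_ile1 // ltW.
    by rewrite /S; lra.
  have h2 : N (q h) - K * t ^+ 3 <= N (f (z + h)).
    by have := cmodB_ge (q h) (f (z + h)); rewrite cmod_distC /q; lra.
  have x0 : 0 <= K * t ^+ 3 by rewrite mulr_ge0 // exprn_ge0 // ltW.
  set x := K * _ in x0 h2; have -> : 2 * S * K * t ^+ 3 = 2 * S * x by rewrite /x; ring.
  have := cmod_ge0 (q h); have := cmod_ge0 (f (z + h)).
  move: (N (q h)) (N (f (z + h))) qS h2 => u v qS h2 v0 u0.
  have h3 : u * x <= S * x by rewrite ler_wpM2r.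
  (* For u > x square the inequality u - x <= v; for u <= x the left side is already nonpositive, as
     u^2 <= S x. *)
  have [ux|xu] := lerP u x; last by nra.
  by have := sqr_ge0 v; nra.
have Nt : N t%:C = t by rewrite cmod_real gtr0_norm.
have Nit : N (t *i) = t.
  by rewrite /cmod /= expr0n add0r sqrtr_sqr gtr0_norm.
have k1 := key _ Nt; have k2 := key (- t%:C); have k3 := key _ Nit; have k4 := key (- (t *i)).
rewrite !cmodN in k2 k4; move: {k2 k4} (k2 Nt) (k4 Nit) => k2 k4.
have m1 := four_point_mean (f z) a b t.
(* The same identity for the function [id] gives the gain t^2 in the mean of |z|^2. *)
have m2 := four_point_mean z 1 0 t.
rewrite /= in m1 m2; rewrite !mul1r !mul0r !addr0 cmod1 cmod0 expr1n mul1r in m2.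
rewrite expr0n mul0r addr0 in m2.
have Kt : 2 * S * K * t ^+ 3 < e * t ^+ 2.
  have -> : 2 * S * K * t ^+ 3 = (t * (2 * S * K)) * t ^+ 2 by ring.
  rewrite ltr_pM2r ?exprn_gt0 //.
  have : 0 < t * S by rewrite mulr_gt0.
  nra.
have at2 : 0 <= N a ^+ 2 * t ^+ 2 by rewrite mulr_ge0 ?sqr_ge0.
have bt2 : 0 <= N b ^+ 2 * t ^+ 4 by rewrite mulr_ge0 ?sqr_ge0 ?exprn_ge0 // ltW.
pose phi y := N (f y) ^+ 2 + e * N y ^+ 2.
have [//|nex] := pselect (exists2 y, N (y - z) < rho & phi z < phi y).
have nphi h : N h = t -> phi (z + h) <= phi z.
  move=> ht; rewrite leNgt; apply/negP => lt; apply: nex; exists (z + h) => //.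
  by rewrite addrC addKr ht.
have p1 := nphi _ Nt; have p2 := nphi (- t%:C); have p3 := nphi _ Nit; have p4 := nphi (- (t *i)).
rewrite !cmodN in p2 p4; move: {p2 p4} (p2 Nt) (p4 Nit) => p2 p4.
rewrite /q in k1 k2 k3 k4; rewrite /phi in p1 p2 p3 p4; exfalso.
nra.
Qed.

(** Adding e|z|^2 to |f|^2 excludes an interior maximum, and [e] is so small that the sum at [z1]
    still exceeds its values on the circle. The 1 in the denominator of [e] covers r = 0. *)
Lemma max_principle f (r M : R) : 0 <= r ->
  (forall z, N z <= r -> ccont f z) -> (forall z, N z < r -> taylor2 f z) ->
  (forall z, N z = r -> N (f z) <= M) -> forall z, N z <= r -> N (f z) <= M.
Proof.
move=> r0 cf tf bM z1 z1r; rewrite leNgt; apply/negP => lt.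
have M0 : 0 <= M by apply: le_trans (cmod_ge0 _) (bM r%:C _); rewrite cmod_real ger0_norm.
pose e := (N (f z1) ^+ 2 - M ^+ 2) / (2 * (r ^+ 2 + 1)).
have D0 : 0 < 2 * (r ^+ 2 + 1) by rewrite mulr_gt0 //; have := sqr_ge0 r; lra.
have e0 : 0 < e by rewrite divr_gt0 // subr_gt0 ltr_pXn2r ?nnegrE ?cmod_ge0.
have er : e * r ^+ 2 < N (f z1) ^+ 2 - M ^+ 2.
  rewrite -[ltRHS](@divfK _ (2 * (r ^+ 2 + 1))) ?gt_eqF // -/e.
  by rewrite ltr_pM2l //; have := sqr_ge0 r; lra.
have [z zr zm] : exists2 z, N z <= r & forall y, N y <= r ->
    N (f y) ^+ 2 + e * N y ^+ 2 <= N (f z) ^+ 2 + e * N z ^+ 2.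
  apply: disc_max => // z eps zr eps0.
  have eps2 : 0 < eps / 2 by lra.
  have [d1 d10 h1] := sqr_near (cmod_ge0 (f z)) eps2.
  have [d2 d20 h2] := cf z zr d1 d10.
  have [d3 d30 h3] := sqr_near (cmod_ge0 z) (divr_gt0 eps2 e0).
  exists (Num.min d2 d3); first by rewrite lt_min d20.
  move=> y; rewrite lt_min => /andP[l2 l3].
  have {}h2 := h1 _ (le_lt_trans (dist_cmod_le _ _) (h2 y l2)).
  have {}h3 := h3 _ (le_lt_trans (dist_cmod_le _ _) l3).
  rewrite ltr_pdivlMr // mulrC in h3.
  have -> : N (f y) ^+ 2 + e * N y ^+ 2 - (N (f z) ^+ 2 + e * N z ^+ 2) =
     (N (f y) ^+ 2 - N (f z) ^+ 2) + e * (N y ^+ 2 - N z ^+ 2) by ring.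
  apply: le_lt_trans (ler_normD _ _) _; rewrite (normrM e) (gtr0_norm e0); lra.
have z1z := zm _ z1r.
have Nz1 : 0 <= e * N z1 ^+ 2 by rewrite mulr_ge0 ?sqr_ge0 // ltW.
have zltr : N z < r.
  rewrite lt_neqAle zr andbT; apply/eqP => zr'.
  have := bM z zr' => h; rewrite zr' in z1z.
  have : N (f z) ^+ 2 <= M ^+ 2 by rewrite ler_pXn2r ?nnegrE ?cmod_ge0.
  lra.
have rz : 0 < r - N z by lra.
have [y yz hy] := taylor2_no_max (tf z zltr) e0 rz.
have := zm y; have yr : N y <= r.
  by have := cmodB_ge y z; lra.
by move=> /(_ yr); lra.
Qed.

End MaximumPrinciple.

(** * Entire functions *)

(* Sealed: conversion would otherwise unfold [derive1] down to filters. *)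
HB.lock Definition cder (R : realType) (f : R[i] -> R[i]) : R[i] -> R[i] :=
  @derive1 R[i] R[i]^o f.

Section EntireFunctions.
Variable R : realType.
Local Notation C := R[i].
Local Notation N := (@cmod R).
Implicit Types (f g : C -> C) (z c : C).

Lemma inv_small (K e : R) : 0 <= K -> 0 < e ->
  exists n0 : nat, forall n, (n0 <= n)%N -> K / n.+1%:R <= e.
Proof.
move=> K0 e0; exists (Num.Def.archi_bound (K / e)) => n hn.
have Ke : 0 <= K / e by rewrite divr_ge0 // ltW.
have := archi_boundP Ke => h.
rewrite ler_pdivrMr ?ltr0Sn // mulrC -ler_pdivrMr //.
apply: le_trans (ltW h) _; rewrite ler_nat; lia.
Qed.

(** The intervals [u n - k n, u n + k n] meet pairwise, and the supremum of their left ends lies in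
    all of them. *)
Lemma R_complete (u k : nat -> R) (n0 : nat) : (forall n, 0 <= k n) ->
  (forall n m, (n0 <= n)%N -> (n <= m)%N -> `|u n - u m| <= k n) ->
  exists l, forall n, (n0 <= n)%N -> `|u n - l| <= k n.
Proof.
move=> k0 hu.
pose E : set R := [set x | exists2 n, (n0 <= n)%N & x = u n - k n]%classic.
have ub m : (n0 <= m)%N -> ubound E (u m + k m).
  move=> hm x [n hn ->].
  case/orP: (leq_total n m) => nm.
    by have := hu n m hn nm; rewrite ler_norml => /andP[]; have := k0 m; lra.
  by have := hu m n hm nm; rewrite ler_norml => /andP[]; have := k0 n; lra.
have E0 : (E !=set0)%classic by exists (u n0 - k n0), n0.
have sE : has_sup E by split => //; exists (u n0 + k n0); exact: ub.
exists (sup E) => n hn.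
have h1 := ge_sup E0 (ub n hn).
have h2 : u n - k n <= sup E by apply: (sup_upper_bound sE); exists n.
by rewrite ler_norml; apply/andP; split; lra.
Qed.

Lemma C_complete (u : nat -> C) (k : nat -> R) (n0 : nat) : (forall n, 0 <= k n) ->
  (forall n m, (n0 <= n)%N -> (n <= m)%N -> N (u n - u m) <= k n) ->
  exists l, forall n, (n0 <= n)%N -> N (u n - l) <= 2 * k n.
Proof.
move=> k0 hu.
have [|a ha] := @R_complete (fun n => complex.Re (u n)) k n0 k0.
  move=> n m hn nm; apply: le_trans (hu n m hn nm).
  by have := Re_le_cmod (u n - u m); case: (u n) (u m) => ? ? [? ?].
have [|b hb] := @R_complete (fun n => complex.Im (u n)) k n0 k0.
  move=> n m hn nm; apply: le_trans (hu n m hn nm).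
  by have := Im_le_cmod (u n - u m); case: (u n) (u m) => ? ? [? ?].
exists (a +i* b) => n hn; apply: le_trans (cmod_le_ReIm _) _.
have := ha n hn; have := hb n hn; case: (u n) => x y /=; lra.
Qed.

(* Locally uniform limits of polynomials: this class is visibly closed under
   sums, products, composition and limits, and the maximum principle gives it
   difference quotients and derivatives without any contour integral. *)
Definition entire f := forall r e : R, 0 < e ->
  exists p : {poly C}, forall z, N z <= r -> N (f z - p.[z]) <= e.

Definition loc_bounded f := forall r : R, exists2 M : R, 0 < M &
  forall z, N z <= r -> N (f z) <= M.

Lemma poly_bounded (p : {poly C}) : loc_bounded (horner p).
Proof.
move=> r; exists (1 + \sum_(i < size p) N p`_i * (1 + `|r|) ^+ i).
  rewrite ltr_wpDr ?sumr_ge0 // => i _.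
  by rewrite mulr_ge0 ?cmod_ge0 // exprn_ge0 // addr_ge0.
move=> z zr; rewrite horner_coef; apply: le_trans (cmod_sum _ _ _) _.
apply: ler_wpDl => //; apply: ler_sum => i _; rewrite cmodM cmodX.
apply: ler_wpM2l; first exact: cmod_ge0.
apply: lerXn2r; rewrite ?nnegrE ?cmod_ge0 ?addr_ge0 //.
have := ler_norm r; lra.
Qed.

Lemma entire_poly (p : {poly C}) : entire (horner p).
Proof. by move=> r e e0; exists p => z _; rewrite subrr cmod0 ltW. Qed.

Lemma entire_ext f g : f =1 g -> entire f -> entire g.
Proof. by move=> /funext ->. Qed.

Lemma entire_cst c : entire (fun=> c).
Proof. by apply: entire_ext (entire_poly c%:P) => z; rewrite hornerC. Qed.

Lemma entire_id : entire id.
Proof. by apply: entire_ext (entire_poly 'X) => z; rewrite hornerX. Qed.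

Lemma entire_bounded f : entire f -> loc_bounded f.
Proof.
move=> ef r; have [p hp] := ef r 1 ltr01; have [M M0 hM] := poly_bounded p r.
exists (1 + M) => [|z zr]; first by lra.
by have := cmodB_ge (f z) p.[z]; have := hp z zr; have := hM z zr; lra.
Qed.

Lemma entire_lim f : (forall r e : R, 0 < e ->
  exists2 g, entire g & forall z, N z <= r -> N (f z - g z) <= e) -> entire f.
Proof.
move=> h r e e0; have e2 : 0 < e / 2 by lra.
have [g eg hg] := h r _ e2; have [p hp] := eg r _ e2.
exists p => z zr; have -> : f z - p.[z] = (f z - g z) + (g z - p.[z]) by ring.
by apply: le_trans (cmodD _ _) _; have := hg z zr; have := hp z zr; lra.
Qed.

Lemma entireD f g : entire f -> entire g -> entire (fun z => f z + g z).
Proof.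
move=> ef eg r e e0; have e2 : 0 < e / 2 by lra.
have [p hp] := ef r _ e2; have [q hq] := eg r _ e2.
exists (p + q) => z zr; rewrite hornerD.
have -> : f z + g z - (p.[z] + q.[z]) = (f z - p.[z]) + (g z - q.[z]) by ring.
by apply: le_trans (cmodD _ _) _; have := hp z zr; have := hq z zr; lra.
Qed.

Lemma entireM f g : entire f -> entire g -> entire (fun z => f z * g z).
Proof.
move=> ef eg r e e0.
have [A A0 hA] := entire_bounded ef r; have [B B0 hB] := entire_bounded eg r.
have e1 : 0 < Num.min 1 (e / 2 / A) by rewrite lt_min ltr01 !divr_gt0.
have B1 : 0 < B + 1 by lra.
have e2 : 0 < e / 2 / (B + 1) by rewrite !divr_gt0.
have [q hq] := eg r _ e1; have [p hp] := ef r _ e2.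
exists (p * q) => z zr; rewrite hornerM.
have -> : f z * g z - p.[z] * q.[z] = f z * (g z - q.[z]) + (f z - p.[z]) * q.[z] by ring.
apply: le_trans (cmodD _ _) _; rewrite !cmodM.
have := hq z zr; rewrite le_min => /andP[h1 h2].
have h3 : N q.[z] <= B + 1.
  by have := cmodB_ge q.[z] (g z); rewrite cmod_distC; have := hB z zr; lra.
have h4 : N (f z) * N (g z - q.[z]) <= e / 2.
  apply: le_trans (ler_pM (cmod_ge0 _) (cmod_ge0 _) (hA z zr) h2) _.
  by rewrite mulrC divfK // gt_eqF.
have h5 : N (f z - p.[z]) * N q.[z] <= e / 2.
  apply: le_trans (ler_pM (cmod_ge0 _) (cmod_ge0 _) (hp z zr) h3) _.
  by rewrite divfK // gt_eqF.
lra.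
Qed.

Lemma entireN f : entire f -> entire (fun z => - f z).
Proof.
by move=> ef; apply: entire_ext (entireM (entire_cst (-1)) ef) => z; rewrite mulN1r.
Qed.

Lemma entireB f g : entire f -> entire g -> entire (fun z => f z - g z).
Proof. by move=> ef eg; exact: entireD ef (entireN eg). Qed.

Lemma entireX f n : entire f -> entire (fun z => f z ^+ n).
Proof.
move=> ef; elim: n => [|n IH]; first exact: entire_cst.
by apply: entire_ext (entireM ef IH) => z; rewrite exprS.
Qed.

Lemma entire_sum (I : Type) (s : seq I) (P : pred I) (F : I -> C -> C) :
  (forall i, entire (F i)) -> entire (fun z => \sum_(i <- s | P i) F i z).
Proof.
move=> eF; elim: s => [|i s IH].
  by apply: entire_ext (entire_cst 0) => z; rewrite big_nil.
case Pi: (P i).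
  by apply: entire_ext (entireD (eF i) IH) => z; rewrite big_cons Pi.
by apply: entire_ext IH => z; rewrite big_cons Pi.
Qed.

Lemma entire_prod (I : Type) (s : seq I) (P : pred I) (F : I -> C -> C) :
  (forall i, entire (F i)) -> entire (fun z => \prod_(i <- s | P i) F i z).
Proof.
move=> eF; elim: s => [|i s IH].
  by apply: entire_ext (entire_cst 1) => z; rewrite big_nil.
case Pi: (P i).
  by apply: entire_ext (entireM (eF i) IH) => z; rewrite big_cons Pi.
by apply: entire_ext IH => z; rewrite big_cons Pi.
Qed.

Lemma entire_comp f g : entire f -> entire g -> entire (fun z => f (g z)).
Proof.
move=> ef eg; apply: entire_lim => r e e0.
have [M _ hM] := entire_bounded eg r; have [p hp] := ef M e e0.
exists (fun z => p.[g z]); last by move=> z zr; exact/hp/hM.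
elim/poly_ind: p {hp} => [|p c IH].
  by apply: entire_ext (entire_cst 0) => z; rewrite horner0.
by apply: entire_ext (entireD (entireM IH eg) (entire_cst c)) => z; rewrite hornerMXaddC.
Qed.

(* [g] is the difference quotient of [f] at [c]; its value at [c] is the derivative. *)
Definition quotient_at f c g := forall z, f z = f c + (z - c) * g z.

Lemma poly_quotient_deriv (p : {poly C}) c : exists2 q : {poly C},
  quotient_at (horner p) c (horner q) & q.[c] = p^`().[c].
Proof.
have [q hq] : exists q, p - (p.[c])%:P = q * ('X - c%:P).
  by apply/factor_theorem; rewrite /root !hornerE subrr.
exists q => [z|].
  have := congr1 (fun p => p.[z]) hq.
  by rewrite !hornerE => h; rewrite mulrC -h; ring.
have := congr1 (fun p => p^`().[c]) hq.
by rewrite derivB derivM derivB derivX !derivC !hornerE subrr mulr0 add0r !subr0 mulr1 => ->.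
Qed.

Lemma poly_quotient (p : {poly C}) c : exists q : {poly C}, quotient_at (horner p) c (horner q).
Proof. by have [q hq _] := poly_quotient_deriv p c; exists q. Qed.

Lemma ccont_quotient f c g : loc_bounded g -> quotient_at f c g -> ccont f c.
Proof.
move=> bg fg e e0; have [M M0 hM] := bg (N c + 1).
exists (Num.min 1 (e / M)); first by rewrite lt_min ltr01 divr_gt0.
move=> y; rewrite lt_min => /andP[h1 h2].
have yc : N y <= N c + 1 by have := cmodB_ge y c; lra.
rewrite (fg y) addrC addKr cmodM.
have := hM y yc; rewrite ltr_pdivlMr // in h2; have := cmod_ge0 (y - c); nra.
Qed.

(** Nesting the three quotients gives the expansion in Horner form, with [f3] as the coefficient of
    the cubic remainder. *)
Lemma taylor2_quotient f f1 f2 f3 c : loc_bounded f3 -> quotient_at f c f1 ->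
  quotient_at f1 c f2 -> quotient_at f2 c f3 -> taylor2 f c.
Proof.
move=> b3 h1 h2 h3; have [M M0 hM] := b3 (N c + 1).
exists (f1 c), (f2 c), M, 1; split; [by []|exact: ltW|move=> h hh].
have hc : c + h - c = h by rewrite addrAC subrr add0r.
rewrite (h1 (c + h)) (h2 (c + h)) (h3 (c + h)) hc.
have -> : f c + h * (f1 c + h * (f2 c + h * f3 (c + h))) -
   (f c + f1 c * h + f2 c * h ^+ 2) = f3 (c + h) * h ^+ 3 by ring.
rewrite cmodM cmodX ler_wpM2r ?exprn_ge0 ?cmod_ge0 //; apply: hM.
by apply: le_trans (cmodD _ _) _; rewrite lerD2l.
Qed.

Lemma ccont_shift f c z : ccont f (c + z) -> ccont (fun w => f (c + w)) z.
Proof.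
move=> cf e e0; have [d d0 hd] := cf e e0; exists d => // y hy; apply: hd.
by rewrite opprD addrACA subrr add0r.
Qed.

Lemma taylor2_shift f c z : taylor2 f (c + z) -> taylor2 (fun w => f (c + w)) z.
Proof.
move=> [a [b [K [d [d0 K0 h]]]]]; exists a, b, K, d; split => // y hy.
by rewrite addrA; exact: h.
Qed.

Lemma max_principle_at f c (r M : R) : 0 <= r ->
  (forall z, ccont f z) -> (forall z, taylor2 f z) ->
  (forall z, N (z - c) = r -> N (f z) <= M) -> forall z, N (z - c) <= r -> N (f z) <= M.
Proof.
move=> r0 cf tf bM z zr.
have := @max_principle _ (fun w => f (c + w)) r M r0 _ _ _ (z - c) zr.
rewrite addrCA subrr addr0; apply => w hw.
- exact/ccont_shift/cf.
- exact/taylor2_shift/tf.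
- by apply: bM; rewrite addrAC subrr add0r.
Qed.

(** On the circle, g is (f z - f c) / (z - c), of modulus at most 2M / r; the maximum principle
    carries the bound inside. This replaces Cauchy's integral formula. *)
Lemma cauchy_estimate f c g (r M : R) : 0 < r ->
  (forall z, ccont g z) -> (forall z, taylor2 g z) -> quotient_at f c g ->
  (forall z, N (z - c) <= r -> N (f z) <= M) ->
  forall z, N (z - c) <= r -> N (g z) <= 2 * M / r.
Proof.
move=> r0 cg tg fg bM; apply: max_principle_at => // [|z zr]; first exact: ltW.
rewrite ler_pdivlMr // mulrC -{1}zr -cmodM.
have -> : (z - c) * g z = f z - f c by rewrite (fg z); ring.
apply: le_trans (cmodB _ _) _.
have := bM z; rewrite zr => /(_ (lexx _)); have := bM c.
by rewrite subrr cmod0 => /(_ (ltW r0)); lra.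
Qed.

Lemma poly_ccont (p : {poly C}) z : ccont (horner p) z.
Proof. by have [q hq] := poly_quotient p z; exact: ccont_quotient (poly_bounded q) hq. Qed.

Lemma poly_taylor2 (p : {poly C}) z : taylor2 (horner p) z.
Proof.
have [p1 h1] := poly_quotient p z; have [p2 h2] := poly_quotient p1 z.
have [p3 h3] := poly_quotient p2 z.
exact: taylor2_quotient (poly_bounded p3) h1 h2 h3.
Qed.

(** Hides 1/(n + 1) behind three properties, so that the estimates of [entire_quotient] are linear
    in an atom. *)
Lemma null_sequence : exists iv : nat -> R, [/\ forall n, 0 < iv n,
  forall n m, (n <= m)%N -> iv m <= iv n &
  forall K e : R, 0 <= K -> 0 < e -> exists n0, forall n, (n0 <= n)%N -> K * iv n <= e].
Proof.
exists (fun n => n.+1%:R^-1); split=> [n|n m nm|]; last exact: inv_small.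
  by rewrite invr_gt0 ltr0Sn.
by rewrite lef_pV2 ?posrE ?ltr0Sn // ler_nat ltnS.
Qed.

(** The quotients [q n] of approximating polynomials converge uniformly: within distance 1 of [c] by
    [cauchy_estimate] ([cau]), farther away by dividing by z - c ([far]). The value of [g] at [c] is
    the limit of [q n] there. *)
Lemma entire_quotient f c : entire f -> exists2 g, entire g & quotient_at f c g.
Proof.
move=> ef.
have [iv [i0 ile ismall]] := null_sequence.
have /choice [p hp] : forall n : nat, exists p : {poly C},
    forall z, N z <= n%:R -> N (f z - p.[z]) <= iv n.
  by move=> n; exact: ef.
have /choice [q hq] : forall n : nat, exists q : {poly C}, quotient_at (horner (p n)) c (horner q).
  by move=> n; exact: poly_quotient.
pose n0 := Num.Def.archi_bound (N c + 1).
have n0P n : (n0 <= n)%N -> N c + 1 <= n%:R.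
  move=> hn; have := archi_boundP (addr_ge0 (cmod_ge0 c) ler01) => h.
  by apply: le_trans (ltW h) _; rewrite ler_nat.
have cau n m z : (n0 <= n)%N -> (n <= m)%N -> N (z - c) <= 1 ->
    N ((q n).[z] - (q m).[z]) <= 4 * iv n.
  move=> hn nm zc.
  have hd : quotient_at (horner (p n - p m)) c (horner (q n - q m)).
    by move=> w; rewrite !hornerD !hornerN (hq n w) (hq m w); ring.
  have -> : 4 * iv n = 2 * (2 * iv n) / 1  by rewrite divr1; ring.
  rewrite -hornerN -hornerD.
  apply: (cauchy_estimate ltr01 (@poly_ccont _) (@poly_taylor2 _) hd) => // w wc.
  have wn : N w <= n%:R by have := cmodB_ge w c; have := n0P n hn; lra.
  have wm : N w <= m%:R by apply: le_trans wn _; rewrite ler_nat.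
  rewrite hornerD hornerN.
  have -> : (p n).[w] - (p m).[w] = (f w - (p m).[w]) - (f w - (p n).[w]) by ring.
  apply: le_trans (cmodB _ _) _.
  have := hp n w wn; have := hp m w wm; have := ile n m nm; lra.
have [l hl] : exists l, forall n, (n0 <= n)%N -> N ((q n).[c] - l) <= 2 * (4 * iv n).
  apply: C_complete => [n|n m hn nm]; first by rewrite mulr_ge0 // ltW.
  by apply: cau; rewrite // subrr cmod0.
pose g z := if z == c then l else (f z - f c) / (z - c).
have fg : quotient_at f c g.
  move=> z; rewrite /g; case: eqVneq => [->|zc]; first by rewrite subrr mul0r addr0.
  by rewrite mulrC divfK ?subr_eq0 // addrC subrK.
have far n z : (n0 <= n)%N -> N z <= n%:R -> z != c ->
    N ((q n).[z] - g z) * N (z - c) <= 2 * iv n.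
  move=> hn zn zc; rewrite -cmodM.
  have -> : ((q n).[z] - g z) * (z - c) = (f c - (p n).[c]) - (f z - (p n).[z]).
    by rewrite (fg z) (hq n z); ring.
  have cn : N c <= n%:R by have := n0P n hn; lra.
  by apply: le_trans (cmodB _ _) _; have := hp n z zn; have := hp n c cn; lra.
(* The bound [far] degenerates as z tends to [c]. So an index [m] depending on z makes it smaller
   than [iv n], and [cau] compares [q n] with [q m] uniformly in z. *)
have near n z : (n0 <= n)%N -> N (z - c) <= 1 -> N ((q n).[z] - g z) <= 8 * iv n.
  move=> hn z1; have [->|zc] := eqVneq z c.
    by rewrite /g eqxx; have := hl n hn; lra.
  have Nzc : 0 < N (z - c) by rewrite cmod_gt0 subr_eq0.
  have K0 : 0 <= 2 / N (z - c) by rewrite divr_ge0 // ltW.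
  have [n1 h1] := ismall _ _ K0 (i0 n).
  pose m := maxn n n1.
  have nm : (n <= m)%N by rewrite leq_maxl.
  have zm : N z <= m%:R.
    by have := cmodB_ge z c; have := n0P m (leq_trans hn nm); lra.
  have := far m z (leq_trans hn nm) zm zc; rewrite -ler_pdivlMr //.
  have := h1 m (leq_maxr _ _).
  have -> : 2 / N (z - c) * iv m = 2 * iv m / N (z - c) by ring.
  have := cau n m z hn nm z1.
  have -> : (q n).[z] - g z = ((q n).[z] - (q m).[z]) + ((q m).[z] - g z) by ring.
  have := cmodD ((q n).[z] - (q m).[z]) ((q m).[z] - g z).
  have := i0 n; lra.
exists g => // r e e0.
have [n1 h1] := ismall 8 e (ler0n _ _) e0.
pose n := maxn (maxn n0 n1) (Num.Def.archi_bound `|r|).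
exists (q n) => z zr; rewrite cmod_distC.
have hn : (n0 <= n)%N by rewrite /n -maxnA leq_maxl.
have := h1 n; rewrite /n [maxn n0 n1]maxnC -maxnA leq_maxl => /(_ isT); rewrite maxnA (maxnC n1) -/n => h2.
have zn : N z <= n%:R.
  have := archi_boundP (normr_ge0 r); have := ler_norm r => h3 h4.
  have : (Num.Def.archi_bound `|r|)%:R <= n%:R :> R by rewrite ler_nat leq_maxr.
  lra.
have [z1|z1] := lerP (N (z - c)) 1.
  by have := near n z hn z1; lra.
have zc : z != c by apply/eqP => zc; move: z1; rewrite zc subrr cmod0; lra.
have := far n z hn zn zc; have := i0 n; have := cmod_ge0 ((q n).[z] - g z); nra.
Qed.

Lemma entire_ccont f z : entire f -> ccont f z.
Proof.
by move=> ef; have [g /entire_bounded bg hg] := entire_quotient z ef; exact: ccont_quotient bg hg.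
Qed.

Lemma entire_taylor2 f z : entire f -> taylor2 f z.
Proof.
move=> ef; have [f1 e1 h1] := entire_quotient z ef; have [f2 e2 h2] := entire_quotient z e1.
have [f3 /entire_bounded b3 h3] := entire_quotient z e2.
exact: taylor2_quotient b3 h1 h2 h3.
Qed.

(** A quotient near [c] is enough, so the lemma applies to germs as well as to entire functions. *)
Lemma cder_quotient f c g (d : R) : 0 < d -> ccont g c ->
  (forall z, N (z - c) < d -> f z = f c + (z - c) * g z) -> cder f c = g c.
Proof.
move=> d0 cg fg; rewrite cder.unlock /derive1.
apply: (@cvg_lim C^o) => //; apply/cvgrPdist_lt => e e0.
have ee : e = (complex.Re e)%:C by rewrite RRe_real // gtr0_real.
have e0' : 0 < complex.Re e by rewrite -ltcR -ee.
have [d1 d10 hd1] := cg _ e0'.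
have dm : 0 < (Num.min d d1)%:C by rewrite ltcR lt_min d0.
near=> h.
have h0 : h != 0 by near: h; exact: nbhs_dnbhs_neq.
have : `|h| < (Num.min d d1)%:C by near: h; exact: dnbhs0_lt.
rewrite normr_cmod ltcR lt_min => /andP[hd hdd].
have hc : h + c - c = h by rewrite addrK.
rewrite (fg (h + c)) hc // [f c + _]addrC addrK /GRing.scale /= mulKf //.
by rewrite distrC normr_cmod ee ltcR; apply: hd1; rewrite hc.
Unshelve. all: by end_near. Qed.

(** If f - p is at most e/2 on the disc of radius r + 1, the Cauchy estimate on unit discs bounds f'
    - p' by e on the disc of radius r. *)
Lemma entire_cder f : entire f -> entire (cder f).
Proof.
move=> ef r e e0; have e2 : 0 < e / 2 by lra.
have [p hp] := ef (r + 1) _ e2.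
exists p^`() => c cr; have [g eg hg] := entire_quotient c ef.
have -> : cder f c = g c.
  by apply: (cder_quotient ltr01) => // *; exact: entire_ccont.
have [q hq <-] := poly_quotient_deriv p c.
have := @cauchy_estimate (fun z => f z - p.[z]) c (fun z => g z - q.[z]) 1 (e / 2) ltr01.
have eh : entire (fun z => g z - q.[z]) by apply: entireB => //; exact: entire_poly.
move=> /(_ (fun z => entire_ccont z eh) (fun z => entire_taylor2 z eh)).
have -> : 2 * (e / 2) / 1 = e by field.
move=> h; apply: (h _ _ c); last by rewrite subrr cmod0.
- by move=> z; rewrite (hg z) (hq z); ring.
- by move=> z zc; apply: hp; have := cmodB_ge z c; lra.
Qed.

End EntireFunctions.

(** The hypothesis is selected by syntactic comparison, before any unification up to conversion. *)
Ltac entire_hyp f := match goal with H : entire ?h |- _ => constr_eq h f; exact: H end.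

Ltac entire_tac := try match goal with
  | |- entire (fun=> ?c) => exact: (entire_cst c)
  | |- entire (fun z => z) => exact: entire_id
  | |- entire (fun z => ?f z) => entire_hyp f
  | |- entire (fun z => @?f z + @?g z) => apply: (@entireD _ f g); entire_tac
  | |- entire (fun z => @?f z * @?g z) => apply: (@entireM _ f g); entire_tac
  | |- entire (fun z => - @?f z) => apply: (@entireN _ f); entire_tac
  | |- entire (fun z => @?f z ^+ ?n) => apply: (@entireX _ f n); entire_tac
  | |- entire (fun z => ?f (@?g z)) =>
      apply: (@entire_comp _ f g); [entire_hyp f | entire_tac]
  | |- entire (@id _) => exact: entire_id
  | |- entire ?f => entire_hyp f
  end.

(** * Holomorphic functions and Liouville's theorem *)

Section HolomorphicFunctions.
Variable R : realType.
Local Notation C := R[i].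
Local Notation N := (@cmod R).
Implicit Types (f g : C -> C) (z c : C).

Lemma entire_tangent f c : entire f ->
  exists g, [/\ entire g, quotient_at f c g & g c = cder f c].
Proof.
move=> ef; have [g eg hg] := entire_quotient c ef; exists g; split=> //.
by symmetry; apply: (cder_quotient ltr01) => // *; exact: entire_ccont.
Qed.

Lemma cder_entire f c g : entire g -> quotient_at f c g -> cder f c = g c.
Proof. by move=> eg hg; apply: (cder_quotient ltr01) => // *; exact: entire_ccont. Qed.

Lemma cder_cst (k c : C) : cder (fun=> k) c = 0.
Proof.
by apply: (@cder_entire _ _ (fun=> 0)) => [|z]; [exact: entire_cst|rewrite mulr0 addr0].
Qed.

Lemma cder_id c : cder id c = 1.
Proof.
apply: (@cder_entire _ _ (fun=> 1)) => [|z]; first exact: entire_cst.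
by rewrite mulr1 addrC subrK.
Qed.

Lemma cderD f g c : entire f -> entire g ->
  cder (fun z => f z + g z) c = cder f c + cder g c.
Proof.
move=> ef eg; have [f1 [e1 h1 <-]] := entire_tangent c ef.
have [g1 [e2 h2 <-]] := entire_tangent c eg.
apply: (@cder_entire _ _ (fun z => f1 z + g1 z)) => [|z]; first exact: entireD.
by rewrite (h1 z) (h2 z); ring.
Qed.

Lemma cderM f g c : entire f -> entire g ->
  cder (fun z => f z * g z) c = cder f c * g c + f c * cder g c.
Proof.
move=> ef eg; have [f1 [e1 h1 <-]] := entire_tangent c ef.
have [g1 [e2 h2 <-]] := entire_tangent c eg.
apply: (@cder_entire _ _ (fun z => f1 z * g z + f c * g1 z)) => [|z].
  by apply: entireD; apply: entireM => //; exact: entire_cst.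
by rewrite (h1 z) (h2 z); ring.
Qed.

Lemma cder_comp f g c : entire f -> entire g ->
  cder (fun z => f (g z)) c = cder f (g c) * cder g c.
Proof.
move=> ef eg; have [f1 [e1 h1 <-]] := entire_tangent (g c) ef.
have [g1 [e2 h2 <-]] := entire_tangent c eg.
apply: (@cder_entire _ _ (fun z => f1 (g z) * g1 z)) => [|z].
  by apply: entireM => //; exact: entire_comp.
by rewrite (h1 (g z)) (h2 z); ring.
Qed.

Lemma cder_affine f (a b c : C) : entire f ->
  cder (fun z => f (a + b * z)) c = cder f (a + b * c) * b.
Proof.
move=> ef; rewrite cder_comp //; last first.
  by apply: entireD; [exact: entire_cst|apply: entireM; [exact: entire_cst|exact: entire_id]].
rewrite cderD; [|exact: entire_cst|by apply: entireM; [exact: entire_cst|exact: entire_id]].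
rewrite cderM; [|exact: entire_cst|exact: entire_id].
by rewrite !cder_cst cder_id mul0r !add0r mulr1.
Qed.

Lemma entire_affine f (a b : C) : entire f -> entire (fun z => f (a + b * z)).
Proof.
move=> ef; apply: entire_comp => //.
by apply: entireD; [exact: entire_cst|apply: entireM; [exact: entire_cst|exact: entire_id]].
Qed.

Lemma ccont_neq0 f c : ccont f c -> f c != 0 ->
  exists2 d : R, 0 < d & forall z, N (z - c) < d -> N (f c) / 2 <= N (f z).
Proof.
move=> cf f0; have e0 : 0 < N (f c) / 2 by rewrite divr_gt0 // cmod_gt0.
have [d d0 hd] := cf _ e0; exists d => // z zc.
by have := hd z zc; have := cmodB_ge (f c) (f z); rewrite cmod_distC; lra.
Qed.

Lemma entire_neq0 f c : entire f -> f c != 0 ->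
  exists2 d : R, 0 < d & forall z, N (z - c) < d -> f z != 0.
Proof.
move=> ef f0; have [d d0 hd] := ccont_neq0 (entire_ccont c ef) f0.
exists d => // z zc; rewrite -cmod_gt0; apply: lt_le_trans (hd z zc).
by rewrite divr_gt0 // cmod_gt0.
Qed.

(* Quotients of entire functions are enough here, and re-expansion of power
   series is avoided. *)
Definition germ_at f c (A B : C -> C) := [/\ entire A, entire B &
  exists2 d : R, 0 < d & forall z, N (z - c) < d -> B z != 0 /\ f z = A z / B z].

Definition holo f := forall c, exists A B, germ_at f c A B.

Lemma germ_intro f c A B (d : R) : entire A -> entire B -> B c != 0 -> 0 < d ->
  (forall z, N (z - c) < d -> B z != 0 -> f z = A z / B z) -> germ_at f c A B.
Proof.
move=> eA eB B0 d0 h; split=> //; have [d1 d10 h1] := entire_neq0 eB B0.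
exists (Num.min d d1); first by rewrite lt_min d0.
move=> z; rewrite lt_min => /andP[z1 z2]; split; first exact: h1.
by apply: h => //; exact: h1.
Qed.

Lemma germ_elim f c A B : germ_at f c A B -> B c != 0 /\ f c = A c / B c.
Proof. by case=> _ _ [d d0 h]; apply: h; rewrite subrr cmod0. Qed.

Lemma holo_ext f g : f =1 g -> holo f -> holo g.
Proof. by move=> /funext ->. Qed.

Lemma entire_holo f : entire f -> holo f.
Proof.
move=> ef c; exists f, (fun=> 1); apply: (@germ_intro f c f (fun=> 1) 1 ef (entire_cst 1) (oner_neq0 _) ltr01).
by move=> z _ _; rewrite divr1.
Qed.

Lemma holoD f g : holo f -> holo g -> holo (fun z => f z + g z).
Proof.
move=> hf hg c; have [A [B [eA eB [d d0 h1]]]] := hf c.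
have [A' [B' [eA' eB' [d' d0' h2]]]] := hg c.
exists (fun z => A z * B' z + A' z * B z), (fun z => B z * B' z); split.
- by apply: entireD; exact: entireM.
- exact: entireM.
exists (Num.min d d'); first by rewrite lt_min d0.
move=> z; rewrite lt_min => /andP[/h1[B0 ->] /h2[B0' ->]].
by rewrite mulf_neq0 //; split=> //; field; apply/andP.
Qed.

Lemma holoM f g : holo f -> holo g -> holo (fun z => f z * g z).
Proof.
move=> hf hg c; have [A [B [eA eB [d d0 h1]]]] := hf c.
have [A' [B' [eA' eB' [d' d0' h2]]]] := hg c.
exists (fun z => A z * A' z), (fun z => B z * B' z); split; [exact: entireM..|].
exists (Num.min d d'); first by rewrite lt_min d0.
move=> z; rewrite lt_min => /andP[/h1[B0 ->] /h2[B0' ->]].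
by rewrite mulf_neq0 //; split=> //; field; apply/andP.
Qed.

Lemma holoB f g : holo f -> holo g -> holo (fun z => f z - g z).
Proof.
move=> hf hg; have := holoD hf (holoM (entire_holo (entire_cst (-1))) hg).
by apply: holo_ext => z; rewrite mulN1r.
Qed.

Lemma holoZ f (k : C) : holo f -> holo (fun z => k * f z).
Proof. by move=> hf; apply: holoM => //; apply: entire_holo; exact: entire_cst. Qed.

Lemma holo_affine f (a b : C) : holo f -> holo (fun z => f (a + b * z)).
Proof.
move=> hf c; have [A [B [eA eB [d d0 h]]]] := hf (a + b * c).
exists (fun z => A (a + b * z)), (fun z => B (a + b * z)); split; [exact: entire_affine..|].
have b1 : 0 < N b + 1 by have := cmod_ge0 b; lra.
exists (d / (N b + 1)); first by rewrite divr_gt0.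
move=> z zc; apply: h.
have -> : a + b * z - (a + b * c) = b * (z - c) by ring.
by rewrite cmodM; rewrite ltr_pdivlMr // in zc; have := cmod_ge0 (z - c); nra.
Qed.

Lemma germ_ccont f c A B : germ_at f c A B -> ccont f c.
Proof.
move=> [eA eB [d d0 h]].
have [B0 fc] := h c ltac:(by rewrite subrr cmod0).
have eH : entire (fun z => A z * B c - A c * B z).
  by apply: entireB; apply: entireM => //; exact: entire_cst.
have [d1 d10 h1] := ccont_neq0 (entire_ccont c eB) B0.
have NB0 : 0 < N (B c) by rewrite cmod_gt0.
move=> e e0.
have e1 : 0 < e * (N (B c) / 2 * N (B c)) by rewrite !mulr_gt0 // divr_gt0.
have [d2 d20 h2] := entire_ccont c eH e1.
exists (Num.min d (Num.min d1 d2)); first by rewrite !lt_min d0 d10.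
move=> z; rewrite !lt_min => /and3P[z1 z2 z3].
have [Bz fz] := h z z1; have {}h1 := h1 z z2; have {}h2 := h2 z z3.
rewrite (mulrC (A c)) subrr subr0 in h2.
have -> : f z - f c = (A z * B c - A c * B z) / (B z * B c).
  by rewrite fz fc; field; apply/andP.
rewrite cmodM cmodV cmodM ltr_pdivrMr ?mulr_gt0 ?cmod_gt0 // (mulrC (A c)) in h2 *.
apply: lt_le_trans h2 _; rewrite ler_wpM2l ?(ltW e0) //.
by rewrite ler_wpM2r // ltW.
Qed.

Lemma holo_ccont f c : holo f -> ccont f c.
Proof. by move=> hf; have [A [B gf]] := hf c; exact: germ_ccont gf. Qed.

Lemma holo_bounded f : holo f -> loc_bounded f.
Proof.
move=> hf r; have [r0|r0] := lerP 0 r; last first.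
  by exists 1 => // z zr; have := cmod_ge0 z; lra.
have [z zr zm] : exists2 z, N z <= r & forall y, N y <= r -> N (f y) <= N (f z).
  apply: disc_max => // z e zr e0; have [d d0 h] := holo_ccont z hf e0.
  by exists d => // y yz; apply: le_lt_trans (dist_cmod_le _ _) (h y yz).
exists (1 + N (f z)) => [|y yr]; first by have := cmod_ge0 (f z); lra.
by have := zm y yr; lra.
Qed.

(** With f = A / B near [c], the entire function A - f(c) B vanishes at [c], so z - c divides it and
    the germ of the quotient at [c] is A1 / B. At another point z - c goes into the denominator. *)
Lemma holo_quotient f c : holo f -> exists2 g, holo g & quotient_at f c g.
Proof.
move=> hf; have [A [B [eA eB [d d0 h]]]] := hf c.
have [B0 fc] := h c ltac:(by rewrite subrr cmod0).
have eH : entire (fun z => A z - f c * B z).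
  by apply: entireB => //; apply: entireM => //; exact: entire_cst.
have [A1 eA1 hA1] := entire_quotient c eH.
have {}hA1 z : A z - f c * B z = (z - c) * A1 z.
  by rewrite (hA1 z) fc divfK // subrr add0r.
exists (fun z => if z == c then A1 c / B c else (f z - f c) / (z - c)) => [z0|z]; last first.
  case: eqVneq => [->|zc]; first by rewrite subrr mul0r addr0.
  by rewrite mulrC divfK ?subr_eq0 // addrC subrK.
have [->|z0c] := eqVneq z0 c.
  exists A1, B; apply: (germ_intro eA1 eB B0 d0) => z zd Bz.
  case: eqVneq => [->//|zc]; have [_ ->] := h z zd.
  have zc' : z - c != 0 by rewrite subr_eq0.
  have -> : A z / B z - f c = (A z - f c * B z) / B z by field.
  by rewrite hA1; field; apply/andP.
have [A' [B' [eA' eB' [d' d0' h']]]] := hf z0.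
have N0c : 0 < N (z0 - c) by rewrite cmod_gt0 subr_eq0.
have eX : entire (fun z => z - c) by apply: entireB; [exact: entire_id|exact: entire_cst].
exists (fun z => A' z - f c * B' z), (fun z => B' z * (z - c)).
apply: (germ_intro _ _ _ (_ : 0 < Num.min d' (N (z0 - c)))).
- by apply: entireB => //; apply: entireM => //; exact: entire_cst.
- exact: entireM.
- rewrite mulf_neq0 ?subr_eq0 //; by have [] := h' z0 ltac:(by rewrite subrr cmod0).
- by rewrite lt_min d0'.
move=> z; rewrite lt_min => /andP[zd zc]; rewrite mulf_eq0 negb_or => /andP[Bz zc'].
case: eqVneq => [e|zc'']; first by move: zc'; rewrite e subrr eqxx.
have [_ ->] := h' z zd; by field; apply/andP.
Qed.

Lemma holo_taylor2 f c : holo f -> taylor2 f c.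
Proof.
move=> ef; have [f1 e1 h1] := holo_quotient c ef; have [f2 e2 h2] := holo_quotient c e1.
have [f3 /holo_bounded b3 h3] := holo_quotient c e2.
exact: taylor2_quotient b3 h1 h2 h3.
Qed.

(** The difference quotient at 0 is at most 2M / r on every disc of radius r about 0, hence zero. *)
Lemma liouville f (M : R) : holo f -> (forall z, N (f z) <= M) -> forall z, f z = f 0.
Proof.
move=> hf bM z; have [g hg fg] := holo_quotient 0 hf.
rewrite (fg z); suff -> : g z = 0 by rewrite mulr0 addr0.
apply/eqP; rewrite -cmod_eq0 eq_le cmod_ge0 andbT leNgt; apply/negP => gz.
suff : N (g z) <= N (g z) / 2 by lra.
move: (N (g z) / 2) (divr_gt0 gz (ltr0Sn _ 1)) => e e0.
have M0 : 0 <= M by apply: le_trans (cmod_ge0 _) (bM 0).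
pose r := N z + 2 * M / e + 1.
have Me : 0 <= 2 * M / e by rewrite divr_ge0 ?mulr_ge0 // ltW.
have r0 : 0 < r by rewrite /r; have := cmod_ge0 z; lra.
have := cauchy_estimate r0 (fun z => holo_ccont z hg) (fun z => holo_taylor2 z hg) fg (fun z _ => bM z).
move=> /(_ z); rewrite subr0 => /(_ _) h; apply: le_trans (h _) _.
  by rewrite /r; lra.
rewrite ler_pdivrMr // -ler_pdivrMl // mulrC /r.
by have := cmod_ge0 z; lra.
Qed.

Definition isolated_zeros f := forall c, exists2 d : R, 0 < d &
  forall z, z != c -> N (z - c) < d -> f z != 0.

Lemma isolated_zerosM f g : isolated_zeros f -> isolated_zeros g ->
  isolated_zeros (fun z => f z * g z).
Proof.
move=> hf hg c; have [d d0 h1] := hf c; have [d' d0' h2] := hg c.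
exists (Num.min d d'); first by rewrite lt_min d0.
by move=> z zc; rewrite lt_min => /andP[z1 z2]; rewrite mulf_neq0 ?h1 ?h2.
Qed.

Lemma isolated_zeros_prod (I : Type) (s : seq I) (P : pred I) (F : I -> C -> C) :
  (forall i, P i -> isolated_zeros (F i)) ->
  isolated_zeros (fun z => \prod_(i <- s | P i) F i z).
Proof.
move=> hF; elim: s => [|i s IH] c.
  by exists 1 => // z _ _; rewrite big_nil oner_neq0.
have [Pi|nPi] := boolP (P i); last first.
  have [d d0 h] := IH c; exists d => // z zc zd.
  by rewrite big_cons (negbTE nPi); exact: h.
have [d d0 h] := isolated_zerosM (hF i Pi) IH c; exists d => // z zc zd.
by rewrite big_cons Pi; exact: h.
Qed.

Definition simple_zeros f := forall c, f c = 0 -> cder f c != 0.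

Lemma simple_isolated f : entire f -> simple_zeros f -> isolated_zeros f.
Proof.
move=> ef sf c; have [f0|fn0] := eqVneq (f c) 0; last first.
  by have [d d0 h] := entire_neq0 ef fn0; exists d => // z _; exact: h.
have [g [eg hg gc]] := entire_tangent c ef.
have gn0 : g c != 0 by rewrite gc; exact: sf.
have [d d0 h] := entire_neq0 eg gn0; exists d => // z zc zd.
by rewrite (hg z) f0 add0r mulf_neq0 ?subr_eq0 // h.
Qed.

(** Permits cancelling [D] from an identity: [f] vanishes off the zeros of [D], which are isolated,
    and continuity does the rest. *)
Lemma eq0_of_mul f D : (forall c, ccont f c) -> isolated_zeros D ->
  (forall z, f z * D z = 0) -> forall z, f z = 0.
Proof.
move=> cf iD fD c; apply/eqP/negPn/negP => f0.
have [d d0 h] := ccont_neq0 (cf c) f0; have [d' d0' h'] := iD c.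
pose t := Num.min d d' / 2.
have m0 : 0 < Num.min d d' by rewrite lt_min d0.
have t0 : 0 < t by rewrite divr_gt0.
have Nt : N (c + t%:C - c) = t by rewrite addrC addKr cmod_real gtr0_norm.
have tm : t < Num.min d d' by rewrite /t; lra.
move: tm; rewrite lt_min => /andP[td td'].
have Dn0 : D (c + t%:C) != 0.
  apply: h'; last by rewrite Nt.
  by rewrite -subr_eq0 -cmod_eq0 Nt gt_eqF.
have := h (c + t%:C); rewrite Nt => /(_ td).
have /eqP := fD (c + t%:C); rewrite mulf_eq0 (negbTE Dn0) orbF => /eqP ->.
have : 0 < N (f c) by rewrite cmod_gt0.
by rewrite cmod0; lra.
Qed.

(** At a zero of [D] write D = (z - c) D1 with D1(c) nonzero: the single factor z - c of [F] is then
    enough. The values [q] at these points are chosen together with local representations A / B. *)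
Lemma removable_quotient F D : holo F -> entire D -> simple_zeros D ->
  (forall z, D z = 0 -> F z = 0) -> exists2 Q, holo Q & forall z, F z = Q z * D z.
Proof.
move=> hF eD sD FD.
have /choice [q hq] : forall c, exists q, exists A B (d : R), [/\ entire A, entire B, B c != 0,
    0 < d & q = A c / B c /\ forall z, N (z - c) < d -> z != c ->
      B z != 0 -> D z != 0 /\ F z / D z = A z / B z].
  move=> c; have [A [B [eA eB [d d0 h]]]] := hF c.
  have [B0 Fc] := h c ltac:(by rewrite subrr cmod0).
  have [d1 d10 h1] := simple_isolated eD sD c.
  have [Dc|Dc] := eqVneq (D c) 0; last first.
    exists (A c / (B c * D c)), A, (fun z => B z * D z), (Num.min d d1).
    split; [by []|exact: entireM|by rewrite mulf_neq0|by rewrite lt_min d0|split=> //].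
    move=> z; rewrite lt_min => /andP[z1 z2] zc.
    rewrite mulf_eq0 negb_or => /andP[Bz Dz]; split=> //.
    by have [_ ->] := h z z1; field; apply/andP.
  have Ac : A c = 0.
    by have /eqP := FD c Dc; rewrite Fc mulf_eq0 invr_eq0 (negbTE B0) orbF => /eqP.
  have [D1 [eD1 hD1 D1c]] := entire_tangent c eD.
  have [A1 [eA1 hA1 _]] := entire_tangent c eA.
  have D10 : D1 c != 0 by rewrite D1c; exact: sD.
  exists (A1 c / (B c * D1 c)), A1, (fun z => B z * D1 z), (Num.min d d1).
  split; [by []|exact: entireM|by rewrite mulf_neq0|by rewrite lt_min d0|split=> //].
  move=> z; rewrite lt_min => /andP[z1 z2] zc.
  rewrite mulf_eq0 negb_or => /andP[Bz D1z]; split; first exact: h1.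
  have [_ ->] := h z z1; rewrite (hA1 z) (hD1 z) Ac Dc !add0r.
  have zc' : z - c != 0 by rewrite subr_eq0.
  by field; apply/and3P.
exists (fun z => if D z == 0 then q z else F z / D z) => [c|z]; last first.
  case: eqVneq => [Dz|Dz]; first by rewrite Dz mulr0 FD.
  by rewrite divfK.
have [A [B [d [eA eB B0 d0 [qE h]]]]] := hq c.
have [Dc|Dc] := eqVneq (D c) 0.
  exists A, B; apply: (germ_intro eA eB B0 d0) => z zd Bz.
  have [->|zc] := eqVneq z c; first by rewrite Dc eqxx.
  by have [Dz ->] := h z zd zc Bz; rewrite (negbTE Dz).
have [A' [B' [eA' eB' [d' d0' h']]]] := hF c.
have [B0' Fc] := h' c ltac:(by rewrite subrr cmod0).
exists A', (fun z => B' z * D z); apply: (germ_intro eA' _ _ d0').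
- exact: entireM.
- by rewrite mulf_neq0.
move=> z zd; rewrite mulf_eq0 negb_or => /andP[Bz Dz].
by rewrite (negbTE Dz); have [_ ->] := h' z zd; field; apply/andP.
Qed.

(** The hypothesis is an equivalence so that the step can be reversed, which gives the negative
    multiples. *)
Lemma int_periods (P : C -> Prop) (p : C) : (forall z, P z <-> P (z + p)) ->
  forall (m : int) z, P z <-> P (z + m%:~R * p).
Proof.
move=> hp; suff hn (n : nat) z : P z <-> P (z + n%:R * p).
  case=> n z; first by rewrite -pmulrn; exact: hn.
  rewrite NegzE mulrNz -pmulrn mulNr.
  by have := hn n.+1 (z - n.+1%:R * p); rewrite subrK => h; split=> /h.
elim: n => [|n IH]; first by rewrite mul0r addr0.
by rewrite -[n.+1]addn1 natrD mulrDl mul1r addrA -hp.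
Qed.

(** [F] and [D] are only quasi-periodic, and periodicity of F / D is stated without division. The
    extended quotient is bounded on the disc of radius [rho], which meets every class modulo the
    periods, so it is constant by Liouville. *)
Lemma elliptic_quotient F D (p1 p2 : C) (rho : R) :
  (forall z, exists m n : int, N (z + m%:~R * p1 + n%:~R * p2) <= rho) ->
  holo F -> entire D -> simple_zeros D -> (forall z, D z = 0 -> F z = 0) ->
  (forall z, F (z + p1) * D z = F z * D (z + p1)) ->
  (forall z, F (z + p2) * D z = F z * D (z + p2)) ->
  exists k, forall z, F z = k * D z.
Proof.
move=> cpt hF eD sD FD h1 h2.
have [Q hQ FQ] := removable_quotient hF eD sD FD.
have per p : (forall z, F (z + p) * D z = F z * D (z + p)) -> forall z, Q (z + p) = Q z.
  move=> hp z; apply/eqP; rewrite -subr_eq0; apply/eqP; move: z.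
  have eT : entire (fun z => D (p + 1 * z)) by exact: entire_affine.
  have iT : isolated_zeros (fun z => D (p + 1 * z)).
    apply: simple_isolated => // c Dc.
    by rewrite cder_affine // mulr1; exact: sD.
  apply: (@eq0_of_mul _ (fun z => D z * D (p + 1 * z))).
  - move=> c; apply: holo_ccont; apply: holoB => //.
    by apply: holo_ext (holo_affine p 1 hQ) => z; rewrite mul1r addrC.
  - by apply: isolated_zerosM => //; exact: simple_isolated.
  move=> z; have := hp z; rewrite mul1r (addrC p) !FQ => h.
  have -> : (Q (z + p) - Q z) * (D z * D (z + p)) =
    Q (z + p) * D (z + p) * D z - Q z * D z * D (z + p) by ring.
  by rewrite h subrr.
have [M M0 hM] := holo_bounded hQ rho.
exists (Q 0) => z; rewrite FQ (liouville (M := M) hQ) // => w.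
have [m [n hmn]] := cpt w.
have Pp p : (forall z, Q (z + p) = Q z) -> forall k (m : int) z, Q z = k <-> Q (z + m%:~R * p) = k.
  by move=> hp k; apply: int_periods => y; rewrite hp.
have -> : Q w = Q (w + m%:~R * p1 + n%:~R * p2); last exact: (hM _ hmn).
have e1 := (Pp _ (per _ h1) (Q w) m w).1 erefl.
exact: esym ((Pp _ (per _ h2) (Q w) n _).1 e1).
Qed.

End HolomorphicFunctions.

(** * The exponential and the Weierstrass factor *)

Section ComplexExponential.
Variable R : realType.
Local Notation C := R[i].
Local Notation N := (@cmod R).
Implicit Types (z : C).

Lemma cexpD (x y : C) : cexp (x + y) = cexp x * cexp y :> C.
Proof.
case: x y => [a b] [c d]; rewrite /cexp /= expRD sinD cosD.
by apply/eqP; rewrite eq_complex /=; apply/andP; split; apply/eqP; ring.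
Qed.

Lemma cexp0 : cexp (0 : C) = 1 :> C.
Proof. by rewrite /cexp /= expR0 cos0 sin0 mulr0 mulr1. Qed.

Lemma cmod_cexp z : N (cexp z) = expR (complex.Re z).
Proof.
apply/eqP; rewrite -(@eqrXn2 _ 2%N) ?cmod_ge0 ?expR_ge0 // sqr_cmod /= !exprMn -mulrDr.
by rewrite cos2Dsin2 mulr1.
Qed.

Lemma cexp_neq0 z : cexp z != 0 :> C.
Proof. by rewrite -cmod_gt0 cmod_cexp expR_gt0. Qed.

Lemma cexpX z n : cexp (n%:R * z) = cexp z ^+ n :> C.
Proof.
elim: n => [|n IH]; first by rewrite mul0r cexp0.
by rewrite -[n.+1]add1n natrD mulrDl mul1r cexpD IH exprS.
Qed.

Lemma mvt0 (f df : R -> R) (x : R) : (forall y : R, is_derive y (1 : R) f (df y)) ->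
  exists2 c, `|c| <= `|x| & f x - f 0 = df c * x.
Proof.
move=> fd.
have cf (A : set R) : ({within A, continuous f})%classic.
  apply: continuous_subspaceT => y.
  by apply/differentiable_continuous/derivable1_diffP; have [] := fd y.
have [x0|x0] := lerP 0 x.
  have [c] := MVT_segment x0 (fun y _ => fd y) (cf _).
  rewrite in_itv /= subr0 => /andP[c0 cx] h; exists c => //.
  by rewrite !ger0_norm.
have [c] := MVT_segment (ltW x0) (fun y _ => fd y) (cf _).
rewrite in_itv /= sub0r => /andP[c0 cx] h; exists c; last by lra.
by rewrite !ler0_norm //; lra.
Qed.

Lemma sin_le (x : R) : `|sin x| <= `|x|.
Proof.
have [c _] := mvt0 x (@is_derive_sin R); rewrite sin0 subr0 => ->.
by rewrite normrM ler_piMl // cos_max.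
Qed.

Lemma cos_near (x : R) : `|cos x - 1| <= `|x| ^+ 2.
Proof.
have [c cx] := mvt0 x (@is_derive_cos R); rewrite cos0 => ->.
rewrite normrM normrN expr2 ler_wpM2r //.
exact: le_trans (sin_le c) cx.
Qed.

Lemma sin_near (x : R) : `|x| <= 1 -> `|sin x - x| <= `|x| ^+ 2.
Proof.
move=> x1; have [c cx] := mvt0 x (@is_derive_sin R); rewrite sin0 subr0 => ->.
have -> : cos c * x - x = (cos c - 1) * x by ring.
rewrite normrM expr2 ler_wpM2r //; apply: le_trans (cos_near c) _.
by have := normr_ge0 c; nra.
Qed.

Lemma exp_near (x : R) : `|x| <= 1 / 2 -> `|expR x - 1 - x| <= 2 * `|x| ^+ 2.
Proof.
move=> x1; have h1 := expR_ge1Dx x; have h2 := expR_ge1Dx (- x).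
rewrite expRN in h2.
have e0 := expR_gt0 x.
have h3 : (1 - x) * expR x <= 1.
  by rewrite -ler_pdivlMr // div1r.
rewrite ger0_norm; last by lra.
rewrite -normrX ger0_norm ?sqr_ge0 //.
move: x1; rewrite ler_norml => /andP[? ?].
nra.
Qed.

Lemma cexp_near z : N z <= 1 / 2 -> N (cexp z - 1 - z) <= 9 * N z ^+ 2.
Proof.
have := Re_le_cmod z; have := Im_le_cmod z; case: z => x y /= hy hx.
move: (N (x +i* y)) hx hy => s hx hy s1.
apply: le_trans (cmod_le_ReIm _) _; rewrite /= oppr0 addr0.
have ex := exp_near (le_trans hx s1).
have cy := cos_near y; have sy := sin_near (le_trans hy (le_trans s1 _)).
have {}sy := sy ltac:(lra); have ly := sin_le y.
have x0 := normr_ge0 x; have y0 := normr_ge0 y.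
have x2 : `|x| ^+ 2 <= s ^+ 2 by rewrite !expr2; nra.
have y2 : `|y| ^+ 2 <= s ^+ 2 by rewrite !expr2; nra.
have e1 : `|expR x - 1| <= 2 * s.
  have -> : expR x - 1 = (expR x - 1 - x) + x by ring.
  apply: le_trans (ler_normD _ _) _; nra.
have e2 : `|expR x| <= 2.
  have -> : expR x = (expR x - 1) + 1 by ring.
  apply: le_trans (ler_normD _ _) _; rewrite normr1; nra.
have -> : expR x * cos y - 1 - x = (expR x - 1 - x) + expR x * (cos y - 1) by ring.
have -> : expR x * sin y - y = (expR x - 1) * sin y + (sin y - y) by ring.
have t1 := ler_normD (expR x - 1 - x) (expR x * (cos y - 1)).
have t2 := ler_normD ((expR x - 1) * sin y) (sin y - y).
rewrite normrM in t1; rewrite normrM in t2.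
have p1 : `|expR x| * `|cos y - 1| <= 2 * s ^+ 2.
  by apply: ler_pM => //; exact: le_trans cy y2.
have p2 : `|expR x - 1| * `|sin y| <= 2 * s * s.
  by apply: ler_pM => //; exact: le_trans ly hy.
nra.
Qed.

Lemma cmod_subX (a b : C) (M : R) n : 1 <= M -> N a <= M -> N b <= M ->
  N (a ^+ n - b ^+ n) <= n%:R * N (a - b) * M ^+ n.
Proof.
move=> M1 aM bM; elim: n => [|n IH]; first by rewrite subrr cmod0 mul0r mul0r.
have -> : a ^+ n.+1 - b ^+ n.+1 = a * (a ^+ n - b ^+ n) + (a - b) * b ^+ n by rewrite !exprS; ring.
apply: le_trans (cmodD _ _) _; rewrite !cmodM cmodX.
have h1 : N a * N (a ^+ n - b ^+ n) <= M * (n%:R * N (a - b) * M ^+ n).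
  by apply: ler_pM; rewrite ?cmod_ge0.
have h2 : N b ^+ n <= M ^+ n.+1.
  apply: le_trans (_ : M ^+ n <= _); first by rewrite lerXn2r ?nnegrE ?cmod_ge0 //; lra.
  by rewrite ler_weXn2l.
have h3 := ler_wpM2l (cmod_ge0 (a - b)) h2.
rewrite -[n.+1]addn1 natrD addn1 exprS in h3 *; lra.
Qed.

(** The approximants are (1 + z/n)^n. One factor differs from exp(z/n) by O(n^-2), and the n factors
    have moduli at most exp(r/n), so the telescoped difference of the powers is O(1/n). *)
Lemma entire_cexp : entire (@cexp R).
Proof.
apply: entire_lim => r0 e e0.
pose r := `|r0| + 1.
have r1 : 1 <= r by rewrite /r lerDr.
have r00 : r0 <= r by rewrite /r; have := ler_norm r0; lra.
pose K := 9 * r ^+ 2 * expR r.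
have r2 : 0 < r ^+ 2 by rewrite exprn_gt0 //; lra.
have K0 : 0 < K by rewrite /K mulr_gt0 ?expR_gt0 // mulr_gt0.
(* The first bound gives K/n <= e, the second |z/n| <= 1/2 for [cexp_near]. *)
pose n := (maxn (Num.Def.archi_bound (K / e)) (Num.Def.archi_bound (2 * r))).+1.
have nK : K <= e * n%:R.
  have Ke : 0 <= K / e by rewrite divr_ge0 // ltW.
  rewrite mulrC -ler_pdivrMr //; apply: le_trans (ltW (archi_boundP Ke)) _.
  by rewrite ler_nat /n ltnW // ltnS leq_maxl.
have nr : 2 * r <= n%:R.
  have r20 : 0 <= 2 * r by lra.
  apply: le_trans (ltW (archi_boundP r20)) _.
  by rewrite ler_nat /n ltnW // ltnS leq_maxr.
have n0 : 0 < n%:R :> R by rewrite ltr0n.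
exists (fun z => (1 + z / n%:R) ^+ n).
  apply: entireX; apply: entireD; first exact: entire_cst.
  by apply: entireM; [exact: entire_id|exact: entire_cst].
move=> z zr0; have zr : N z <= r by lra.
set h := z / n%:R.
have zh : z = n%:R * h by rewrite /h mulrC divfK // pnatr_eq0.
have Nh : N h <= r / n%:R by rewrite /h cmodM cmodV cmod_nat ler_pM2r ?invr_gt0.
have h12 : N h <= 1 / 2.
  by apply: le_trans Nh _; rewrite ler_pdivrMr //; lra.
rewrite {1}zh cexpX.
have M1 : 1 <= expR (r / n%:R).
  by apply: le_trans (expR_ge1Dx _); rewrite lerDl divr_ge0 //; lra.
apply: le_trans (cmod_subX n M1 _ _) _.
- rewrite cmod_cexp ler_expR; apply: le_trans Nh.
  exact: le_trans (ler_norm _) (Re_le_cmod _).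
- by apply: le_trans (expR_ge1Dx _); apply: le_trans (cmodD _ _) _; rewrite cmod1 lerD2l.
rewrite -expRM_natl [n%:R * (r / _)]mulrC divfK ?gt_eqF // [leLHS]mulrC.
have -> : cexp h - (1 + h) = cexp h - 1 - h :> C by rewrite opprD addrA.
have c1 := cexp_near h12.
have c2 : 9 * N h ^+ 2 <= 9 * (r ^+ 2 / n%:R ^+ 2).
  rewrite ler_pM2l // -expr_div_n lerXn2r ?nnegrE ?cmod_ge0 // divr_ge0 //; lra.
have c3 : n%:R * N (cexp h - 1 - h) <= n%:R * (9 * (r ^+ 2 / n%:R ^+ 2)).
  by rewrite ler_pM2l //; lra.
apply: le_trans (ler_wpM2l (expR_ge0 r) c3) _.
have -> : expR r * (n%:R * (9 * (r ^+ 2 / n%:R ^+ 2))) = K / n%:R.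
  by rewrite /K; field; rewrite gt_eqF.
by rewrite ler_pdivrMr.
Qed.

Lemma cder_cexp z : cder (@cexp R) z = cexp z.
Proof.
have [g [eg hg g0]] := entire_tangent 0 entire_cexp.
have [g1 eg1 hg1] := entire_quotient 0 eg.
have g01 : g 0 = 1.
  have [//|gn] := eqVneq (g 0) 1; exfalso.
  have [M M0 hM] := entire_bounded eg1 1.
  have d0 : 0 < N (g 0 - 1) by rewrite cmod_gt0 subr_eq0.
  (* At the real point t, [cexp_near] gives |g 0 - 1| <= (9 + M) t; this t makes the right side at
     most half of the left. *)
  pose t := Num.min (1 / 2) (N (g 0 - 1) / (2 * (9 + M))).
  have M9 : 0 < 2 * (9 + M) by lra.
  have t0 : 0 < t by rewrite lt_min !divr_gt0.
  have tM : t * (2 * (9 + M)) <= N (g 0 - 1).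
    by rewrite -ler_pdivlMr // ge_min lexx orbT.
  have t12 : t <= 1 / 2 by rewrite ge_min lexx.
  have Nt : N t%:C = t by rewrite cmod_real gtr0_norm.
  have := @cexp_near t%:C; rewrite Nt => /(_ t12).
  rewrite (hg t%:C) (hg1 t%:C) !subr0 cexp0.
  have -> : 1 + t%:C * (g 0 + t%:C * g1 t%:C) - 1 - t%:C = t%:C * (g 0 - 1 + t%:C * g1 t%:C) by ring.
  rewrite cmodM Nt expr2 mulrCA ler_pM2l //.
  have := cmodB_ge (g 0 - 1) (- (t%:C * g1 t%:C)); rewrite opprK cmodN cmodM Nt.
  have := hM t%:C; rewrite Nt => /(_ ltac:(lra)) h.
  have : t * N (g1 t%:C) <= t * M by rewrite ler_pM2l.
  nra.
have -> : cexp z = cexp z * g 0 :> C by rewrite g01 mulr1.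
have -> : cexp z * g 0 = (fun w => cexp z * g (- z + 1 * w)) z.
  by rewrite /= mul1r addNr.
apply: (@cder_entire _ _ z (fun w => cexp z * g (- z + 1 * w))).
  by apply: entireM; [exact: entire_cst|exact: entire_affine].
move=> w; have -> : cexp w = cexp z * cexp (w - z) :> C by rewrite -cexpD addrC subrK.
by rewrite (hg (w - z)) subr0 cexp0 mul1r (addrC (- z)); ring.
Qed.

Lemma isolated_zeros_id : isolated_zeros (@id C).
Proof.
apply: simple_isolated; first exact: entire_id.
by move=> c _; rewrite cder_id oner_neq0.
Qed.

(** The quadratic coefficient b is found from exp(2w) = exp(w)^2, whose terms of order w^2 read 4b =
    2b + 1. *)
Lemma cexp_taylor : exists2 G : C -> C, entire G &
  forall z, cexp z = 1 + z + z ^+ 2 / 2 + z ^+ 3 * G z.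
Proof.
have [g [eg hg g0]] := entire_tangent 0 entire_cexp.
have [g1 eg1 hg1] := entire_quotient 0 eg.
have [g2 eg2 hg2] := entire_quotient 0 eg1.
rewrite cder_cexp cexp0 in g0.
have ex z : cexp z = 1 + z + z ^+ 2 * g1 0 + z ^+ 3 * g2 z :> C.
  by rewrite (hg z) (hg1 z) (hg2 z) g0 cexp0; ring.
exists g2 => // z; rewrite ex; congr (_ + _ + _ * _ + _).
(* The expansion of (exp(2z) - exp(z)^2) / z^2. It vanishes off 0, hence also at 0, where its value
   is 2b - 1. *)
pose H z := 2 * g1 0 - 1 + z * (8 * g2 (2 * z) - (2 * g1 0 + g1 0 ^+ 2 * z +
  2 * g2 z + 2 * z * g2 z + 2 * g1 0 * z ^+ 2 * g2 z + z ^+ 3 * g2 z ^+ 2)).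
have eH : entire H.
  have e2 : entire (fun z => g2 (2 * z)) by entire_tac.
  by rewrite /H; entire_tac.
have H0 : H 0 = 0.
  apply: (@eq0_of_mul _ H (fun z => z * z)); first by move=> c; exact: entire_ccont.
    by apply: isolated_zerosM; exact: isolated_zeros_id.
  move=> w; have := ex (2 * w); rewrite cexpX !ex /H => /eqP; rewrite -subr_eq0 => /eqP h.
  by apply: oppr_inj; rewrite oppr0 -[RHS]h; ring.
move: H0; rewrite /H mul0r addr0 => /eqP; rewrite subr_eq0 => /eqP h.
have n2 : 2 != 0 :> C by rewrite pnatr_eq0.
by apply: (mulfI n2); rewrite h divff.
Qed.

Lemma wfactorE z : wfactor z = (1 - z) * cexp (z + z ^+ 2 / 2) :> C.
Proof. by []. Qed.

Lemma entire_wfactor : entire (@wfactor R).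
Proof.
apply: (@entire_ext _ (fun z : C => (1 - z) * cexp (z + z ^+ 2 / 2))) => //.
apply: entireM; first by entire_tac.
by apply: entire_comp; [exact: entire_cexp|entire_tac].
Qed.

(** The exponent t + t^2/2 cancels log(1 - t) up to third order; cubic decay is what a sum over a
    planar lattice needs. *)
Lemma wfactor_near : exists2 K : R, 0 < K &
  forall z, N z <= 1 -> N (wfactor z - 1) <= K * N z ^+ 3.
Proof.
have [G eG hG] := cexp_taylor.
(* With w = z + z^2/2, this is (1 - z)(1 + w + w^2/2 + w^3 G(w)) - 1 divided by z^3. *)
pose H z := - (1 / 2) - 3 / 8 * z - z ^+ 2 / 8 + (1 - z) * (1 + z / 2) ^+ 3 * G (z + z ^+ 2 / 2).
have eH : entire H.
  have eG2 : entire (fun z => G (z + z ^+ 2 / 2)) by entire_tac.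
  by rewrite /H; entire_tac.
have [K K0 hK] := entire_bounded eH 1.
exists K => // z z1.
have -> : wfactor z - 1 = H z * z ^+ 3 :> C.
  by rewrite wfactorE hG /H; field.
by rewrite cmodM cmodX ler_wpM2r ?exprn_ge0 ?cmod_ge0 // hK.
Qed.

End ComplexExponential.

(** * Convergence of the sigma product *)

Section LatticeProducts.
Variable R : realType.
Local Notation C := R[i].
Local Notation N := (@cmod R).

Lemma prod1D_ge1 (I : Type) (s : seq I) (a : I -> R) : (forall i, 0 <= a i) ->
  1 <= \prod_(i <- s) (1 + a i).
Proof.
move=> a0; elim: s => [|i s IH]; first by rewrite big_nil.
by rewrite big_cons; have := a0 i; nra.
Qed.

Lemma cmod_prod1D (I : Type) (s : seq I) (x : I -> C) :
  N (\prod_(i <- s) (1 + x i) - 1) <= \prod_(i <- s) (1 + N (x i)) - 1.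
Proof.
elim: s => [|i s IH]; first by rewrite !big_nil !subrr cmod0.
rewrite !big_cons; set p := \prod_(j <- s) (1 + x j) in IH *.
set q := \prod_(j <- s) (1 + N (x j)) in IH *.
have -> : (1 + x i) * p - 1 = (p - 1) + x i * p by ring.
apply: le_trans (cmodD _ _) _; rewrite cmodM.
have : N p <= q by have := cmodB_ge p 1; rewrite cmod1; lra.
by have := cmod_ge0 (x i); nra.
Qed.

(** An algebraic substitute for exp bounds: for a sum S <= 1/2 it yields a product of at most 1 +
    2S. *)
Lemma prod1D_mul (I : Type) (s : seq I) (a : I -> R) : (forall i, 0 <= a i) ->
  \sum_(i <- s) a i <= 1 -> \prod_(i <- s) (1 + a i) * (1 - \sum_(i <- s) a i) <= 1.
Proof.
move=> a0; elim: s => [|i s IH]; first by rewrite !big_nil subr0 mulr1.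
rewrite !big_cons => h; have := prod1D_ge1 s a0.
have S0 : 0 <= \sum_(j <- s) a j by apply: sumr_ge0.
have := a0 i; have := IH ltac:(by have := a0 i; lra).
set P := \prod_(j <- s) _; set S := \sum_(j <- s) _ in S0 h * => h1 h2 h3.
have h4 : (1 + a i) * (1 - (a i + S)) <= 1 - S by nra.
apply: le_trans h1; rewrite [_ * P]mulrC -mulrA ler_wpM2l //; lra.
Qed.

Lemma prod_near1 (I : Type) (s : seq I) (x : I -> C) :
  \sum_(i <- s) N (x i) <= 1 / 2 ->
  N (\prod_(i <- s) (1 + x i) - 1) <= 2 * \sum_(i <- s) N (x i).
Proof.
move=> S12; apply: le_trans (cmod_prod1D s x) _.
have x0 i : 0 <= N (x i) := cmod_ge0 _.
have S0 : 0 <= \sum_(j <- s) N (x j) by apply: sumr_ge0.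
have S1 : \sum_(j <- s) N (x j) <= 1 by lra.
have := prod1D_mul x0 S1; have := prod1D_ge1 s x0.
by nra.
Qed.

Definition zrange (n : nat) : seq int := [seq (i%:Z - n%:Z)%R | i <- iota 0 (2 * n).+1].

Lemma mem_zrange n m : (m \in zrange n) = (`|m| <= n)%N.
Proof.
apply/mapP/idP => [[k]|h]; first by rewrite mem_iota => ? ->; lia.
by exists `|(m + n%:Z)%R|%N; rewrite ?mem_iota; lia.
Qed.

Lemma uniq_zrange n : uniq (zrange n).
Proof. by rewrite map_inj_uniq ?iota_uniq // => i j; lia. Qed.

Lemma size_zrange n : size (zrange n) = (2 * n).+1.
Proof. by rewrite size_map size_iota. Qed.

Lemma big_zrange (T : Type) (idx : T) (op : T -> T -> T) n (F : int -> T) :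
  \big[op/idx]_(i < (2 * n).+1) F (i%:Z - n%:Z)%R = \big[op/idx]_(m <- zrange n) F m.
Proof. by rewrite big_map -(big_mkord xpredT (fun i => F (i%:Z - n%:Z)%R)) /index_iota subn0. Qed.

Definition box (n : nat) : seq (int * int) := [seq (x, y) | x <- zrange n, y <- zrange n].

Lemma mem_box n p : (p \in box n) = (`|p.1| <= n)%N && (`|p.2| <= n)%N.
Proof.
case: p => a b; rewrite -!mem_zrange /=; apply/allpairsP/andP => [[[x y] /= [? ? [-> ->]]] //|[? ?]].
by exists (a, b).
Qed.

Lemma uniq_box n : uniq (box n).
Proof. by apply: allpairs_uniq; rewrite ?uniq_zrange // => -[a b] [c d]. Qed.

Lemma size_box n : size (box n) = ((2 * n).+1 * (2 * n).+1)%N.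
Proof. by rewrite size_allpairs size_zrange. Qed.

Definition shell (n : nat) : seq (int * int) := [seq p <- box n.+1 | p \notin box n].

Lemma perm_box n : perm_eq (box n.+1) (box n ++ shell n).
Proof.
apply: uniq_perm; first exact: uniq_box.
- rewrite cat_uniq uniq_box filter_uniq ?uniq_box // andbT andTb.
  by rewrite -all_predC; exact: filter_all.
- move=> p; rewrite [RHS]mem_cat /shell mem_filter !mem_box; case: p => a b /=; lia.
Qed.

Lemma size_shell n : size (shell n) = (8 * n.+1)%N.
Proof. have := perm_size (perm_box n); rewrite [RHS]size_cat !size_box => h.
by apply: (@addnI ((2 * n).+1 * (2 * n).+1)%N); rewrite -h; ring. Qed.

Lemma big_box (T : Type) (idx : T) (op : Monoid.com_law idx) n (F : int * int -> T) :
  \big[op/idx]_(p <- box n.+1) F p =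
  op (\big[op/idx]_(p <- box n) F p) (\big[op/idx]_(p <- shell n) F p).
Proof. by rewrite (perm_big _ (perm_box n)) big_cat. Qed.

(** Compares the modulus of a lattice point with the sup norm of its coordinates, the norm whose
    balls are the boxes. *)
Definition lattice_bound (w1 w2 : C) (c : R) := 0 < c /\
  forall m n : int, c * `|m|%N%:R <= N (latpt w1 w2 m n) /\ c * `|n|%N%:R <= N (latpt w1 w2 m n).

(** The value 1 at the origin lets products run over whole boxes. *)
Definition bfactor (w1 w2 : C) (p : int * int) (u : C) : C :=
  if (p.1 != 0) || (p.2 != 0) then wfactor (u / latpt w1 w2 p.1 p.2) else 1.

Definition boxprod w1 w2 n u : C := \prod_(p <- box n) bfactor w1 w2 p u.

Lemma sigma_partialE (w1 w2 : C) n (u : C) :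
  sigma_partial w1 w2 n u = u * boxprod w1 w2 n u :> C.
Proof.
rewrite /sigma_partial /boxprod big_allpairs; congr (_ * _).
rewrite -(big_zrange _ _ n (fun m => \prod_(k <- zrange n) bfactor w1 w2 (m, k) u)).
apply: eq_bigr => i _; rewrite big_mkcond.
rewrite -(big_zrange _ _ n (fun k => bfactor w1 w2 ((i%:Z - n%:Z)%R, k) u)).
by apply: eq_bigr => j _.
Qed.

End LatticeProducts.

(** * Limits of complex sequences *)

Section ComplexSequences.
Variable R : realType.
Local Notation C := R[i].
Local Notation N := (@cmod R).
Implicit Types (a b : nat -> C) (k l : C).

Definition ccv a l := forall e : R, 0 < e ->
  exists n0, forall n, (n0 <= n)%N -> N (a n - l) <= e.

Lemma ccv_uniq a k l : ccv a k -> ccv a l -> k = l.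
Proof.
move=> hk hl; apply/eqP; rewrite -subr_eq0 -cmod_eq0 eq_le cmod_ge0 andbT leNgt; apply/negP => kl.
have e0 : 0 < N (k - l) / 4 by rewrite divr_gt0.
have [n1 h1] := hk _ e0; have [n2 h2] := hl _ e0.
have := h1 _ (leq_maxl n1 n2); have := h2 _ (leq_maxr n1 n2); set n := maxn _ _.
move=> u v; have := cmodB (a n - l) (a n - k).
have -> : (a n - l) - (a n - k) = k - l by ring.
lra.
Qed.

Lemma ccv_ext a b l : (exists n0, forall n, (n0 <= n)%N -> a n = b n) -> ccv a l -> ccv b l.
Proof.
move=> [n0 ab] ha e e0; have [n1 h1] := ha e e0.
by exists (maxn n0 n1) => n; rewrite geq_max => /andP[u v]; rewrite -ab // h1.
Qed.

Lemma ccv_cst l : ccv (fun=> l) l.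
Proof. by move=> e e0; exists 0%N => n _; rewrite subrr cmod0 ltW. Qed.

Lemma ccvM a b k l : ccv a k -> ccv b l -> ccv (fun n => a n * b n) (k * l).
Proof.
move=> ha hb e e0.
pose A := N k + 1; pose B := N l + 1.
have A0 : 0 < A by rewrite /A; have := cmod_ge0 k; lra.
have B0 : 0 < B by rewrite /B; have := cmod_ge0 l; lra.
have e1 : 0 < Num.min 1 (e / 2 / B) by rewrite lt_min ltr01 !divr_gt0.
have e2 : 0 < e / 2 / A by rewrite !divr_gt0.
have [n1 h1] := ha _ e1; have [n2 h2] := hb _ e2.
exists (maxn n1 n2) => n; rewrite geq_max => /andP[/h1 u /h2 v].
move: u; rewrite le_min => /andP[u1 u2].
have -> : a n * b n - k * l = a n * (b n - l) + (a n - k) * l by ring.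
apply: le_trans (cmodD _ _) _; rewrite !cmodM.
have aA : N (a n) <= A by have := cmodB_ge (a n) k; rewrite /A; lra.
have p1 : N (a n) * N (b n - l) <= e / 2.
  apply: le_trans (ler_pM (cmod_ge0 _) (cmod_ge0 _) aA v) _.
  by rewrite mulrC divfK // gt_eqF.
have p2 : N (a n - k) * N l <= e / 2.
  have lB : N l <= B by rewrite /B; lra.
  apply: le_trans (ler_pM (cmod_ge0 _) (cmod_ge0 _) u2 lB) _.
  by rewrite divfK // gt_eqF.
lra.
Qed.

Lemma ccv_bound a l (K : R) (n0 : nat) : 0 <= K ->
  (forall n, (n0 <= n)%N -> N (a n - l) <= K / n.+1%:R) -> ccv a l.
Proof.
move=> K0 h e e0; have [n1 h1] := inv_small K0 e0.
exists (maxn n0 n1) => n; rewrite geq_max => /andP[u v].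
exact: le_trans (h n u) (h1 n v).
Qed.

Lemma ccv_lim a l : ccv a l -> lim ((a : nat -> C^o) @ \oo)%classic = l.
Proof.
move=> h; apply: (@cvg_lim C^o) => //; apply/cvgrPdist_lt => e e0.
have ee : e = (complex.Re e)%:C by rewrite RRe_real // gtr0_real.
have e0' : 0 < complex.Re e / 2 by rewrite divr_gt0 // -ltcR -ee.
have [n0 h0] := h _ e0'; exists n0 => // n /= hn.
by rewrite distrC normr_cmod ee ltcR; have := h0 n hn; lra.
Qed.

End ComplexSequences.

(** * Locally uniform convergence and zeros of the sigma product *)

Section SigmaProduct.
Variable R : realType.
Local Notation C := R[i].
Local Notation N := (@cmod R).
Variables (w1 w2 : C) (c : R).
Hypothesis lb : lattice_bound w1 w2 c.
Local Notation lat := (latpt w1 w2).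
Local Notation bf := (bfactor w1 w2).
Local Notation bp := (boxprod w1 w2).

Lemma lat_neq0 (m n : int) : (m != 0) || (n != 0) -> lat m n != 0 :> C.
Proof.
case: lb => c0 h mn; have [h1 h2] := h m n; rewrite -cmod_gt0.
case/orP: mn => [m0|n0].
  by apply: lt_le_trans h1; rewrite mulr_gt0 // ltr0n absz_gt0.
by apply: lt_le_trans h2; rewrite mulr_gt0 // ltr0n absz_gt0.
Qed.

Lemma shell_lat n p : p \in shell n -> c * n.+1%:R <= N (lat p.1 p.2).
Proof.
case: lb => c0 h; rewrite /shell mem_filter !mem_box => pn.
have [h1 h2] := h p.1 p.2.
have : (n.+1 <= `|p.1|)%N \/ (n.+1 <= `|p.2|)%N by lia.
case=> np.
  by apply: le_trans h1; rewrite ler_pM2l // ler_nat.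
by apply: le_trans h2; rewrite ler_pM2l // ler_nat.
Qed.

Lemma shell_neq0 n p : p \in shell n -> (p.1 != 0) || (p.2 != 0).
Proof. by rewrite /shell mem_filter !mem_box; lia. Qed.

Lemma entire_bfactor p : entire (bf p).
Proof.
have [b|b] := boolP ((p.1 != 0) || (p.2 != 0)); last first.
  by apply: entire_ext (entire_cst 1) => u; rewrite /bfactor (negbTE b).
apply: (@entire_ext _ (fun u => wfactor (u / lat p.1 p.2))) => [u|]; first by rewrite /bfactor b.
apply: (@entire_comp _ (@wfactor R) (fun u => u / lat p.1 p.2)); first exact: entire_wfactor.
by entire_tac.
Qed.

Lemma entire_boxprod n : entire (bp n).
Proof. by apply: entire_prod => p; exact: entire_bfactor. Qed.

(** The 8(n + 1) points of a shell have modulus at least c(n + 1), and each factor is within O(n^-3)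
    of 1. *)
Lemma shell_sum (r : R) : 0 <= r -> exists2 B : R, 0 <= B & forall n u, N u <= r ->
  r <= c * n.+1%:R -> \sum_(p <- shell n) N (bf p u - 1) <= B / n.+1%:R ^+ 2.
Proof.
move=> r0; have [c0 _] := lb; have [K K0 hK] := wfactor_near R.
exists (8 * (K * (r / c) ^+ 3)).
  by rewrite mulr_ge0 // mulr_ge0 ?(ltW K0) // exprn_ge0 // divr_ge0 // ltW.
move=> n u ur rn; have n0 : 0 < n.+1%:R :> R by rewrite ltr0Sn.
have cn : 0 < c * n.+1%:R by rewrite mulr_gt0.
have hp p : p \in shell n -> N (bf p u - 1) <= K * (r / (c * n.+1%:R)) ^+ 3.
  move=> ps; rewrite /bfactor (shell_neq0 ps).
  have hl := shell_lat ps.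
  have q1 : N (u / lat p.1 p.2) <= r / (c * n.+1%:R).
    rewrite cmodM cmodV; apply: ler_pM; rewrite ?cmod_ge0 ?invr_ge0 ?cmod_ge0 //.
    by rewrite lef_pV2 ?posrE // (lt_le_trans cn).
  apply: le_trans (hK _ _) _.
    by apply: le_trans q1 _; rewrite ler_pdivrMr // mul1r.
  by rewrite ler_pM2l // lerXn2r ?nnegrE ?cmod_ge0 // divr_ge0 // (ltW cn).
rewrite big_seq; apply: le_trans (ler_sum _ hp) _.
rewrite -big_seq big_const_seq count_predT size_shell iter_addr addr0.
rewrite -[leLHS]mulr_natl natrM.
suff -> : 8%:R * n.+1%:R * (K * (r / (c * n.+1%:R)) ^+ 3) =
   8 * (K * (r / c) ^+ 3) / n.+1%:R ^+ 2 by [].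
by field; rewrite !gt_eqF.
Qed.

(** Telescoping, from 1/(k + 1)^2 <= 1/k - 1/(k + 1). *)
Lemma tail_sum (n M : nat) : (0 < n)%N -> (n <= M)%N ->
  \sum_(n <= k < M) (k.+1%:R ^+ 2)^-1 <= n%:R^-1 - M%:R^-1 :> R.
Proof.
move=> n0; elim: M => [|M IH].
  by rewrite leqn0 => /eqP n00; rewrite n00 in n0.
rewrite leq_eqVlt => /orP[/eqP <-|nM]; first by rewrite big_geq // subrr.
rewrite ltnS in nM; rewrite big_nat_recr //=.
have M0 : 0 < M%:R :> R by rewrite ltr0n (leq_trans n0).
apply: le_trans (lerD (IH nM) (lexx _)) _.
rewrite -subr_ge0 -natr1.
have -> : n%:R^-1 - (M%:R + 1)^-1 - (n%:R^-1 - M%:R^-1 + ((M%:R + 1) ^+ 2)^-1) =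
   (M%:R * (M%:R + 1) ^+ 2)^-1 :> R.
  have nn : n%:R != 0 :> R by rewrite pnatr_eq0 -lt0n.
  have MM : M%:R != 0 :> R by rewrite gt_eqF.
  have M1 : M%:R + 1 != 0 :> R by rewrite gt_eqF //; lra.
  by field; rewrite nn MM M1.
by rewrite invr_ge0 mulr_ge0 ?ltW // exprn_gt0 //; lra.
Qed.

(** The error is relative to the finite product. As it is at most one half of it, the limit can
    vanish only where a finite product does; this locates the zeros of sigma. *)
Lemma boxprod_tail (r : R) : 0 <= r -> exists (B : R) (n0 : nat), [/\ 0 <= B,
  forall n, (n0 <= n)%N -> B / n.+1%:R <= 1 / 2 &
  forall n M u, (n0 <= n)%N -> (n <= M)%N -> N u <= r ->
    N (bp M u - bp n u) <= N (bp n u) * (B / n.+1%:R)].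
Proof.
move=> r0; have [c0 _] := lb; have [B B0 hB] := shell_sum r0.
have [n1 h1] : exists n1 : nat, forall n, (n1 <= n)%N -> r <= c * n.+1%:R.
  have [n1 h1] := inv_small r0 c0; exists n1 => n hn.
  by have := h1 n hn; rewrite ler_pdivrMr ?ltr0Sn.
have B8 : 0 <= 8 * B by rewrite mulr_ge0.
have e14 : 0 < 1 / 4 :> R by lra.
have [n2 h2] := inv_small B8 e14.
have Bn n : (n2 <= n)%N -> 8 * B / n.+1%:R <= 1 / 4 by exact: h2.
(* 8 = 2 * 2 * 2: [prod_near1] inside each shell, 1/n <= 2/(n + 1) after telescoping, and
   [prod_near1] over the shells. The bound 1 keeps n positive for [tail_sum]. *)
exists (8 * B), (maxn (maxn n1 n2) 1); split=> //.
  move=> n; rewrite !geq_max => /andP[/andP[_ hn] _].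
  by apply: le_trans (Bn n hn) _; lra.
move=> n M u; rewrite !geq_max => /andP[/andP[nn1 nn2] n0] nM ur.
pose s k := \prod_(p <- shell k) bf p u.
have bM : bp M u = bp n u * \prod_(n <= k < M) s k.
  elim: M nM => [|M IH]; first by rewrite leqn0 => /eqP ->; rewrite big_geq // mulr1.
  rewrite leq_eqVlt => /orP[/eqP <-|]; first by rewrite big_geq // mulr1.
  rewrite ltnS => nM; rewrite big_nat_recr //= mulrA -IH //.
  by rewrite /boxprod big_box.
have invle k : (n <= k)%N -> k.+1%:R^-1 <= n.+1%:R^-1 :> R.
  by move=> nk; rewrite lef_pV2 ?posrE ?ltr0Sn // ler_nat ltnS.
have i0 k : 0 < k.+1%:R^-1 :> R by rewrite invr_gt0 ltr0Sn.
have sk k : (n <= k)%N -> N (s k - 1) <= 2 * B * (k.+1%:R ^+ 2)^-1.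
  move=> nk.
  have hs := hB k u ur (h1 k (leq_trans nn1 nk)).
  have sm : B / k.+1%:R ^+ 2 <= 1 / 2.
    rewrite expr2 invfM mulrA.
    have := Bn k (leq_trans nn2 nk).
    have k1 : k.+1%:R^-1 <= 1 :> R by rewrite invf_le1 ?ltr0Sn // ler1n.
    have bk : 0 <= B / k.+1%:R by rewrite mulr_ge0 // ltW.
    rewrite -mulrA; move: (B / k.+1%:R) bk => q q0 h3.
    by apply: le_trans (_ : q <= _); [rewrite ler_piMr|lra].
  have -> : s k = \prod_(p <- shell k) (1 + (bf p u - 1)).
    by apply: eq_bigr => p _; rewrite addrC subrK.
  apply: le_trans (prod_near1 _) _; first exact: le_trans hs sm.
  by rewrite -mulrA ler_pM2l.
have -> : bp M u - bp n u = bp n u * (\prod_(n <= k < M) s k - 1) by rewrite bM; ring.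
rewrite cmodM ler_wpM2l ?cmod_ge0 //.
have -> : \prod_(n <= k < M) s k = \prod_(k <- index_iota n M) (1 + (s k - 1)).
  by apply: eq_bigr => k _; rewrite addrC subrK.
have ssum : \sum_(k <- index_iota n M) N (s k - 1) <= 4 * B * n.+1%:R^-1.
  apply: le_trans (_ : \sum_(n <= k < M) 2 * B * (k.+1%:R ^+ 2)^-1 <= _).
    by apply: ler_sum_nat => k /andP[nk _]; exact: sk.
  rewrite -mulr_sumr.
  have := tail_sum n0 nM.
  have Mi : 0 <= M%:R^-1 :> R by rewrite invr_ge0.
  have ni : n%:R^-1 <= 2 * n.+1%:R^-1 :> R.
    rewrite -[2]invrK -invfM lef_pV2 ?posrE ?ltr0n ?mulr_gt0 ?invr_gt0 ?ltr0Sn //.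
    rewrite mulrC ler_pdivrMr // -natrM ler_nat; lia.
  move: (\sum_(n <= k < M) _) (n.+1%:R^-1) (n%:R^-1) (M%:R^-1) Mi ni => S x y z z0 yx ts.
  have : S <= 2 * x by lra.
  by move=> /(ler_wpM2l (mulr_ge0 (ler0n R 2) B0)); lra.
have := Bn n nn2; move: (n.+1%:R^-1) ssum => x ssum bn.
apply: le_trans (prod_near1 _) _; lra.
Qed.

Lemma boxprod_limit : exists h : C -> C, forall r, exists (B : R) (n0 : nat), [/\ 0 <= B,
  forall n, (n0 <= n)%N -> B / n.+1%:R <= 1 / 2 &
  forall n u, (n0 <= n)%N -> N u <= r -> N (h u - bp n u) <= N (bp n u) * (B / n.+1%:R)].
Proof.
have /choice [h hh] : forall u : C, exists l, ccv (fun n => bp n u) l.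
  move=> u; have [B [n0 [B0 h1 h2]]] := boxprod_tail (cmod_ge0 u).
  have Bn n : 0 <= B / n.+1%:R by rewrite divr_ge0.
  pose A := 2 * N (bp n0 u).
  have A0 : 0 <= A by rewrite mulr_ge0 // cmod_ge0.
  have bA n : (n0 <= n)%N -> N (bp n u) <= A.
    move=> hn; have := h2 n0 n u (leqnn _) hn (lexx _).
    have := ler_wpM2l (cmod_ge0 (bp n0 u)) (h1 n0 (leqnn _)).
    have := cmodB_ge (bp n u) (bp n0 u); have := cmod_ge0 (bp n0 u); rewrite /A.
    by move: (_ * (B / _)) => q; lra.
  have [|l hl] := @C_complete _ (fun n => bp n u) (fun n => A * (B / n.+1%:R)) n0 (fun n => mulr_ge0 A0 (Bn n)).
    move=> n m hn nm; rewrite cmod_distC; apply: le_trans (h2 n m u hn nm (lexx _)) _.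
    by rewrite ler_wpM2r // bA.
  exists l; apply: (@ccv_bound _ _ _ (2 * (A * B)) n0); first by rewrite mulr_ge0 // mulr_ge0.
  move=> n hn; have -> : 2 * (A * B) / n.+1%:R = 2 * (A * (B / n.+1%:R)) by rewrite !mulrA.
  exact: hl.
exists h => r; have [r0|r0] := lerP 0 r; last first.
  exists 0, 0%N; split=> // [n _|n u _ ur]; first by rewrite mul0r; lra.
  by have := cmod_ge0 u; lra.
have [B [n0 [B0 h1 h2]]] := boxprod_tail r0; exists B, n0; split=> // n u hn ur.
rewrite leNgt; apply/negP => lt; have d0 : 0 < (N (h u - bp n u) - N (bp n u) * (B / n.+1%:R)) / 2.
  by rewrite divr_gt0 // subr_gt0.
have [n1 h3] := hh u _ d0; have := h3 _ (leq_maxr n n1).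
have := h2 n _ u hn (leq_maxl n n1) ur; set M := maxn n n1.
have := cmodD (h u - bp M u) (bp M u - bp n u).
have -> : h u - bp M u + (bp M u - bp n u) = h u - bp n u by ring.
rewrite (cmod_distC (h u) (bp M u)); move: (_ * (B / _)) d0 => X; lra.
Qed.

Lemma sigma_product : exists h : C -> C, [/\ entire h, h 0 = 1,
  forall u, wsigma w1 w2 u = u * h u :> C,
  forall u, ccv (fun n => sigma_partial w1 w2 n u) (wsigma w1 w2 u) &
  forall u, h u = 0 -> exists m n : int, u = lat m n].
Proof.
have [h hh] := boxprod_limit.
have cvh u : ccv (fun n => bp n u) (h u).
  have [B [n0 [B0 h1 h2]]] := hh (N u).
  have bA n : (n0 <= n)%N -> N (bp n u) <= 2 * N (h u).
    move=> hn; have := h2 n u hn (lexx _).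
    have := ler_wpM2l (cmod_ge0 (bp n u)) (h1 n hn).
    have := cmodB_ge (bp n u) (h u); rewrite (cmod_distC (bp n u)); have := cmod_ge0 (bp n u).
    by move: (_ * (B / _)) => q; lra.
  apply: (@ccv_bound _ _ _ (2 * N (h u) * B) n0); first by rewrite !mulr_ge0 ?cmod_ge0.
  move=> n hn; rewrite cmod_distC; apply: le_trans (h2 n u hn (lexx _)) _.
  by rewrite -(mulrA _ B) ler_wpM2r ?bA // divr_ge0.
have cvs u : ccv (fun n => sigma_partial w1 w2 n u) (u * h u).
  apply: (@ccv_ext _ (fun n => u * bp n u)).
    by exists 0%N => n _; rewrite sigma_partialE.
  exact: ccvM (ccv_cst u) (cvh u).
have sE u : wsigma w1 w2 u = u * h u :> C by exact: ccv_lim (cvs u).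
exists h; split=> //.
- apply: entire_lim => r e e0.
  have [B [n0 [B0 h1 h2]]] := hh r.
  have [A A0 hA] := entire_bounded (entire_boxprod n0) r.
  have K0 : 0 <= 3 * A * B by rewrite !mulr_ge0 // ltW.
  have [n1 h3] := inv_small K0 e0.
  exists (bp (maxn n0 n1)); first exact: entire_boxprod.
  move=> z zr; set n := maxn n0 n1.
  have hn : (n0 <= n)%N by rewrite leq_maxl.
  apply: le_trans (h2 n z hn zr) _; apply: le_trans (h3 n (leq_maxr _ _)).
  rewrite -(mulrA _ B) ler_wpM2r ?divr_ge0 //.
  have p1 := h2 n z hn zr; have p2 := h1 n hn.
  have p3 := h2 n0 z (leqnn _) zr; have p4 := h1 n0 (leqnn _).
  have p5 := hA z zr.
  have q1 := cmodB_ge (bp n z) (h z); rewrite cmod_distC in q1.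
  have q2 := cmodB_ge (h z) (bp n0 z).
  have := ler_wpM2l (cmod_ge0 (bp n z)) p2; have := ler_wpM2l (cmod_ge0 (bp n0 z)) p4.
  move: (N (bp n z) * (B / _)) (N (bp n0 z) * (B / _)) p1 p3 => x y p1 p3; lra.
- apply: ccv_uniq (cvh 0) _; apply: ccv_ext (ccv_cst 1); exists 0%N => n _.
  rewrite /boxprod big1 // => p _; rewrite /bfactor mul0r; case: ifP => // _.
  by rewrite wfactorE subr0 mul1r expr0n mul0r addr0 cexp0.
- by move=> u; rewrite sE.
(* If h u = 0, the relative error gives |bp n0 u| <= |bp n0 u| / 2, so a factor of a finite product
   vanishes at u. *)
move=> u hu; have [B [n0 [B0 h1 h2]]] := hh (N u).
have := h2 n0 u (leqnn _) (lexx _); rewrite hu sub0r cmodN => p1.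
have : N (bp n0 u) <= 0.
  have := ler_wpM2l (cmod_ge0 (bp n0 u)) (h1 n0 (leqnn _)).
  by move: (_ * (B / _)) p1 => x; lra.
rewrite le_eqVlt ltNge cmod_ge0 orbF cmod_eq0 prodf_seq_eq0 => /hasP[p _ /=].
rewrite /bfactor; case: ifP => [p0|_]; last by rewrite oner_eq0.
rewrite wfactorE mulf_eq0 (negbTE (cexp_neq0 _)) orbF subr_eq0 => /eqP ul.
exists p.1, p.2; have := lat_neq0 p0 => l0.
by apply: (mulIf (_ : (lat p.1 p.2)^-1 != 0)); rewrite ?invr_eq0 // -ul divff.
Qed.

End SigmaProduct.

(** * Quasi-periodicity of sigma *)

Section SigmaQuadratic.
Variable R : realType.
Local Notation C := R[i].
Local Notation N := (@cmod R).
Variables (w1 w2 : C) (c : R).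
Hypothesis lb : lattice_bound w1 w2 c.
Local Notation lat := (latpt w1 w2).

Lemma latptN (m n : int) : lat (- m) (- n) = - lat m n :> C.
Proof. by rewrite /latpt !mulrNz; ring. Qed.

Lemma boxprodN n u : boxprod w1 w2 n (- u) = boxprod w1 w2 n u.
Proof.
pose f (p : int * int) := ((- p.1)%R, (- p.2)%R).
have inj_f : injective f by move=> [a b] [d e] [/oppr_inj -> /oppr_inj ->].
have pb : perm_eq (box n) [seq f p | p <- box n].
  apply: uniq_perm; rewrite ?map_inj_uniq ?uniq_box // => -[a b].
  rewrite [LHS]mem_box -[(a, b)]/(a, b); apply/idP/mapP => [h|[[d e]]].
    by exists ((- a)%R, (- b)%R); rewrite ?mem_box /f /= ?opprK ?abszN.
  by rewrite mem_box /f => h [-> ->]; rewrite /= !abszN.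
rewrite /boxprod (perm_big _ pb) big_map; apply: eq_bigr => p _.
rewrite /bfactor /f /= !oppr_eq0; case: ifP => // _.
by rewrite latptN invrN mulrNN.
Qed.

Lemma wsigmaN u : wsigma w1 w2 (- u) = - wsigma w1 w2 u :> C.
Proof.
have [h [_ _ _ cv _]] := sigma_product lb.
apply: ccv_uniq (cv (- u)) _.
have := ccvM (ccv_cst (-1)) (cv u); rewrite mulN1r.
by apply: ccv_ext; exists 0%N => n _; rewrite !sigma_partialE boxprodN mulN1r mulNr.
Qed.

(** What remains of a Weierstrass factor after u - w is taken out: the exponential of a quadratic
    polynomial in u, times -1/w. *)
Definition expfactor (p : int * int) (u : C) : C :=
  if (p.1 != 0) || (p.2 != 0) then
    - (lat p.1 p.2)^-1 * cexp (u / lat p.1 p.2 + (u / lat p.1 p.2) ^+ 2 / 2)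
  else 1.

Lemma sigma_partial_linear n u : sigma_partial w1 w2 n u =
  (\prod_(p <- box n) (u - lat p.1 p.2)) * \prod_(p <- box n) expfactor p u :> C.
Proof.
have z0 : (0%Z, 0%Z) \in box n by rewrite mem_box.
have -> : sigma_partial w1 w2 n u =
    (\prod_(p <- box n) if (p.1 != 0) || (p.2 != 0) then 1 else u) * boxprod w1 w2 n u :> C.
  rewrite sigma_partialE (bigD1_seq (0%Z, 0%Z)) ?uniq_box //= big1 ?mulr1 //.
  by move=> -[a b]; rewrite xpair_eqE negb_and => ->.
rewrite /boxprod -!big_split; apply: eq_bigr => -[a b] _.
rewrite /bfactor /expfactor /=; case: ifP => [ab|].
  have l0 := lat_neq0 lb ab.
  rewrite wfactorE; move: (lat a b) l0 => l l0; rewrite mul1r mulrA; congr (_ * _).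
  by field.
move=> /negbT; rewrite negb_or !negbK => /andP[/eqP -> /eqP ->].
by rewrite /latpt !mul0r !mulr0 addr0 subr0 !mulr1.
Qed.

(** For a quadratic polynomial q, q(u + w) - q(u) is affine in u, so its sum over two points depends
    only on their sum, which is the same for u, v and for u + t, v - t. *)
Lemma expfactor_quad p (u v t w : C) :
  expfactor p (u + w) * expfactor p (v + w) * (expfactor p (u + t) * expfactor p (v - t)) =
  expfactor p u * expfactor p v * (expfactor p (u + t + w) * expfactor p (v - t + w)).
Proof.
rewrite /expfactor; case: ifP => // _; set k := - _.
have e4 a b d e : (k * cexp a) * (k * cexp b) * ((k * cexp d) * (k * cexp e)) =
   k ^+ 4 * cexp (a + b + d + e) :> C by rewrite !cexpD; ring.
by rewrite !e4; congr (_ * cexp _); ring.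
Qed.

Definition column n (m : int) (u : C) : C := \prod_(k <- zrange n) (u - lat m k).

Lemma prod_shift n (F : int -> C) :
  F n%:Z * \prod_(m <- zrange n) F (m - 1)%R = F (- n%:Z - 1)%R * \prod_(m <- zrange n) F m.
Proof.
rewrite -(big_zrange _ _ n (fun m => F (m - 1)%R)) -big_zrange.
have := big_ord_recr (2 * n).+1 (fun i : 'I_ _ => F ((i%:Z - n%:Z) - 1)%R) (op := *%R) (idx := 1).
rewrite big_ord_recl /= => h; rewrite mulrC.
have -> : F n%:Z = F ((2 * n).+1%:Z - n%:Z - 1)%R by congr F; lia.
rewrite -h; congr (F _ * _); first by lia.
by apply: eq_bigr => i _; congr F; rewrite /bump /=; lia.
Qed.

Lemma linear_shift n (u : C) :
  column n n%:Z u * \prod_(p <- box n) (u + 2 * w1 - lat p.1 p.2) =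
  column n (- n%:Z - 1)%R u * \prod_(p <- box n) (u - lat p.1 p.2).
Proof.
rewrite !big_allpairs -(prod_shift n (fun m => column n m u)); congr (_ * _).
apply: eq_bigr => m _; apply: eq_bigr => k _ /=.
by rewrite /latpt mulrzBr; ring.
Qed.

Lemma column_far (r : R) : 0 <= r -> exists n0 : nat, forall n (m k : int) (x : C),
  (n0 <= n)%N -> (n <= `|m|)%N -> N x <= r -> c * n.+1%:R / 4 <= N (x - lat m k).
Proof.
move=> r0; have [c0 hl] := lb; have c4 : 0 < c / 4 by rewrite divr_gt0.
have [n1 h1] := inv_small r0 c4; exists (maxn n1 1) => n m k x.
rewrite geq_max => /andP[hn n0] nm xr.
have := h1 n hn; rewrite ler_pdivrMr ?ltr0Sn // => rn.
have [h2 _] := hl m k.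
have h3 : c * n%:R <= N (lat m k) by apply: le_trans h2; rewrite ler_pM2l // ler_nat.
have h4 : c * n.+1%:R <= 2 * (c * n%:R).
  by rewrite mulrCA ler_pM2l // -natrM ler_nat; lia.
have := cmodB_ge (lat m k) x; rewrite cmod_distC.
have -> : c * n.+1%:R / 4 = c / 4 * n.+1%:R by rewrite mulrAC.
have h5 : c * n.+1%:R = 4 * (c / 4 * n.+1%:R) by field.
lra.
Qed.

Lemma column_neq0 (mm : nat -> int) (x : C) : (forall n, (n <= `|mm n|)%N) ->
  exists n0, forall n, (n0 <= n)%N -> column n (mm n) x != 0.
Proof.
move=> hm; have [n0 h] := column_far (cmod_ge0 x); exists n0 => n hn.
rewrite prodf_seq_neq0; apply/allP => k _ /=; rewrite -cmod_gt0.
apply: lt_le_trans (h n (mm n) k x hn (hm n) (lexx _)).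
by rewrite divr_gt0 // mulr_gt0 ?ltr0Sn //; have [] := lb.
Qed.

(** Since x + y = x' + y', the products (x - l)(y - l) and (x' - l)(y' - l) differ by a constant [d]
    independent of l. Each of the 2n + 1 ratios is 1 + O(n^-2), so their product tends to 1. *)
Lemma column_ratio (mm : nat -> int) (x y x' y' : C) : (forall n, (n <= `|mm n|)%N) ->
  x + y = x' + y' ->
  ccv (fun n => column n (mm n) x * column n (mm n) y /
                (column n (mm n) x' * column n (mm n) y')) 1.
Proof.
move=> hm xy; have [c0 _] := lb.
have [n1 h1] := column_far (cmod_ge0 x'); have [n2 h2] := column_far (cmod_ge0 y').
pose d := x * y - x' * y'.
(* At most 2(n + 1) terms, each bounded by |d| (4 / (c(n + 1)))^2. *)
pose K := 32 * N d / c ^+ 2.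
have K0 : 0 <= K by rewrite divr_ge0 ?exprn_ge0 ?mulr_ge0 ?cmod_ge0 // ltW.
have e2 : 0 < 1 / 2 :> R by lra.
have [n3 h3] := inv_small K0 e2.
have K20 : 0 <= 2 * K by lra.
apply: (@ccv_bound _ _ _ (2 * K) (maxn n1 (maxn n2 n3)) K20) => n.
rewrite !geq_max => /and3P[/h1{}h1 /h2{}h2 /h3{}h3].
have cn : 0 < c * n.+1%:R / 4 by rewrite divr_gt0 // mulr_gt0 ?ltr0Sn.
have nz k : (x' - lat (mm n) k != 0) /\ (y' - lat (mm n) k != 0).
  split; rewrite -cmod_gt0.
    exact: lt_le_trans cn (h1 _ k _ (hm n) (lexx _)).
  exact: lt_le_trans cn (h2 _ k _ (hm n) (lexx _)).
pose q k := d / ((x' - lat (mm n) k) * (y' - lat (mm n) k)).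
have -> : column n (mm n) x * column n (mm n) y /
    (column n (mm n) x' * column n (mm n) y') = \prod_(k <- zrange n) (1 + q k).
  rewrite /column -!big_split -prodfV -big_split; apply: eq_bigr => k _ /=.
  have [z1 z2] := nz k; rewrite /q /d; have -> : y = x' + y' - x by rewrite -xy; ring.
  by move: (lat (mm n) k) z1 z2 => l z1 z2; field; apply/andP.
have qk k : N (q k) <= N d * (c * n.+1%:R / 4)^-1 ^+ 2.
  rewrite /q cmodM cmodV cmodM invfM expr2 ler_wpM2l ?cmod_ge0 //.
  apply: ler_pM; rewrite ?invr_ge0 ?cmod_ge0 //.
    by rewrite lef_pV2 ?posrE ?(lt_le_trans cn) ?h1.
  by rewrite lef_pV2 ?posrE ?(lt_le_trans cn) ?h2.
have ssum : \sum_(k <- zrange n) N (q k) <= K / n.+1%:R.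
  apply: le_trans (ler_sum _ (fun k _ => qk k)) _.
  rewrite big_const_seq count_predT size_zrange iter_addr addr0 -[leLHS]mulr_natl.
  have n0 : 0 < n.+1%:R :> R by rewrite ltr0Sn.
  have -> : K / n.+1%:R = (2 * n.+1%:R) * (N d * (c * n.+1%:R / 4)^-1 ^+ 2).
    by rewrite /K; field; rewrite !gt_eqF.
  apply: ler_wpM2r; first by rewrite mulr_ge0 ?cmod_ge0 ?sqr_ge0.
  by rewrite -natrM ler_nat; lia.
apply: le_trans (prod_near1 _) _; first exact: le_trans ssum h3.
by rewrite -mulrA ler_pM2l.
Qed.

(* The Gaussian factors of the finite products cancel in this identity, and a
   translation by [2 w1] only exchanges the two extreme columns of the box, whose
   contribution tends to 1. So no conditionally convergent lattice sum has to be
   evaluated. *)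
Lemma wsigma_quad1 (u v t : C) : let s := wsigma w1 w2 in let w := 2 * w1 in
  s (u + w) * s (v + w) * (s (u + t) * s (v - t)) =
  s u * s v * (s (u + t + w) * s (v - t + w)) :> C.
Proof.
move=> s w; have [h [_ _ _ cv _]] := sigma_product lb.
pose S n z : C := sigma_partial w1 w2 n z.
pose a n := column n (- n%:Z - 1)%R; pose b n := column n n%:Z.
have am n : (n <= `|(- n%:Z - 1)%R|)%N by lia.
have bm n : (n <= `|n%:Z|)%N by lia.
have cR : ccv (fun n => S n u * S n v * (S n (u + t + w) * S n (v - t + w)))
   (s u * s v * (s (u + t + w) * s (v - t + w))) by do !apply: ccvM; exact: cv.
have cL : ccv (fun n => S n (u + w) * S n (v + w) * (S n (u + t) * S n (v - t)))
   (s (u + w) * s (v + w) * (s (u + t) * s (v - t))) by do !apply: ccvM; exact: cv.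
(* The two factors 1 stand for the limits of the two ratios of extreme columns. *)
apply: ccv_uniq cL _; rewrite -[X in ccv _ X]mulr1 -[X in ccv _ X]mulr1.
have e1 : u + v = (u + t) + (v - t) by ring.
have := ccvM (ccvM cR (column_ratio am e1)) (column_ratio bm (esym e1)).
apply: ccv_ext.
have [n1 h1] := column_neq0 (u + t) am; have [n2 h2] := column_neq0 (v - t) am.
have [n3 h3] := column_neq0 u bm; have [n4 h4] := column_neq0 v bm.
exists (maxn (maxn n1 n2) (maxn n3 n4)) => n; rewrite !geq_max => /andP[/andP[/h1 z1 /h2 z2] /andP[/h3 z3 /h4 z4]].
rewrite /S !sigma_partial_linear.
pose L z := \prod_(p <- box n) (z - lat p.1 p.2).
pose K z := \prod_(p <- box n) expfactor p z.
rewrite -/(L u) -/(L v) -/(L (u + w)) -/(L (v + w)) -/(L (u + t)) -/(L (v - t)).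
rewrite -/(L (u + t + w)) -/(L (v - t + w)).
rewrite -/(K u) -/(K v) -/(K (u + w)) -/(K (v + w)) -/(K (u + t)) -/(K (v - t)).
rewrite -/(K (u + t + w)) -/(K (v - t + w)) -/(a n) -/(b n).
have Kq : K (u + w) * K (v + w) * (K (u + t) * K (v - t)) =
    K u * K v * (K (u + t + w) * K (v - t + w)).
  by rewrite /K -!big_split; apply: eq_bigr => p _; exact: expfactor_quad.
have Ls z : b n z * L (z + w) = a n z * L z by exact: linear_shift.
have Lw z : b n z != 0 -> L (z + w) = a n z * L z / b n z.
  by move=> bz; rewrite -Ls mulrC mulKf.
have Lt z : a n z != 0 -> L z = b n z * L (z + w) / a n z.
  by move=> az; rewrite Ls mulrC mulKf.
rewrite (Lw u) // (Lw v) // (Lt (u + t)) // (Lt (v - t)) //.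
move: z1 z2 z3 z4; rewrite -/(a n) -/(b n) => z1 z2 z3 z4.
set Lu := L u; set Lv := L v; set Lut := L (u + t + w); set Lvt := L (v - t + w).
transitivity (a n u * a n v * b n (u + t) * b n (v - t) * Lu * Lv * Lut * Lvt /
  (b n u * b n v * a n (u + t) * a n (v - t)) * (K u * K v * (K (u + t + w) * K (v - t + w)))).
  by field; rewrite z1 z2 z3 z4.
by rewrite -Kq; field; rewrite z1 z2 z3 z4.
Qed.

Lemma latpt_swap (m n : int) : latpt w2 w1 n m = lat m n :> C.
Proof. by rewrite /latpt addrC. Qed.

Lemma lattice_bound_swap : lattice_bound w2 w1 c.
Proof.
by have [c0 h] := lb; split=> // m n; have [h1 h2] := h n m; rewrite latpt_swap.
Qed.

(** Exchanging the half-periods transposes the square boxes; results for 2 w1 thereby hold for 2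
    w2. *)
Lemma wsigma_swap u : wsigma w2 w1 u = wsigma w1 w2 u :> C.
Proof.
rewrite /wsigma; suff -> : (fun n => sigma_partial w2 w1 n u) = (fun n => sigma_partial w1 w2 n u) by [].
apply/funext => n; rewrite /sigma_partial (exchange_big_dep xpredT) //=; congr (_ * _).
apply: eq_bigr => i _; apply: eq_big => [j|j _]; first by rewrite orbC.
by rewrite latpt_swap.
Qed.

End SigmaQuadratic.

(** * Holomorphic functions with zero derivative *)

Section ConstantDerivative.
Variable R : realType.
Local Notation C := R[i].
Local Notation N := (@cmod R).
Implicit Types (f g : C -> C) (z c : C).

Lemma cder_germ f c A B : germ_at f c A B ->
  cder f c = (cder A c * B c - A c * cder B c) / B c ^+ 2.
Proof.
move=> gf; have [B0 fc] := germ_elim gf; have [eA eB [d d0 h]] := gf.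
have [A1 [eA1 hA1 <-]] := entire_tangent c eA; have [B1 [eB1 hB1 <-]] := entire_tangent c eB.
rewrite (@cder_quotient _ f c (fun z => (A1 z - f c * B1 z) / B z) d d0).
- by rewrite fc; field.
- apply: (@germ_ccont _ _ _ (fun z => A1 z - f c * B1 z) B).
  by apply: (germ_intro _ eB B0 ltr01) => //; entire_tac.
move=> z zd; have [Bz ->] := h z zd.
have e : A z - f c * B z = (z - c) * (A1 z - f c * B1 z).
  by rewrite (hA1 z) (hB1 z) fc; field.
have -> : A z / B z = f c + (A z - f c * B z) / B z by field.
by rewrite e mulrA.
Qed.

Lemma holo_cder f : holo f -> holo (cder f).
Proof.
move=> hf c; have [A [B gf]] := hf c; have [eA eB [d d0 h]] := gf.
have [B0 fc] := germ_elim gf.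
have eA' := entire_cder eA; have eB' := entire_cder eB.
exists (fun z => cder A z * B z - A z * cder B z), (fun z => B z ^+ 2).
have e1 : entire (fun z => cder A z * B z - A z * cder B z) by entire_tac.
have e2 : entire (fun z => B z ^+ 2) by entire_tac.
have B2 : B c ^+ 2 != 0 by rewrite expf_neq0.
apply: (germ_intro e1 e2 B2 d0).
move=> z zd _; apply: cder_germ; split=> //; exists (d - N (z - c)); first by rewrite subr_gt0.
move=> y yz; apply: h; have -> : y - c = (y - z) + (z - c) by ring.
by apply: le_lt_trans (cmodD _ _) _; lra.
Qed.

Lemma cder_holo f c g : holo g -> quotient_at f c g -> cder f c = g c.
Proof. by move=> hg fg; apply: (cder_quotient ltr01) => // *; exact: holo_ccont. Qed.

(** Along the line t z, the real and imaginary parts of f have real derivative 0. The projection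
    [pr] treats both at once. *)
Lemma cder0_cst f : holo f -> (forall z, cder f z = 0) -> forall z, f z = f 0.
Proof.
move=> hf f0 z.
have line (pr : C -> R) : (forall y, `|pr y| <= N y) -> (forall a b, pr (a - b) = pr a - pr b) ->
    pr (f z) = pr (f 0).
  move=> prN prB; pose F (t : R) := pr (f (t%:C * z)).
  suff dF (x : R) : is_derive x (1 : R) F 0.
    by have := is_derive_0_is_cst 1 0 dF; rewrite /F mul1r mul0r.
  have [g hg fg] := holo_quotient (x%:C * z) hf.
  have g0 : g (x%:C * z) = 0 by rewrite -(cder_holo hg fg) f0.
  have cv : (h^-1 *: ((F \o shift x) (h *: (1 : R)) - F x) @[h --> (0 : R)^'] --> (0 : R))%classic.
    apply/cvgrPdist_lt => e e0.
    have z1 : 0 < N z + 1 by have := cmod_ge0 z; lra.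
    have [d d0 hd] := holo_ccont (x%:C * z) hg (divr_gt0 e0 z1).
    have dz : 0 < d / (N z + 1) by rewrite divr_gt0.
    near=> h.
    have h0 : h != 0 by near: h; exact: nbhs_dnbhs_neq.
    have hz : `|h| < d / (N z + 1) by near: h; exact: dnbhs0_lt.
    rewrite sub0r normrN /= /F -prB /shift /= /GRing.scale /= mulr1.
    have e1 : (h + x)%:C * z - x%:C * z = h%:C * z by rewrite rmorphD; ring.
    rewrite (fg ((h + x)%:C * z)) e1 addrC addKr normrM normfV.
    have Nhz : N (h%:C * z) = `|h| * N z by rewrite cmodM cmod_real.
    have g1 : N (g ((h + x)%:C * z)) < e / (N z + 1).
      have := hd ((h + x)%:C * z); rewrite e1 g0 subr0; apply; rewrite Nhz.
      by rewrite ltr_pdivlMr // in hz; have := normr_ge0 h; nra.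
    rewrite mulrC ltr_pdivrMr ?normr_gt0 //; apply: le_lt_trans (prN _) _.
    rewrite cmodM Nhz; rewrite ltr_pdivlMr // in g1.
    have h1 : 0 < `|h| by rewrite normr_gt0.
    have := cmod_ge0 (g ((h + x)%:C * z)); have := cmod_ge0 z; nra.
  split; first by apply/cvg_ex; exists 0.
  by rewrite /derive; apply: cvg_lim.
have re := line (@complex.Re R) (@Re_le_cmod R) ltac:(by move=> [? ?] [? ?]).
have im := line (@complex.Im R) (@Im_le_cmod R) ltac:(by move=> [? ?] [? ?]).
by apply/eqP; rewrite eq_complex re im !eqxx.
Unshelve. all: by end_near. Qed.

End ConstantDerivative.

(** * Simple zeros and quasi-periods from the four-term identity *)

Section SigmaPeriods.
Variable R : realType.
Local Notation C := R[i].
Local Notation N := (@cmod R).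

Lemma cder_mul0 (f g : C -> C) z : entire f -> entire g -> f z = 0 ->
  cder (fun u => f u * g u) z = cder f z * g z.
Proof. by move=> ef eg f0; rewrite cderM // f0 mul0r addr0. Qed.

Lemma entire_shift (f : C -> C) (p : C) : entire f -> entire (fun u => f (u + p)).
Proof. by move=> ef; entire_tac. Qed.

Lemma cder_shift (f : C -> C) (p z : C) : entire f ->
  cder (fun u => f (u + p)) z = cder f (z + p).
Proof.
move=> ef; have <- : (fun u => f (p + 1 * u)) = (fun u => f (u + p)).
  by apply/funext => u; rewrite mul1r addrC.
by rewrite cder_affine // mulr1 mul1r addrC.
Qed.

Lemma cder_reflect (f : C -> C) (p z : C) : entire f ->
  cder (fun u => f (p - u)) z = - cder f (p - z).
Proof.
move=> ef; have <- : (fun u => f (p + (-1) * u)) = (fun u => f (p - u)).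
  by apply/funext => u; rewrite mulN1r.
by rewrite cder_affine // mulrN1 mulN1r.
Qed.

Variables (s : C -> C) (p1 p2 : C).
Hypotheses (es : entire s) (s0 : s 0 = 0) (ds0 : cder s 0 = 1).
Hypothesis sN : forall u, s (- u) = - s u.
Hypothesis zs : forall u, s u = 0 -> exists m n : int, u = m%:~R * p1 + n%:~R * p2.
Hypothesis indep : forall m n : int, m%:~R * p1 + n%:~R * p2 = 0 -> m = 0 /\ n = 0.

(** Produces points where [s] does not vanish: division points of the lattice with a non-integral
    coordinate. *)
Lemma nonlattice (k m n : int) (x : C) : k%:~R * x = m%:~R * p1 + n%:~R * p2 ->
  (forall a b : int, (k * a)%R = m -> (k * b)%R = n -> False) -> s x != 0.
Proof.
move=> kx nk; apply/eqP => /zs[a [b xab]].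
have [|h1 h2] := @indep (k * a - m)%R (k * b - n)%R.
  have := kx; rewrite xab => h; rewrite !mulrzBr !intrM.
  by apply/eqP; move/eqP: h; rewrite -subr_eq0 => /eqP h; apply/eqP; rewrite -[RHS]h; ring.
by apply: (nk a b); lia.
Qed.

Section OnePeriod.
Variable p : C.
Hypothesis quad : forall u v t,
  s (u + p) * s (v + p) * (s (u + t) * s (v - t)) =
  s u * s v * (s (u + t + p) * s (v - t + p)).
(* [v] and [t] are chosen such that the arguments other than [z] and [z + p] avoid the lattice. *)
Hypothesis generic : exists v t, [/\ s v != 0, s (v + p) != 0, s (v - t) != 0,
  s (v - t + p) != 0 & forall z, s z = 0 \/ s (z + p) = 0 -> s (z + t) != 0 /\ s (z + t + p) != 0].

(** For generic [v] and [t], only [s z] and [s (z + p)] can vanish in the four-term identity, one on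
    each side. *)
Lemma zero_shift z : s z = 0 <-> s (z + p) = 0.
Proof.
have [v [t [v0 vp0 vt0 vtp0 zt]]] := generic; have := quad z v t; split=> h0.
  have [z1 z2] := zt z (or_introl h0).
  move: H; rewrite h0 !mul0r => /eqP.
  by rewrite !mulf_eq0 (negbTE vp0) (negbTE z1) (negbTE vt0) !orbF => /eqP.
have [z1 z2] := zt z (or_intror h0).
move: H; rewrite h0 !mul0r => /esym/eqP.
by rewrite !mulf_eq0 (negbTE v0) (negbTE z2) (negbTE vtp0) !orbF => /eqP.
Qed.

(** Differentiating the four-term identity in u at a common zero leaves one term on each side. This
    will carry s'(0) = 1 to all lattice points. *)
Lemma simple_zero_shift z : s z = 0 /\ cder s z != 0 <-> s (z + p) = 0 /\ cder s (z + p) != 0.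
Proof.
have [v [t [v0 vp0 vt0 vtp0 zt]]] := generic.
suff key : s z = 0 -> s (z + p) = 0 -> (cder s z != 0) = (cder s (z + p) != 0).
  by split=> -[z0 dz]; have z0' := z0; [apply zero_shift in z0'; rewrite key in dz | apply zero_shift in z0'; rewrite -key in dz].
move=> z0 zp0; have [z1 z2] := zt z (or_introl z0).
pose F u := s (u + p) * (s (u + t) * (s (v + p) * s (v - t))).
pose G u := s u * (s (u + t + p) * (s v * s (v - t + p))).
have FG : F = G.
  by apply/funext => u; rewrite /F /G; transitivity (s (u + p) * s (v + p) * (s (u + t) * s (v - t)));
    [ring | rewrite quad; ring].
have e1 : entire (fun u => s (u + p)) by exact: entire_shift.
have e2 : entire (fun u => s (u + t) * (s (v + p) * s (v - t))) by entire_tac.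
have e3 : entire (fun u => s (u + t + p) * (s v * s (v - t + p))) by entire_tac.
have dF : cder F z = cder s (z + p) * (s (z + t) * (s (v + p) * s (v - t))).
  by rewrite (@cder_mul0 (fun u => s (u + p)) _ z e1 e2 zp0) cder_shift.
have dG : cder G z = cder s z * (s (z + t + p) * (s v * s (v - t + p))).
  by rewrite (@cder_mul0 s _ z es e3 z0).
move: dF; rewrite FG dG => h.
have k1 : s (z + t + p) * (s v * s (v - t + p)) != 0 by rewrite !mulf_neq0.
have k2 : s (z + t) * (s (v + p) * s (v - t)) != 0 by rewrite !mulf_neq0.
move: h k1 k2; move: (_ * (s v * _)) (_ * (_ * s (v - t))) => K1 K2 h k1 k2.
have := congr1 (fun x => x == 0) h; rewrite /= !mulf_eq0 (negbTE k1) (negbTE k2) !orbF.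
by move=> ->.
Qed.

Lemma cder_cexp_affine (A z : C) : cder (fun u => cexp (A * u)) z = A * cexp (A * z) :> C.
Proof.
have ec := @entire_cexp R; have eA : entire (fun u => A * u) by entire_tac.
rewrite (@cder_comp _ (@cexp R) (fun u => A * u)) // cder_cexp.
rewrite (@cderM _ (fun=> A) id) ?cder_cst ?cder_id; [|exact: entire_cst|exact: entire_id].
by rewrite mul0r add0r mulr1 mulrC.
Qed.

(** The derivative of the four-term identity in t at t = 0. It says zeta(u + p) - zeta(u) = A,
    cleared of denominators, with A read off at u = v. *)
Lemma log_derivative_shift : exists A : C, forall u,
  s (u + p) * cder s u - s u * cder s (u + p) + A * (s u * s (u + p)) = 0.
Proof.
have [v [_ [v0 vp0 _ _ _]]] := generic.
exists (cder s (v + p) / s (v + p) - cder s v / s v) => u.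
pose K1 := s (u + p) * s (v + p); pose K2 := s u * s v.
pose F t := K1 * (s (t + u) * s (v - t)).
pose G t := K2 * (s (t + (u + p)) * s ((v + p) - t)).
have FG : F = G.
  apply/funext => t; rewrite /F /G /K1 /K2 (addrC t) quad.
  by congr (_ * (s _ * s _)); ring.
have e1 q : entire (fun t => s (t + q)) by exact: entire_shift.
have e2 q : entire (fun t => s (q - t)) by entire_tac.
have dP K q r : cder (fun t => K * (s (t + q) * s (r - t))) 0 = K * (cder s q * s r - s q * cder s r).
  have e3 : entire (fun t => s (t + q) * s (r - t)) by exact: entireM.
  rewrite (@cderM _ (fun=> K) _ 0 (entire_cst K) e3) cder_cst mul0r add0r.
  rewrite (@cderM _ (fun t => s (t + q)) (fun t => s (r - t)) 0 (e1 q) (e2 r)).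
  by rewrite cder_shift // cder_reflect // subr0 add0r; ring.
have dF : cder F 0 = K1 * (cder s u * s v - s u * cder s v) by exact: dP.
move: dF; rewrite FG => dF.
have dG : cder G 0 = K2 * (cder s (u + p) * s (v + p) - s (u + p) * cder s (v + p)) by exact: dP.
move: dG; rewrite dF /K1 /K2 => /eqP; rewrite -subr_eq0 => /eqP h.
apply: (mulfI (mulf_neq0 v0 vp0)); rewrite mulr0 -[RHS]h.
by field; rewrite v0 vp0.
Qed.

(** The quotient of s(u + p) exp(-A u) by s(u) is holomorphic by [zero_shift], and its derivative is
    zero by [log_derivative_shift]. *)
Lemma quasi_period : isolated_zeros s -> simple_zeros s ->
  exists k A : C, k != 0 /\ forall u, s (u + p) = k * cexp (A * u) * s u.
Proof.
move=> iz sz; have [A hA] := log_derivative_shift.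
pose F u := s (u + p) * cexp (- A * u).
have e1 : entire (fun u => s (u + p)) by exact: entire_shift.
have e2 : entire (fun u => cexp (- A * u)).
  by have ec := @entire_cexp R; apply: (@entire_comp _ (@cexp R) (fun u => - A * u)); entire_tac.
have eF : entire F by exact: entireM.
have FD z : s z = 0 -> F z = 0 by move=> /zero_shift h; rewrite /F h mul0r.
have [Q hQ FQ] := removable_quotient (entire_holo eF) es sz FD.
have dF u : cder F u = cder s (u + p) * cexp (- A * u) - A * (s (u + p) * cexp (- A * u)).
  rewrite (@cderM _ (fun u => s (u + p)) (fun u => cexp (- A * u)) u e1 e2).
  by rewrite cder_shift // cder_cexp_affine; ring.
have Qcst : forall z, Q z = Q 0.
  apply: cder0_cst => //.
  apply: (@eq0_of_mul _ _ (fun z => s z * s z)).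
  - by move=> c; apply: holo_ccont; exact: holo_cder.
  - exact: isolated_zerosM.
  move=> z.
  have [g hg Qg] := holo_quotient z hQ; have [s1 [es1 hs1 ds1]] := entire_tangent z es.
  have hh : holo (fun y => g y * s y + Q z * s1 y).
    by apply: holoD; [apply: holoM => //; exact: entire_holo|apply: holoZ; exact: entire_holo].
  have dF2 : cder F z = g z * s z + Q z * cder s z.
    rewrite -ds1; apply: (@cder_holo _ F z (fun y => g y * s y + Q z * s1 y) hh) => y.
    by rewrite !FQ (hs1 y) (Qg y); ring.
  rewrite (cder_holo hg Qg).
  have -> : g z * (s z * s z) = cder F z * s z - F z * cder s z by rewrite dF2 FQ; ring.
  rewrite dF /F; transitivity (- cexp (- A * z) * (s (z + p) * cder s z - s z * cder s (z + p) + A * (s z * s (z + p)))).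
    by ring.
  by rewrite hA mulr0.
have sp u : s (u + p) = Q 0 * cexp (A * u) * s u.
  have := FQ u; rewrite /F Qcst => h.
  have ee : cexp (- A * u) * cexp (A * u) = 1 :> C by rewrite -cexpD mulNr addNr cexp0.
  have -> : s (u + p) = s (u + p) * (cexp (- A * u) * cexp (A * u)) by rewrite ee mulr1.
  by rewrite mulrA h; ring.
exists (Q 0), A; split=> //; apply/eqP => Q0.
have [v [_ [_ vp0 _ _ _]]] := generic.
by move: vp0; rewrite sp Q0 !mul0r eqxx.
Qed.

End OnePeriod.

(** At u = -p/2 oddness turns the quasi-period relation into k exp(-A p/2) = -1. *)
Lemma quasi_period_sq (p k A : C) : s (p / 2) != 0 ->
  (forall u, s (u + p) = k * cexp (A * u) * s u) -> k ^+ 2 = cexp (A * p).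
Proof.
move=> sp h; have h2 : - (p / 2) + p = p / 2 by field.
have := h (- (p / 2)); rewrite h2 sN mulrN -mulNr -[X in X = _]mul1r => /(mulIf sp) e.
pose a : C := cexp (A * - (p / 2)); pose b : C := cexp (A * (p / 2)).
have ka : k * a = -1 by rewrite [in RHS]e opprK.
have ab : a * b = 1 by rewrite /a /b -cexpD mulrN addNr cexp0.
have -> : A * p = A * (p / 2) + A * (p / 2) by field.
rewrite cexpD -/b; have -> : k = - b by rewrite -[LHS]mulr1 -ab mulrA ka mulN1r.
by rewrite sqrrN expr2.
Qed.

End SigmaPeriods.

(** * Theta functions of degree one *)

Section DegreeOne.
Variable R : realType.
Local Notation C := R[i].
Local Notation N := (@cmod R).

Lemma simple_zerosM (f g : C -> C) : entire f -> entire g -> simple_zeros f -> simple_zeros g ->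
  (forall z, f z = 0 -> g z != 0) -> simple_zeros (fun z => f z * g z).
Proof.
move=> ef eg sf sg fg z /eqP; rewrite mulf_eq0; case/orP=> /eqP z0.
  by rewrite (@cder_mul0 _ f g) // mulf_neq0 ?sf ?fg.
have -> : (fun z => f z * g z) = (fun z => g z * f z) by apply/funext => y; rewrite mulrC.
rewrite (@cder_mul0 _ g f) // mulf_neq0 ?sg //.
by apply/eqP => /fg; rewrite z0 eqxx.
Qed.

Lemma simple_zeros_shift (f : C -> C) p : entire f -> simple_zeros f -> simple_zeros (fun z => f (z + p)).
Proof. by move=> ef sf z z0; rewrite cder_shift //; exact: sf. Qed.

Lemma simple_zeros_reflect (f : C -> C) p : entire f -> simple_zeros f -> simple_zeros (fun z => f (p - z)).
Proof. by move=> ef sf z z0; rewrite cder_reflect // oppr_eq0; exact: sf. Qed.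

Definition multiplier (k A z : C) : C := k * cexp (A * z).

Lemma multiplier_neq0 (k A z : C) : k != 0 -> multiplier k A z != 0.
Proof. by move=> k0; rewrite mulf_neq0 // cexp_neq0. Qed.

Lemma multiplierM (k A x y : C) :
  multiplier k A x * multiplier k A y = k ^+ 2 * cexp (A * (x + y)).
Proof. by rewrite /multiplier mulrDr cexpD; ring. Qed.

Variables (s : C -> C) (p1 p2 : C).

(** The interface between the analysis of the sigma product and the determinant argument. *)
Record sigma_like (k1 A1 k2 A2 : C) (rho : R) : Prop := SigmaLike {
  sl_entire : entire s;
  sl_odd : forall u, s (- u) = - s u;
  sl_zero : forall u, s u = 0 -> exists m n : int, u = m%:~R * p1 + n%:~R * p2;
  sl_zero0 : s 0 = 0;
  sl_der0 : cder s 0 = 1;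
  sl_simple : simple_zeros s;
  sl_indep : forall m n : int, m%:~R * p1 + n%:~R * p2 = 0 -> m = 0 /\ n = 0;
  sl_compact : forall z, exists m n : int, N (z + m%:~R * p1 + n%:~R * p2) <= rho;
  sl_k1 : k1 != 0;
  sl_k2 : k2 != 0;
  sl_per1 : forall z, s (z + p1) = multiplier k1 A1 z * s z;
  sl_per2 : forall z, s (z + p2) = multiplier k2 A2 z * s z }.

Variables (k1 A1 k2 A2 : C) (rho : R).
Hypothesis sl : sigma_like k1 A1 k2 A2 rho.
Let es := sl_entire sl.
Let sN := sl_odd sl.

Lemma sigma_isolated : isolated_zeros s.
Proof. exact: simple_isolated es (sl_simple sl). Qed.

Lemma lattice_ind (P : C -> Prop) : (forall z, P z <-> P (z + p1)) -> (forall z, P z <-> P (z + p2)) ->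
  forall z a, P a -> s (z - a) = 0 -> P z.
Proof.
move=> h1 h2 z a Pa /(sl_zero sl)[m [n zmn]].
have -> : z = a + m%:~R * p1 + n%:~R * p2 by rewrite -addrA -zmn addrC subrK.
exact: (int_periods h2 n _).1 ((int_periods h1 m a).1 Pa).
Qed.

Lemma quasi_zero (f : C -> C) (p k A : C) : k != 0 ->
  (forall z, f (z + p) = multiplier k A z * f z) -> forall z, f z = 0 <-> f (z + p) = 0.
Proof.
move=> k0 h z; rewrite h; split=> [->|/eqP]; first by rewrite mulr0.
by rewrite mulf_eq0 (negbTE (multiplier_neq0 _ _ k0)) => /eqP.
Qed.

Lemma sigma_zero_sub x y : s x = 0 -> s y = 0 -> s (x - y) = 0.
Proof.
move=> x0 y0.
apply: (@lattice_ind (fun z => s (z - y) = 0) _ _ x 0).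
- by move=> z; rewrite addrAC; exact: (quasi_zero (sl_k1 sl) (sl_per1 sl)).
- by move=> z; rewrite addrAC; exact: (quasi_zero (sl_k2 sl) (sl_per2 sl)).
- by rewrite sub0r sN y0 oppr0.
- by rewrite subr0.
Qed.

Lemma quasi_of_cross (f : C -> C) (p k A : C) : (forall c, ccont (fun z => f (z + p) - multiplier k A z * f z) c) ->
  (forall z, s (z + p) = multiplier k A z * s z) ->
  (forall z, f (z + p) * s z = f z * s (z + p)) -> forall z, f (z + p) = multiplier k A z * f z.
Proof.
move=> cf hs hf z; apply/eqP; rewrite -subr_eq0; apply/eqP; move: z.
apply: (eq0_of_mul cf sigma_isolated) => z; rewrite mulrBl hf hs; ring.
Qed.

Lemma entire_multiplier (k A : C) : entire (multiplier k A).
Proof.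
have ec := @entire_cexp R.
apply: (@entireM _ (fun=> k) (fun z => cexp (A * z))); first exact: entire_cst.
by apply: (@entire_comp _ (@cexp R) (fun z => A * z)); entire_tac.
Qed.

Lemma holo_quasi_ccont (f : C -> C) (p k A : C) : holo f ->
  forall c, ccont (fun z => f (z + p) - multiplier k A z * f z) c.
Proof.
move=> hf c; apply: holo_ccont; apply: holoB.
  by apply: holo_ext (holo_affine p 1 hf) => z; rewrite mul1r addrC.
by apply: holoM => //; apply: entire_holo; exact: entire_multiplier.
Qed.

(** Periodicity of g / s, cleared of the denominator: [g] has the multipliers of [s]. *)
Definition cross_periodic (g : C -> C) :=
  (forall z, g (z + p1) * s z = g z * s (z + p1)) /\
  (forall z, g (z + p2) * s z = g z * s (z + p2)).

Lemma cross_quasi g : holo g -> cross_periodic g ->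
  (forall z, g (z + p1) = multiplier k1 A1 z * g z) /\
  (forall z, g (z + p2) = multiplier k2 A2 z * g z).
Proof.
move=> hg [h1 h2]; split.
  by apply: (@quasi_of_cross g p1 k1 A1 _ (sl_per1 sl) h1); exact: holo_quasi_ccont.
by apply: (@quasi_of_cross g p2 k2 A2 _ (sl_per2 sl) h2); exact: holo_quasi_ccont.
Qed.

Lemma cross_zero g a : holo g -> cross_periodic g -> g a = 0 ->
  forall z, s (z - a) = 0 -> g z = 0.
Proof.
move=> hg cg ga z; have [q1 q2] := cross_quasi hg cg.
apply: (lattice_ind (P := fun z => g z = 0)) => // y.
  exact: (quasi_zero (sl_k1 sl) q1).
exact: (quasi_zero (sl_k2 sl) q2).
Qed.

Lemma half_neq0 (m n : int) x : 2 * x = m%:~R * p1 + n%:~R * p2 ->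
  (m %% 2 != 0)%Z || (n %% 2 != 0)%Z -> s x != 0.
Proof.
move=> xmn mn; apply: (@nonlattice _ s p1 p2 (sl_zero sl) (sl_indep sl) 2 m n) => //.
by move=> a b am bn; move: mn; rewrite -am -bn; lia.
Qed.

(** At a half period the odd function [s], which is nonzero there, forces M = -1; an even [g] with
    the same multiplier satisfies g(x) = -g(x). *)
Lemma half_vanish g x (M : C) : (forall z, g (- z) = g z) -> s x != 0 ->
  g x = M * g (- x) -> s x = M * s (- x) -> g x = 0.
Proof.
move=> ge sx gx; rewrite sN mulrN -mulNr -[X in X = _]mul1r => /(mulIf sx) M1.
have M1' : M = -1 by rewrite [in RHS]M1 opprK.
have n2 : 2 != 0 :> C by rewrite pnatr_eq0.
move: gx; rewrite ge M1' mulN1r => h; apply: (mulfI n2); rewrite mulr0.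
by have := congr1 (fun y => g x + y) h; rewrite /= subrr => <-; ring.
Qed.

(* Modulo [s], [g] is even, so it vanishes at the three half periods; the
   quotient of [K s^2] by the product [D] of the translates of [s] vanishing there
   is elliptic without poles, hence constant, and it is 0 at the origin. *)
Lemma degree_one g : holo g -> cross_periodic g -> exists k, forall z, g z = k * s z.
Proof.
move=> hg [g1 g2]; have hs := entire_holo es.
have n2 : 2 != 0 :> C by rewrite pnatr_eq0.
have s0 := sl_zero0 sl.
(* Twice the odd part. It vanishes at 0, hence on the lattice, so F / s is constant; subtracting
   half of it times [s] from [g] leaves the even function [K]. *)
pose F z := g z - g (- z).
have hF : holo F.
  by apply: holoB => //; apply: holo_ext (holo_affine 0 (-1) hg) => z; rewrite mulN1r add0r.
have refl p : (forall z, g (z + p) * s z = g z * s (z + p)) ->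
    forall z, F (z + p) * s z = F z * s (z + p).
  move=> h z; have := h (- (z + p)); rewrite opprD subrK -opprD !sN => h'.
  have {}h' : g (- (z + p)) * s z = g (- z) * s (z + p).
    by apply: oppr_inj; rewrite -!mulrN h'.
  by rewrite /F !mulrBl h h'.
have cF : cross_periodic F by split; exact: refl.
have F0 z : s z = 0 -> F z = 0.
  by move=> z0; apply: (@cross_zero F 0 hF cF) => //; rewrite ?subr0 // /F oppr0 subrr.
have [c0 Fc] := elliptic_quotient (sl_compact sl) hF es (sl_simple sl) F0 cF.1 cF.2.
pose K z := g z - c0 / 2 * s z.
have hK : holo K by apply: holoB => //; exact: holoZ.
have Ke z : K (- z) = K z.
  apply/eqP; rewrite eq_sym -subr_eq0; apply/eqP; rewrite /K sN.
  by have := Fc z; rewrite /F => h; transitivity (g z - g (- z) - c0 * s z); [field|rewrite h subrr].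
have cK : cross_periodic K.
  by split=> z; rewrite /K !mulrBl ?g1 ?g2; congr (_ - _); ring.
have [q1 q2] := cross_quasi hK cK.
pose x1 := p1 / 2; pose x2 := p2 / 2; pose x3 := (p1 + p2) / 2.
have sx1 : s x1 != 0 by apply: (@half_neq0 1 0); rewrite /x1 // mulrC divfK // mul1r mul0r addr0.
have sx2 : s x2 != 0 by apply: (@half_neq0 0 1); rewrite /x2 // mulrC divfK // mul1r mul0r add0r.
have sx3 : s x3 != 0 by apply: (@half_neq0 1 1); rewrite /x3 // mulrC divfK // !mul1r.
have K1 : K x1 = 0.
  apply: (half_vanish Ke sx1 (M := multiplier k1 A1 (- x1))).
    by rewrite -q1; congr K; rewrite /x1; field.
  by rewrite -(sl_per1 sl); congr s; rewrite /x1; field.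
have K2 : K x2 = 0.
  apply: (half_vanish Ke sx2 (M := multiplier k2 A2 (- x2))).
    by rewrite -q2; congr K; rewrite /x2; field.
  by rewrite -(sl_per2 sl); congr s; rewrite /x2; field.
have K3 : K x3 = 0.
  apply: (half_vanish Ke sx3 (M := multiplier k2 A2 (- x3 + p1) * multiplier k1 A1 (- x3))).
    by rewrite -mulrA -q1 -q2; congr K; rewrite /x3; field.
  by rewrite -mulrA -(sl_per1 sl) -(sl_per2 sl); congr s; rewrite /x3; field.
(* The third zero is put at -x3 so that x1 + x2 - x3 = 0; then [D] has exactly the multipliers of
   s^3, as has K s^2. *)
pose D z := s (z + - x1) * (s (z + - x2) * s (z + x3)).
have esh q : entire (fun z => s (z + q)) by exact: entire_shift.
have eD : entire D by do 2!apply: entireM => //.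
have disj a b : s (b - a) != 0 -> forall z, s (z + a) = 0 -> s (z + b) != 0.
  move=> ab z za; apply/eqP => zb; move/eqP: ab; apply.
  by rewrite -(sigma_zero_sub zb za); congr s; ring.
have ssh q : simple_zeros (fun z => s (z + q)) by apply: simple_zeros_shift => //; exact: sl_simple sl.
have d12 : s (- x2 - - x1) != 0 by apply: (@half_neq0 1 (-1)); rewrite // /x1 /x2; field.
have d13 : s (x3 - - x1) != 0 by apply: (@half_neq0 2 1); rewrite // /x1 /x3; field.
have d23 : s (x3 - - x2) != 0 by apply: (@half_neq0 1 2); rewrite // /x2 /x3; field.
have sD : simple_zeros D.
  apply: simple_zerosM => //; first exact: entireM.
    by apply: simple_zerosM => //; exact: disj.
  by move=> z z0; rewrite mulf_neq0 // (disj (- x1)).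
pose G z := K z * (s z * s z).
have hG : holo G by apply: holoM => //; exact: holoM.
have GD z : D z = 0 -> G z = 0.
  rewrite /G /D => /eqP; rewrite !mulf_eq0 => /or3P[] /eqP z0.
  - by rewrite (cross_zero hK cK K1 z0) mul0r.
  - by rewrite (cross_zero hK cK K2 z0) mul0r.
  - by rewrite (@cross_zero K (- x3) hK cK) ?mul0r ?Ke // opprK.
have per p k A : (forall z, s (z + p) = multiplier k A z * s z) ->
    (forall z, K (z + p) = multiplier k A z * K z) -> forall z, G (z + p) * D z = G z * D (z + p).
  move=> sp Kp z; have sp' q : s (z + p + q) = multiplier k A (z + q) * s (z + q) by rewrite addrAC sp.
  rewrite /G /D !sp' sp Kp.
  have mm : multiplier k A (z + - x1) * (multiplier k A (z + - x2) * multiplier k A (z + x3)) =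
      multiplier k A z * (multiplier k A z * multiplier k A z).
    rewrite !multiplierM /multiplier.
    have -> : (k * cexp (A * (z + - x1))) * (k ^+ 2 * cexp (A * (z + - x2 + (z + x3)))) =
      k ^+ 3 * (cexp (A * (z + - x1)) * cexp (A * (z + - x2 + (z + x3)))) by ring.
    have -> : (k * cexp (A * z)) * (k ^+ 2 * cexp (A * (z + z))) =
      k ^+ 3 * (cexp (A * z) * cexp (A * (z + z))) by ring.
    by rewrite -!cexpD; congr (_ * cexp _); rewrite /x1 /x2 /x3; field.
  set P := multiplier k A z in mm *.
  set a := multiplier _ _ _ in mm *; set b := multiplier _ _ _ in mm *; set d := multiplier _ _ _ in mm *.
  transitivity (P * (P * P) * (K z * (s z * s z) * (s (z + - x1) * (s (z + - x2) * s (z + x3))))).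
    by ring.
  by rewrite -mm; ring.
have [c GcD] := elliptic_quotient (sl_compact sl) hG eD sD GD (per _ _ _ (sl_per1 sl) q1) (per _ _ _ (sl_per2 sl) q2).
have D0 : D 0 != 0 by rewrite /D !add0r !sN !mulf_neq0 ?oppr_eq0.
have c00 : c = 0.
  by have /esym/eqP := GcD 0; rewrite /G s0 !mulr0 mulf_eq0 (negbTE D0) orbF => /eqP.
have Kz : forall z, K z = 0.
  apply: (@eq0_of_mul _ K (fun z => s z * s z)).
  - by move=> z; exact: holo_ccont.
  - by apply: isolated_zerosM; exact: sigma_isolated.
  - by move=> z; have := GcD z; rewrite c00 mul0r.
exists (c0 / 2) => z; apply/eqP; rewrite -subr_eq0; exact/eqP/Kz.
Qed.

End DegreeOne.

(** * The Weierstrass sigma function satisfies [sigma_like] *)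

Section WeierstrassSigma.
Variable R : realType.
Local Notation C := R[i].
Local Notation N := (@cmod R).

Lemma latptE (w1 w2 : C) (m n : int) :
  latpt w1 w2 m n = m%:~R * (2 * w1) + n%:~R * (2 * w2) :> C.
Proof. by rewrite /latpt; ring. Qed.

Lemma period_ratio (w1 w2 : C) : 0 < complex.Im (w2 / w1) ->
  w1 != 0 /\ exists a b : R, 0 < b /\ w2 = w1 * (a +i* b).
Proof.
move=> h; have w10 : w1 != 0.
  by apply/eqP => w0; move: h; rewrite w0 invr0 mulr0 ltxx.
split=> //; exists (complex.Re (w2 / w1)), (complex.Im (w2 / w1)); split=> //.
have -> : complex.Re (w2 / w1) +i* complex.Im (w2 / w1) = w2 / w1 by case: (w2 / w1).
by rewrite mulrC divfK.
Qed.

(** With w2/w1 = a + ib, the imaginary part of m + n w2/w1 controls |n| b; then its real part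
    controls |m| up to |n||a|. The two terms of the minimum [e] come from these two bounds. *)
Lemma lattice_bound_exists (w1 w2 : C) : 0 < complex.Im (w2 / w1) ->
  exists c, lattice_bound w1 w2 c.
Proof.
move=> /period_ratio[w10 [a [b [b0 ->]]]].
have W0 : 0 < 2 * N w1 by rewrite mulr_gt0 // cmod_gt0.
have D0 : 0 < b + `|a| by have := normr_ge0 a; lra.
pose e := Num.min b (b / (b + `|a|)).
have e0 : 0 < e by rewrite lt_min b0 divr_gt0.
exists (2 * N w1 * e); split; first by rewrite mulr_gt0.
move=> m n; have -> : latpt w1 (w1 * (a +i* b)) m n = (2 * w1) * (m%:~R + n%:~R * (a +i* b)) :> C.
  by rewrite /latpt; ring.
rewrite cmodM cmodM cmod_nat -!mulrA !ler_pM2l ?cmod_gt0 //.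
set z := m%:~R + _.
have zE : z = (m%:~R + n%:~R * a) +i* (n%:~R * b).
  rewrite /z -[m%:~R](rmorph_int (real_complex R)) -[n%:~R](rmorph_int (real_complex R)).
  by apply/eqP; rewrite eq_complex /=; apply/andP; split; apply/eqP; ring.
have hI : `|n%:~R : R| * b <= N z.
  by have := Im_le_cmod z; rewrite zE /= normrM (gtr0_norm b0).
have hR : `|m%:~R + n%:~R * a| <= N z by have := Re_le_cmod z; rewrite zE.
have hm : `|m%:~R : R| <= N z + `|n%:~R : R| * `|a|.
  have -> : (m%:~R : R) = (m%:~R + n%:~R * a) - n%:~R * a by ring.
  by apply: le_trans (ler_normB _ _) _; rewrite (normrM n%:~R); lra.
have nm : `|m%:~R : R| = `|m|%N%:R by rewrite -intr_norm -abszE.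
have nn : `|n%:~R : R| = `|n|%N%:R by rewrite -intr_norm -abszE.
rewrite -nm -nn.
have eb : e <= b by rewrite ge_min lexx.
have ebD : e * (b + `|a|) <= b by rewrite -ler_pdivlMr // ge_min lexx orbT.
split; last by have := normr_ge0 (n%:~R : R); nra.
have h1 : `|m%:~R : R| * b <= N z * (b + `|a|).
  by have := normr_ge0 a; have := normr_ge0 (n%:~R : R); nra.
have : e * `|m%:~R : R| * (b + `|a|) <= N z * (b + `|a|).
  have := normr_ge0 (m%:~R : R); nra.
by rewrite ler_pM2r.
Qed.

Lemma cocompact (w1 w2 : C) : 0 < complex.Im (w2 / w1) ->
  forall z, exists m n : int,
    N (z + m%:~R * (2 * w1) + n%:~R * (2 * w2)) <= N (2 * w1) + N (2 * w2).
Proof.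
move=> /period_ratio[w10 [a [b [b0 ->]]]] z.
have p0 : 2 * w1 != 0 by rewrite mulf_neq0 // pnatr_eq0.
pose q := z / (2 * w1); pose t := complex.Im q / b; pose s := complex.Re q - t * a.
have qE : q = s%:C + t%:C * (a +i* b).
  have bn : b != 0 by rewrite gt_eqF.
  rewrite /s /t; clear s t; case: q => x y /=; apply/eqP; rewrite eq_complex /=.
  by apply/andP; split; apply/eqP; field.
exists (- Num.floor s), (- Num.floor t).
have frac (x : R) : `|x - (Num.floor x)%:~R| <= 1.
  have := floor_itv x; rewrite intrD => /andP[h1 h2].
  by rewrite ger0_norm; lra.
have zE : z = 2 * w1 * q by rewrite /q mulrC divfK.
have -> : z + (- Num.floor s)%:~R * (2 * w1) + (- Num.floor t)%:~R * (2 * (w1 * (a +i* b))) =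
   (s - (Num.floor s)%:~R)%:C * (2 * w1) + (t - (Num.floor t)%:~R)%:C * (2 * (w1 * (a +i* b))).
  by rewrite zE qE !mulrNz !rmorphB /= !rmorph_int; ring.
apply: le_trans (cmodD _ _) _; rewrite (cmodM _%:C) (cmodM (_ - _)%:C) !cmod_real.
by apply: lerD; rewrite ler_piMl ?cmod_ge0.
Qed.

(** With v = p1/2 and t = p1/4, every argument to be kept off the lattice has a p1-coordinate in
    (1/4)Z outside Z, which becomes a congruence modulo 4. *)
Lemma quarter_generic (s : C -> C) (p1 p2 : C) :
  (forall u, s u = 0 -> exists m n : int, u = m%:~R * p1 + n%:~R * p2) ->
  (forall m n : int, m%:~R * p1 + n%:~R * p2 = 0 -> m = 0 /\ n = 0) ->
  exists v t, [/\ s v != 0, s (v + p1) != 0, s (v - t) != 0,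
  s (v - t + p1) != 0 & forall z, s z = 0 \/ s (z + p1) = 0 -> s (z + t) != 0 /\ s (z + t + p1) != 0].
Proof.
move=> zs indep.
have nl (m n : int) x : 4 * x = m%:~R * p1 + n%:~R * p2 -> (m %% 4 != 0)%Z -> s x != 0.
  move=> h mn; apply: (@nonlattice _ s p1 p2 zs indep 4 m n) => // a b am _.
  by move: mn; rewrite -am; lia.
exists (p1 / 2), (p1 / 4); split.
- by apply: (nl 2 0); rewrite // mul0r addr0; field.
- by apply: (nl 6 0); rewrite // mul0r addr0; field.
- by apply: (nl 1 0); rewrite // mul0r addr0; field.
- by apply: (nl 5 0); rewrite // mul0r addr0; field.
move=> z [/zs[m [n zmn]]|/zs[m [n zmn]]].
  split; [apply: (nl (4 * m + 1)%R (4 * n)%R)|apply: (nl (4 * m + 5)%R (4 * n)%R)]; try lia.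
    by rewrite zmn !intrD !intrM; field.
  by rewrite zmn !intrD !intrM; field.
have {}zmn : z = m%:~R * p1 + n%:~R * p2 - p1 by rewrite -zmn addrK.
split; [apply: (nl (4 * m - 3)%R (4 * n)%R)|apply: (nl (4 * m + 1)%R (4 * n)%R)]; try lia.
  by rewrite zmn intrB !intrM; field.
by rewrite zmn !intrD !intrM; field.
Qed.

Lemma wsigma_like (w1 w2 : C) : 0 < complex.Im (w2 / w1) ->
  exists k1 A1 k2 A2 rho, sigma_like (wsigma w1 w2) (2 * w1) (2 * w2) k1 A1 k2 A2 rho.
Proof.
move=> im0; have [c lb] := lattice_bound_exists im0.
have [h [eh h0 sE _ hz]] := sigma_product lb.
pose s : C -> C := wsigma w1 w2.
have sE' : (fun u => u * h u) = s by apply/funext => u; rewrite /s sE.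
have es : entire s by rewrite -sE'; exact: entireM (@entire_id R) eh.
have s0 : s 0 = 0 by rewrite /s sE mul0r.
have ds0 : cder s 0 = 1.
  by rewrite -sE' (@cderM _ id h 0 (@entire_id R) eh) cder_id h0 mul1r mul0r addr0.
have sN u : s (- u) = - s u by exact: wsigmaN lb u.
have zs u : s u = 0 -> exists m n : int, u = m%:~R * (2 * w1) + n%:~R * (2 * w2).
  rewrite /s sE => /eqP; rewrite mulf_eq0 => /orP[/eqP ->|/eqP /hz[m [n ->]]].
    by exists 0, 0; rewrite !mul0r addr0.
  by exists m, n; rewrite latptE.
have zs' u : s u = 0 -> exists m n : int, u = m%:~R * (2 * w2) + n%:~R * (2 * w1).
  by move=> /zs[m [n ->]]; exists n, m; rewrite addrC.
have indep (m n : int) : m%:~R * (2 * w1) + n%:~R * (2 * w2) = 0 -> m = 0 /\ n = 0.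
  rewrite -latptE => l0; have [mn|] := boolP ((m != 0) || (n != 0)).
    by have := lat_neq0 lb mn; rewrite l0 eqxx.
  by rewrite negb_or !negbK => /andP[/eqP -> /eqP ->].
have indep' (m n : int) : m%:~R * (2 * w2) + n%:~R * (2 * w1) = 0 -> m = 0 /\ n = 0.
  by rewrite addrC => /indep[].
have q1 u v t : s (u + 2 * w1) * s (v + 2 * w1) * (s (u + t) * s (v - t)) =
    s u * s v * (s (u + t + 2 * w1) * s (v - t + 2 * w1)) by exact: wsigma_quad1 lb u v t.
have sw : wsigma w2 w1 = s by apply/funext => u; exact: wsigma_swap.
have q2 u v t : s (u + 2 * w2) * s (v + 2 * w2) * (s (u + t) * s (v - t)) =
    s u * s v * (s (u + t + 2 * w2) * s (v - t + 2 * w2)).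
  by have := wsigma_quad1 (lattice_bound_swap lb) u v t; rewrite sw.
have g1 := quarter_generic zs indep; have g2 := quarter_generic zs' indep'.
(* The simple zero at 0 is transported along both periods to every lattice point. *)
have sz : simple_zeros s.
  move=> u su; have [m [n umn]] := zs u su.
  suff : s u = 0 /\ cder s u != 0 by case.
  have P0 : s 0 = 0 /\ cder s 0 != 0 by rewrite s0 ds0 oner_neq0.
  have h1 := simple_zero_shift es q1 g1; have h2 := simple_zero_shift es q2 g2.
  have := (int_periods h2 n _).1 ((int_periods h1 m 0).1 P0).
  by rewrite add0r -umn.
have iz := simple_isolated es sz.
have [k1 [A1 [k10 per1]]] := quasi_period es q1 g1 iz sz.
have [k2 [A2 [k20 per2]]] := quasi_period es q2 g2 iz sz.
by exists k1, A1, k2, A2, (N (2 * w1) + N (2 * w2)); split=> //; exact: cocompact.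
Qed.

End WeierstrassSigma.

(** * The determinant *)

Section TwoVariables.
Variable R : realType.
Local Notation C := R[i].
Local Notation N := (@cmod R).

(** A class of expressions in entire functions of a, of v and of v - a. It contains [psi], is closed
    under d/dv, and gives entireness in each variable separately. *)
Inductive bientire : (C -> C -> C) -> Prop :=
| bientire_fst f : entire f -> bientire (fun a _ => f a)
| bientire_snd f : entire f -> bientire (fun _ v => f v)
| bientire_diff f : entire f -> bientire (fun a v => f (v - a))
| bientireD F G : bientire F -> bientire G -> bientire (fun a v => F a v + G a v)
| bientireM F G : bientire F -> bientire G -> bientire (fun a v => F a v * G a v).

Lemma bientire_entire1 F v : bientire F -> entire (fun a => F a v).
Proof.
elim=> [f ef|f _|f ef|{}F G _ eF _ eG|{}F G _ eF _ eG].
- by [].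
- exact: entire_cst.
- by entire_tac.
- exact: entireD.
- exact: entireM.
Qed.

Lemma bientire_entire2 F a : bientire F -> entire (F a).
Proof.
elim=> [f _|f ef|f ef|{}F G _ eF _ eG|{}F G _ eF _ eG].
- exact: entire_cst.
- by [].
- by entire_tac.
- exact: entireD.
- exact: entireM.
Qed.

Lemma bientire_cder F : bientire F -> bientire (fun a v => cder (F a) v).
Proof.
elim=> [f _|f ef|f ef|{}F G bF eF bG eG|{}F G bF eF bG eG].
- have -> : (fun a : C => cder (fun=> f a)) = (fun a v => (fun=> 0) a).
    by apply/funext => a; apply/funext => v; rewrite cder_cst.
  by apply: bientire_fst; exact: entire_cst.
- by apply: (@bientire_snd (cder f)); exact: entire_cder.
- have -> : (fun a : C => cder (fun v => f (v - a))) = (fun a v => cder f (v - a)).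
    by apply/funext => a; apply/funext => v; rewrite cder_shift.
  by apply: (@bientire_diff (cder f)); exact: entire_cder.
- have -> : (fun a : C => cder (fun v => F a v + G a v)) = (fun a v => cder (F a) v + cder (G a) v).
    by apply/funext => a; apply/funext => v; rewrite (@cderD _ (F a) (G a)) //; exact: bientire_entire2.
  exact: bientireD.
- have -> : (fun a : C => cder (fun v => F a v * G a v)) =
      (fun a v => cder (F a) v * G a v + F a v * cder (G a) v).
    by apply/funext => a; apply/funext => v; rewrite (@cderM _ (F a) (G a)) //; exact: bientire_entire2.
  by apply: bientireD; exact: bientireM.
Qed.

Lemma cderX (f : C -> C) n v : entire f ->
  cder (fun u => f u ^+ n.+1) v = n.+1%:R * f v ^+ n * cder f v.
Proof.
move=> ef; elim: n => [|n IH].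
  by rewrite expr0 !mul1r; congr (cder _ v); apply/funext => u; rewrite expr1.
have -> : (fun u => f u ^+ n.+2) = (fun u => f u * f u ^+ n.+1) by apply/funext => u; rewrite exprS.
rewrite (@cderM _ f (fun u => f u ^+ n.+1)) //; last exact: entireX.
by rewrite IH -[n.+2]addn1 natrD !exprS; ring.
Qed.

Variable s : C -> C.

(* [psi i a v = s(a)^i s(v)^(i+1) (d/dv + s'(a)/s(a))^i (s(v - a)/s(v))]: this
   product is entire in both variables. *)
Fixpoint psi (i : nat) (a v : C) : C :=
  if i is j.+1 then
    s a * (cder (psi j a) v * s v - j.+1%:R * cder s v * psi j a v) + cder s a * s v * psi j a v
  else s (v - a).

Lemma psi_bientire i : entire s -> bientire (psi i).
Proof.
move=> es; have es' := entire_cder es; elim: i => [|i IH]; first exact: bientire_diff.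
have bcst k : bientire (fun _ _ => k) by apply: (@bientire_fst (fun=> k)); exact: entire_cst.
have bN F : bientire F -> bientire (fun a v => - F a v).
  move=> bF; have -> : (fun a v => - F a v) = (fun a v => -1 * F a v).
    by apply/funext => a; apply/funext => v; rewrite mulN1r.
  exact: bientireM.
have b1 : bientire (fun a _ => s a) by exact: bientire_fst.
have b2 : bientire (fun _ v => s v) by exact: bientire_snd.
have b3 : bientire (fun a _ => cder s a) by exact: bientire_fst.
have b4 : bientire (fun _ v => cder s v) by exact: bientire_snd.
have b5 := bientire_cder IH.
apply: (@bientireD (fun a v => s a * (cder (psi i a) v * s v - i.+1%:R * cder s v * psi i a v))
  (fun a v => cder s a * s v * psi i a v)); last by do 2!apply: bientireM => //.
apply: bientireM => //; apply: (@bientireD (fun a v => cder (psi i a) v * s v)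
   (fun a v => - (i.+1%:R * cder s v * psi i a v))); first exact: bientireM.
by apply: bN; do 2!apply: bientireM => //.
Qed.

Lemma psi0 i v : s 0 = 0 -> cder s 0 = 1 -> psi i 0 v = s v ^+ i.+1.
Proof.
move=> s0 ds0; elim: i => [|i IH] /=; first by rewrite subr0 expr1.
by rewrite s0 ds0 mul0r add0r mul1r IH -exprS.
Qed.

(** Replacing a by a + p multiplies s(v - a) by [mu] v, proportional to exp(-A v), and adds A to
    zeta(a). The derivative of [mu] cancels this A, so [mu] commutes past the operator; the power of
    the multiplier comes from s(a)^i. *)
Lemma psi_period (p k A : C) : entire s -> k != 0 -> (forall z, s (z + p) = multiplier k A z * s z) ->
  forall i a v, psi i (a + p) v = multiplier k A a ^+ i * multiplier k^-1 (- A) (v - a - p) * psi i a v.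
Proof.
move=> es k0 per i a; pose mu v := multiplier k^-1 (- A) (v - a - p).
have emu : entire mu by apply: (@entire_comp _ (multiplier k^-1 (- A)) (fun v => v - a - p));
  [exact: entire_multiplier|entire_tac].
have mu_inv v : mu v * multiplier k A (v - a - p) = 1.
  rewrite /mu /multiplier mulrACA mulVf // mul1r -cexpD mulNr addNr; exact: cexp0.
have dmu v : cder mu v = - A * mu v.
  have e1 : entire (fun v => k^-1 * cexp (- A * v)) by exact: (entire_multiplier k^-1 (- A)).
  have -> : mu = (fun u => (fun v => k^-1 * cexp (- A * v)) (u + (- a - p))).
    by apply/funext => u; rewrite /mu /multiplier addrA.
  rewrite (@cder_shift _ (fun v => k^-1 * cexp (- A * v))) //.
  have e2 : entire (fun v => cexp (- A * v)).
    by apply: (@entire_comp _ (@cexp R) (fun v => - A * v)); [exact: entire_cexp|entire_tac].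
  rewrite (@cderM _ (fun=> k^-1) (fun v => cexp (- A * v))) //; last exact: entire_cst.
  by rewrite cder_cst cder_cexp_affine; ring.
have dper : cder s (a + p) = multiplier k A a * (cder s a + A * s a).
  rewrite -cder_shift //.
  have -> : (fun u => s (u + p)) = (fun u => (k * cexp (A * u)) * s u) by apply/funext => u; exact: per.
  rewrite (@cderM _ (multiplier k A) s) //; last exact: entire_multiplier.
  have e2 : entire (fun v => cexp (A * v)).
    by apply: (@entire_comp _ (@cexp R) (fun v => A * v)); [exact: entire_cexp|entire_tac].
  rewrite (@cderM _ (fun=> k) (fun v => cexp (A * v))) //; last exact: entire_cst.
  by rewrite cder_cst cder_cexp_affine /multiplier; ring.
elim: i => [|i IH] v.
  rewrite /= expr0 mul1r -/(mu v); have -> : v - (a + p) = v - a - p by rewrite opprD addrA.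
  have -> : s (v - a) = multiplier k A (v - a - p) * s (v - a - p) by rewrite -per subrK.
  by rewrite mulrA mu_inv mul1r.
have epsi : entire (psi i a) by apply: bientire_entire2; exact: psi_bientire.
have dpsi : cder (psi i (a + p)) v = multiplier k A a ^+ i * (mu v * (cder (psi i a) v - A * psi i a v)).
  have -> : psi i (a + p) = (fun u => multiplier k A a ^+ i * (mu u * psi i a u)).
    by apply/funext => u; rewrite IH mulrA.
  rewrite (@cderM _ (fun=> multiplier k A a ^+ i) (fun u => mu u * psi i a u)); [|exact: entire_cst|exact: entireM].
  by rewrite cder_cst (@cderM _ mu (psi i a)) // dmu; ring.
rewrite /= dpsi per dper IH -/(mu v) exprS; ring.
Qed.

End TwoVariables.

(** * The entries of the determinant in terms of [psi] *)

Section IteratedDerivative.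
Variable R : realType.
Local Notation C := R[i].
Variables (w1 w2 : C).
Local Notation s := (wsigma w1 w2 : C -> C).
Hypothesis es : entire s.

Lemma wzetaE a : wzeta w1 w2 a = cder s a / s a :> C.
Proof. by rewrite cder.unlock. Qed.

Lemma dplusE (c : C) (g : C -> C) v : dplus c g v = cder g v + c * g v :> C.
Proof. by rewrite cder.unlock. Qed.

(** The induction is over all [v]: its step differentiates the formula, which must therefore hold on
    a neighbourhood where [s] is nonzero. *)
Lemma phitilde_psi i (a v : C) : s a != 0 -> s v != 0 ->
  phitilde w1 w2 v i a = psi s i a v / (s a ^+ i * s v ^+ i.+1) :> C.
Proof.
move=> sa; elim: i v => [|i IH] v sv; first by rewrite /phitilde /= expr0 mul1r expr1.
pose B u := s a ^+ i * s u ^+ i.+1.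
have eB : entire B by apply: (@entireM _ (fun=> s a ^+ i)); [exact: entire_cst|exact: entireX].
have epsi : entire (psi s i a) by apply: bientire_entire2; exact: psi_bientire.
have [d d0 hd] := entire_neq0 es sv.
have Bn0 u : s u != 0 -> B u != 0 by move=> su; rewrite mulf_neq0 // expf_neq0.
have gm : germ_at (fun u => phitilde w1 w2 u i a) v (psi s i a) B.
  apply: (germ_intro epsi eB (Bn0 _ sv) d0) => u ud _; exact: IH (hd u ud).
have -> : phitilde w1 w2 v i.+1 a = dplus (wzeta w1 w2 a) (fun u => phitilde w1 w2 u i a) v by [].
rewrite dplusE wzetaE (cder_germ gm) (IH v sv).
have dB : cder B v = s a ^+ i * (i.+1%:R * s v ^+ i * cder s v).
  rewrite (@cderM _ (fun=> s a ^+ i) (fun u => s u ^+ i.+1)); [|exact: entire_cst|exact: entireX].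
  by rewrite cder_cst mul0r add0r cderX.
rewrite dB /B /= !exprS; move: (cder (psi s i a) v) (psi s i a v) (cder s v) (cder s a) => x y z t.
have sai : s a ^+ i != 0 by rewrite expf_neq0.
have svi : s v ^+ i != 0 by rewrite expf_neq0.
move: (s a) (s v) sa sv sai svi => b c b0 c0; move: (b ^+ i) (c ^+ i) => bi ci bi0 ci0.
by field; rewrite b0 c0 bi0 ci0.
Qed.

End IteratedDerivative.

(** * Induction on the size of the determinant *)

Section DeterminantIdentity.
Variable R : realType.
Local Notation C := R[i].
Local Notation N := (@cmod R).

Lemma entire_det n (M : C -> 'M[C]_n) : (forall i j, entire (fun t => M t i j)) ->
  entire (fun t => \det (M t)).
Proof.
move=> eM.
apply: (@entire_sum _ _ _ _ (fun (p : 'S_n) t => (-1) ^+ p * \prod_i M t i (p i))) => p.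
apply: (@entireM _ (fun=> (-1) ^+ p) (fun t => \prod_i M t i (p i))); first exact: entire_cst.
by apply: (@entire_prod _ _ _ _ (fun i t => M t i (p i))) => i; exact: eM.
Qed.

Lemma isolated_zeros_cst (k : C) : k != 0 -> isolated_zeros (fun=> k).
Proof. by move=> k0 c; exists 1. Qed.

Variables (s : C -> C) (p1 p2 k1 A1 k2 A2 : C) (rho : R) (e : C).
Hypothesis sl : sigma_like s p1 p2 k1 A1 k2 A2 rho.
Hypothesis se : s e != 0.
Let es := sl_entire sl.
Let sN := sl_odd sl.

(** The entry of the theorem times s(a)^i, which clears its poles in a. *)
Definition Phi i a : C := psi s i a e / s e ^+ i.+1.

Lemma entire_Phi i : entire (Phi i).
Proof.
apply: (@entireM _ (fun a => psi s i a e) (fun=> (s e ^+ i.+1)^-1)); last exact: entire_cst.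
by apply: bientire_entire1; exact: psi_bientire.
Qed.

Lemma Phi0 i : Phi i 0 = 1.
Proof. by rewrite /Phi (psi0 _ _ (sl_zero0 sl) (sl_der0 sl)) divff // expf_neq0. Qed.

Lemma Phi_period p k A : k != 0 -> (forall z, s (z + p) = multiplier k A z * s z) ->
  forall i a, Phi i (a + p) = multiplier k A a ^+ i * multiplier k^-1 (- A) (e - a - p) * Phi i a.
Proof. by move=> k0 per i a; rewrite /Phi (psi_period es k0 per) mulrA. Qed.

(** The matrix of the theorem with column j multiplied by [s (alpha j) ^+ n.-1]. *)
Definition sigmamx n (alpha : 'I_n -> C) : 'M[C]_n :=
  \matrix_(i, j) (Phi i (alpha j) * s (alpha j) ^+ (n.-1 - i)).

Definition vdm n (alpha : 'I_n -> C) : C :=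
  \prod_(i < n) \prod_(j < n | (i < j)%N) s (alpha i - alpha j).

Definition extend n (beta : 'I_n -> C) (x : C) (j : 'I_n.+1) : C :=
  if unlift ord_max j is Some i then beta i else x.

Lemma extend_lift n (beta : 'I_n -> C) x i : extend beta x (lift ord_max i) = beta i.
Proof. by rewrite /extend liftK. Qed.

Lemma extend_max n (beta : 'I_n -> C) x : extend beta x ord_max = x.
Proof. by rewrite /extend unlift_none. Qed.

Lemma extendK n (alpha : 'I_n.+1 -> C) :
  alpha = extend (fun i => alpha (lift ord_max i)) (alpha ord_max).
Proof. by apply/funext => j; rewrite /extend; case: unliftP => [i ->|->]. Qed.

Lemma sum_extend n (beta : 'I_n -> C) x : \sum_j extend beta x j = \sum_j beta j + x.
Proof.
rewrite big_ord_recr /= extend_max; congr (_ + _); apply: eq_bigr => i _.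
have -> : widen_ord (leqnSn n) i = lift ord_max i by apply/val_inj; rewrite /= /bump leqNgt ltn_ord.
by rewrite extend_lift.
Qed.

Lemma vdm_extend n (beta : 'I_n -> C) x :
  vdm (extend beta x) = vdm beta * \prod_(j < n) s (beta j - x).
Proof.
have wl i : widen_ord (leqnSn n) i = lift ord_max i :> 'I_n.+1.
  by apply/val_inj; rewrite /= /bump leqNgt ltn_ord.
rewrite /vdm big_ord_recr /= [X in _ * X]big_pred0 ?mulr1; last first.
  by move=> j; rewrite ltnNge -ltnS ltn_ord.
rewrite -big_split; apply: eq_bigr => i _ /=.
rewrite big_mkcond big_ord_recr /= ltn_ord extend_max wl extend_lift; congr (_ * _).
rewrite [RHS]big_mkcond; apply: eq_bigr => j _.
by rewrite wl !extend_lift.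
Qed.

Section LastColumn.
Variables (n : nat) (beta : 'I_n -> C).

Definition lastdet (x : C) : C := \det (sigmamx (extend beta x)).

(** These cofactors do not see the last argument; 0 is an arbitrary value for it. *)
Definition lastcof (i : 'I_n.+1) : C := cofactor (sigmamx (extend beta 0)) i ord_max.

Lemma lastdetE x :
  lastdet x = \sum_(i < n.+1) Phi i x * s x ^+ (n - i) * lastcof i.
Proof.
rewrite /lastdet (expand_det_col _ ord_max); apply: eq_bigr => i _.
rewrite mxE extend_max /lastcof /cofactor; congr (_ * (_ * \det _)).
by apply/matrixP => a b; rewrite !mxE !extend_lift.
Qed.

Lemma entire_lastdet : entire lastdet.
Proof.
have -> : lastdet = (fun x => \sum_(i < n.+1) Phi i x * s x ^+ (n - i) * lastcof i).
  by apply/funext => x; rewrite lastdetE.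
apply: (@entire_sum _ _ _ _ (fun (i : 'I_n.+1) x => Phi i x * s x ^+ (n - i) * lastcof i)) => i.
apply: (@entireM _ (fun x => Phi i x * s x ^+ (n - i)) (fun=> lastcof i)); last exact: entire_cst.
by apply: entireM; [exact: entire_Phi|exact: entireX].
Qed.

(** In row i, [Phi] contributes the i-th power of the multiplier and the power of [s] the (n -
    i)-th, so all rows share one factor. *)
Lemma lastdet_period p k A : k != 0 -> (forall z, s (z + p) = multiplier k A z * s z) ->
  forall x, lastdet (x + p) = multiplier k A x ^+ n * multiplier k^-1 (- A) (e - x - p) * lastdet x.
Proof.
move=> k0 per x; rewrite !lastdetE mulr_sumr; apply: eq_bigr => i _.
rewrite (Phi_period k0 per) per (exprMn_comm _ (mulrC (multiplier k A x) (s x))).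
have -> : multiplier k A x ^+ n = multiplier k A x ^+ i * multiplier k A x ^+ (n - i).
  by rewrite -exprD subnKC // -ltnS.
move: (multiplier k A x) => m; move: (m ^+ i) (m ^+ (n - i)) (s x ^+ (n - i)) => a b d; ring.
Qed.

Lemma lastdet_eq0 j : lastdet (beta j) = 0.
Proof.
rewrite /lastdet -det_tr; apply: (@determinant_alternate _ _ _ (lift ord_max j) ord_max).
  by rewrite eq_sym neq_lift.
by move=> i; rewrite !mxE extend_lift extend_max.
Qed.

(** As s(0) = 0, only the bottom entry of the last column survives; its exponent is 0 and it equals
    1. In the remaining minor the exponents are n - i instead of n - 1 - i, whence one factor
    [s (beta j)] per column. *)
Lemma lastdet0 : lastdet 0 = (\prod_j s (beta j)) * \det (sigmamx beta).
Proof.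
rewrite lastdetE big_ord_recr /= subnn expr0 mulr1 Phi0 mul1r big1 ?add0r => [|i _]; last first.
  by rewrite (sl_zero0 sl) expr0n subn_eq0 leqNgt ltn_ord mulr0 mul0r.
rewrite /lastcof /cofactor addnn -signr_odd odd_double expr0 mul1r.
have -> : row' ord_max (col' ord_max (sigmamx (extend beta 0))) =
    sigmamx beta *m diag_mx (\row_j s (beta j)).
  apply/matrixP => i j; rewrite mul_mx_diag !mxE extend_lift -mulrA -exprSr.
  have -> : lift ord_max i = i :> nat by rewrite /= /bump leqNgt ltn_ord.
  congr (_ * _ ^+ _); have : (i < n)%N := ltn_ord i; move: (nat_of_ord i) => k /=; lia.
rewrite det_mulmx det_diag mulrC; congr (_ * _); by apply: eq_bigr => j _; rewrite mxE.
Qed.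

(** Generic position: [bb] makes the zeros of [D] simple, while [b0] and [s_sigma] let the value at
    x = 0 determine the constant. *)
Hypothesis b0 : forall j, s (beta j) != 0.
Hypothesis bb : forall i j, i != j -> s (beta i - beta j) != 0.
Let sigma := e - \sum_j beta j.
Hypothesis s_sigma : s sigma != 0.

Let D x : C := \prod_j s (beta j - x).

Lemma sigma_zero_sym x y : s (x - y) = 0 -> s (y - x) = 0.
Proof. by move=> h; rewrite -opprB sN h oppr0. Qed.

Lemma lastdet_zero x : D x = 0 -> lastdet x = 0.
Proof.
move=> /eqP/prodf_eq0[j _ /eqP bx].
have per p k A : k != 0 -> (forall z, s (z + p) = multiplier k A z * s z) ->
    forall z, lastdet z = 0 <-> lastdet (z + p) = 0.
  move=> k0 kp z; rewrite (lastdet_period k0 kp).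
  have c0 : multiplier k A z ^+ n * multiplier k^-1 (- A) (e - z - p) != 0.
    by rewrite mulf_neq0 ?expf_neq0 ?multiplier_neq0 ?invr_eq0.
  by split=> [->|/eqP]; rewrite ?mulr0 // mulf_eq0 (negbTE c0) => /eqP.
apply: (lattice_ind sl (P := fun z => lastdet z = 0) _ _ (lastdet_eq0 j) (sigma_zero_sym bx)).
  exact: per (sl_k1 sl) (sl_per1 sl).
exact: per (sl_k2 sl) (sl_per2 sl).
Qed.

Lemma entire_reflect q : entire (fun z => s (q - z)).
Proof. by entire_tac. Qed.

Lemma entire_D : entire D.
Proof. by apply: (@entire_prod _ _ _ _ (fun j x => s (beta j - x))) => j; exact: entire_reflect. Qed.

Lemma simple_D : simple_zeros D.
Proof.
have es' := entire_reflect.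
rewrite /D; suff h (r : seq 'I_n) : uniq r -> simple_zeros (fun x => \prod_(j <- r) s (beta j - x)).
  by apply: h; exact: index_enum_uniq.
elim: r => [|j r IH] /=.
  by move=> _ z /eqP; rewrite big_nil oner_eq0.
move=> /andP[jr ur].
have -> : (fun x => \prod_(i <- j :: r) s (beta i - x)) =
   (fun x => s (beta j - x) * \prod_(i <- r) s (beta i - x)).
  by apply/funext => x; rewrite big_cons.
apply: simple_zerosM => //.
- by apply: (@entire_prod _ _ _ _ (fun j x => s (beta j - x))) => i.
- by apply: simple_zeros_reflect => //; exact: sl_simple sl.
- exact: IH.
move=> z zj; rewrite prodf_seq_neq0; apply/allP => i ir /=; apply/eqP => zi.
have ij : i != j by apply: contraNneq jr => <-.
have /eqP := bb ij; apply.
by rewrite -(sigma_zero_sub sl zi zj); congr s; ring.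
Qed.

(** Pairing one multiplier at x with that at beta j - x - p gives k^2 exp(A (beta j - p)) = exp(A
    beta j). The two remaining factors multiply to the exponential of minus A times the sum of the
    beta j. *)
Lemma multiplier_balance p k A x : k != 0 -> k ^+ 2 = cexp (A * p) ->
  multiplier k A x ^+ n * multiplier k^-1 (- A) (e - x - p) *
  ((\prod_j multiplier k A (beta j - x - p)) * multiplier k A (sigma - x - p)) = 1.
Proof.
move=> k0 kk.
have -> : multiplier k A x ^+ n = \prod_(j < n) multiplier k A x by rewrite prodr_const card_ord.
transitivity ((\prod_j (multiplier k A x * multiplier k A (beta j - x - p))) *
  (multiplier k^-1 (- A) (e - x - p) * multiplier k A (sigma - x - p))).
  by rewrite mulrACA -big_split.
have -> : multiplier k^-1 (- A) (e - x - p) * multiplier k A (sigma - x - p) =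
    cexp (- (A * \sum_j beta j)).
  rewrite /multiplier mulrACA mulVf // mul1r -cexpD /sigma; congr cexp; ring.
have -> : \prod_j (multiplier k A x * multiplier k A (beta j - x - p)) = cexp (A * \sum_j beta j).
  rewrite mulr_sumr.
  transitivity (\prod_j (cexp (A * beta j) : C)).
    apply: eq_bigr => j _; rewrite multiplierM kk -cexpD; congr cexp; ring.
  by elim/big_rec2: _ => [|i x' y' _ ->]; rewrite ?cexp0 // cexpD.
by rewrite -cexpD subrr cexp0.
Qed.

(* The quotient of the determinant by [D] has the multipliers of [s (sigma - x)]. *)
Lemma lastdet_factor : exists K : C, forall x, lastdet x = K * (D x * s (sigma - x)).
Proof.
have eD := entire_D; have sD := simple_D; have iD := simple_isolated eD sD.
have [kap hk gk] := removable_quotient (entire_holo entire_lastdet) eD sD lastdet_zero.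
(* In the variable y = sigma - x the target s(sigma - x) becomes s(y), as [degree_one] requires. *)
pose G y := kap (sigma - y).
have hG : holo G.
  by apply: holo_ext (holo_affine sigma (-1) hk) => z; rewrite mulN1r.
have cross p k A : k != 0 -> k ^+ 2 = cexp (A * p) -> (forall z, s (z + p) = multiplier k A z * s z) ->
    forall y, G (y + p) * s y = G y * s (y + p).
  move=> k0 kk per y; apply/eqP; rewrite -subr_eq0; apply/eqP; move: y.
  (* Multiplying by [D] at both points replaces [kap] by [lastdet], whose multiplier is known. *)
  apply: (@eq0_of_mul _ _ (fun y => D (sigma - (y + p)) * D (sigma - y))).
  - move=> c; apply: holo_ccont; apply: holoB; apply: holoM => //.
    + by apply: holo_ext (holo_affine p 1 hG) => z; rewrite mul1r addrC.
    + exact: entire_holo.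
    + by apply: entire_holo; exact: (@entire_shift _ s p es).
  - have sr : simple_zeros (fun y => D (sigma - y)) by exact: simple_zeros_reflect.
    have er : entire (fun y => D (sigma - y)) by entire_tac.
    apply: isolated_zerosM; last exact: simple_isolated.
    apply: (@simple_isolated _ (fun y => (fun u => D (sigma - u)) (y + p))).
      exact: (@entire_shift _ (fun u => D (sigma - u)) p er).
    exact: (@simple_zeros_shift _ (fun u => D (sigma - u))).
  move=> y; rewrite /G; set x := sigma - (y + p).
  have yx : sigma - y = x + p by rewrite /x; ring.
  have yE : y = sigma - x - p by rewrite /x; ring.
  have ypE : y + p = sigma - x by rewrite /x; ring.
  rewrite yx ypE yE.
  have hD : D x = (\prod_j multiplier k A (beta j - x - p)) * D (x + p).
    rewrite /D -big_split; apply: eq_bigr => j _ /=.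
    have -> : s (beta j - x) = s ((beta j - x - p) + p) by rewrite subrK.
    by rewrite per; congr (_ * s _); ring.
  have hs : s (sigma - x) = multiplier k A (sigma - x - p) * s (sigma - x - p).
    by rewrite -per subrK.
  have g1 := gk x; have g2 := gk (x + p).
  rewrite (lastdet_period k0 per) in g2.
  have bal := @multiplier_balance p k A x k0 kk.
  set m1 := multiplier k A x ^+ n * _ in g2 bal; set m2 := \prod_j multiplier _ _ _ in hD bal.
  set m3 := multiplier k A _ in hs bal.
  transitivity (kap x * D x * (D (x + p) * s (sigma - x - p)) - kap (x + p) * D (x + p) * (D x * s (sigma - x))).
    by ring.
  rewrite -g1 -g2 hD hs.
  transitivity (lastdet x * D (x + p) * s (sigma - x - p) * (1 - m1 * (m2 * m3))); first by ring.
  by rewrite bal subrr mulr0.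
have half (m k : int) x : 2 * x = m%:~R * p1 + k%:~R * p2 ->
  (m %% 2 != 0)%Z || (k %% 2 != 0)%Z -> s x != 0 by exact: (half_neq0 sl).
have n2 : 2 != 0 :> C by rewrite pnatr_eq0.
have sq1 : k1 ^+ 2 = cexp (A1 * p1).
  apply: (quasi_period_sq sN _ (sl_per1 sl)); apply: (half 1 0) => //.
  by rewrite mulrC divfK // mul1r mul0r addr0.
have sq2 : k2 ^+ 2 = cexp (A2 * p2).
  apply: (quasi_period_sq sN _ (sl_per2 sl)); apply: (half 0 1) => //.
  by rewrite mulrC divfK // mul1r mul0r add0r.
have cG : cross_periodic s p1 p2 G.
  by split; [exact: cross (sl_k1 sl) sq1 (sl_per1 sl)|exact: cross (sl_k2 sl) sq2 (sl_per2 sl)].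
have [K GK] := degree_one sl hG cG.
exists K => x; rewrite gk mulrCA mulrC; congr (_ * _).
by rewrite -GK /G opprB addrC subrK.
Qed.

Lemma lastdet_step x :
  \det (sigmamx beta) = s sigma * vdm beta / s e ->
  lastdet x = s (sigma - x) * vdm (extend beta x) / s e.
Proof.
move=> IH; have [K hK] := lastdet_factor.
have Dn0 : \prod_j s (beta j) != 0 by rewrite prodf_seq_neq0; apply/allP => j _; exact: b0.
have := hK 0; rewrite lastdet0 IH subr0.
have -> : D 0 = \prod_j s (beta j) by apply: eq_bigr => j _; rewrite subr0.
move=> h; have KE : K = vdm beta / s e.
  apply: (mulIf (mulf_neq0 Dn0 s_sigma)); rewrite -h; ring.
by rewrite hK KE vdm_extend; rewrite /D; ring.
Qed.

End LastColumn.

Lemma isolated_affine (a b : C) : b != 0 -> isolated_zeros (fun t => s (a + b * t)).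
Proof.
move=> b0; apply: simple_isolated; first exact: entire_affine.
by move=> t t0; rewrite cder_affine // mulf_neq0 //; exact: (sl_simple sl t0).
Qed.

Lemma det_sigmamx n (alpha : 'I_n -> C) :
  \det (sigmamx alpha) = s (e - \sum_j alpha j) * vdm alpha / s e.
Proof.
elim: n alpha => [|n IH] alpha.
  by rewrite det_mx00 /vdm !big_ord0 subr0 mulr1 divff.
rewrite (extendK alpha); move: (fun i => _) (alpha ord_max) => beta x {alpha}.
(* Generic position is reached by moving [beta j] to [beta j + (j + 1) t]. *)
pose bt (t : C) (j : 'I_n) := beta j + j.+1%:R * t.
pose H t := \det (sigmamx (extend (bt t) x)) -
  s (e - \sum_j extend (bt t) x j) * vdm (extend (bt t) x) / s e.
suff H0 t : H t = 0.
  have := H0 0; rewrite /H; have -> : bt 0 = beta by apply/funext => j; rewrite /bt mulr0 addr0.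
  by move=> /eqP; rewrite subr_eq0 => /eqP.
(* The speeds j + 1 are nonzero, pairwise distinct and, for n > 0, of nonzero sum [S]; so each
   factor of [J] is [s] of a nonconstant affine function of t. *)
pose S : C := \sum_(j < n) j.+1%:R.
pose J t := (\prod_j s (bt t j)) * (\prod_(q : 'I_n * 'I_n | q.1 != q.2) s (bt t q.1 - bt t q.2)) *
  s (e - \sum_j bt t j).
have sum_bt u : \sum_j bt u j = \sum_j beta j + S * u.
  by rewrite /bt big_split /= -mulr_suml.
have ebt j : entire (fun u => bt u j).
  by rewrite /bt; entire_tac.
have eext j : entire (fun u => extend (bt u) x j).
  rewrite /extend; case: (unlift ord_max j) => [k|]; last exact: entire_cst.
  exact: ebt.
apply: (@eq0_of_mul _ H J).
- move=> c; apply: entire_ccont.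
  apply: (@entireB _ (fun t => \det (sigmamx (extend (bt t) x)))
     (fun t => s (e - \sum_j extend (bt t) x j) * vdm (extend (bt t) x) / s e)).
    apply: entire_det => i j.
    have -> : (fun t => sigmamx (extend (bt t) x) i j) =
       (fun t => (fun a => Phi i a * s a ^+ (n - i)) (extend (bt t) x j)).
      by apply/funext => u; rewrite mxE.
    apply: (@entire_comp _ (fun a => Phi i a * s a ^+ (n - i)) (fun t => extend (bt t) x j)) => //.
    by apply: entireM; [exact: entire_Phi|exact: entireX].
  apply: (@entireM _ (fun t => s (e - \sum_j extend (bt t) x j) * vdm (extend (bt t) x)) (fun=> (s e)^-1));
    last exact: entire_cst.
  apply: entireM.
    apply: (@entire_comp _ s (fun t => e - \sum_j extend (bt t) x j)) => //.
    apply: (@entireB _ (fun=> e) (fun t => \sum_j extend (bt t) x j)); first exact: entire_cst.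
    exact: (@entire_sum _ _ _ _ (fun j t => extend (bt t) x j)).
  rewrite /vdm.
  apply: (@entire_prod _ _ _ _ (fun (i : 'I_n.+1) t => \prod_(j < n.+1 | (i < j)%N) s (extend (bt t) x i - extend (bt t) x j))) => i.
  apply: (@entire_prod _ _ _ _ (fun (j : 'I_n.+1) t => s (extend (bt t) x i - extend (bt t) x j))) => j.
  apply: (@entire_comp _ s (fun t => extend (bt t) x i - extend (bt t) x j)) => //.
  exact: (@entireB _ (fun t => extend (bt t) x i) (fun t => extend (bt t) x j)).
- apply: isolated_zerosM; first apply: isolated_zerosM.
  + apply: (@isolated_zeros_prod _ _ _ _ (fun j t => s (bt t j))) => j _.
    by apply: isolated_affine; rewrite pnatr_eq0.
  + apply: (@isolated_zeros_prod _ _ _ _ (fun (q : 'I_n * 'I_n) t => s (bt t q.1 - bt t q.2))) => -[i j] /= ij.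
    have -> : (fun t => s (bt t i - bt t j)) =
       (fun t => s ((beta i - beta j) + (i.+1%:R - j.+1%:R) * t)).
      by apply/funext => u; congr s; rewrite /bt; ring.
    apply: isolated_affine; rewrite subr_eq0 eqr_nat eqSS.
    by apply: contraNneq ij => /val_inj ->.
  + have -> : (fun t => s (e - \sum_j bt t j)) = (fun t => s ((e - \sum_j beta j) + (- S) * t)).
      by apply/funext => u; congr s; rewrite sum_bt; ring.
    (* For n = 0 the sum does not move with t, and the factor is the nonzero constant [s e]. *)
    have [n0|n0] := posnP n; last first.
      apply: isolated_affine; rewrite oppr_eq0 /S -natr_sum pnatr_eq0 -lt0n.
      by rewrite (bigD1 (Ordinal n0)) //= ltn_addr.
    have noI (j : 'I_n) : False by have := leq_ltn_trans (leq0n j) (ltn_ord j); rewrite n0.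
    have -> : (fun t => s (e - \sum_j beta j + - S * t)) = (fun=> s e).
      have S00 : S = 0 by rewrite /S big1 // => j; case: (noI j).
      have b00 : \sum_(j < n) beta j = 0 by rewrite big1 // => j; case: (noI j).
      by apply/funext => u; rewrite b00 S00 !oppr0 mul0r !addr0.
    exact: isolated_zeros_cst.
move=> u; have [Ju|Ju] := eqVneq (J u) 0; first by rewrite Ju mulr0.
move: Ju; rewrite {1}/J !mulf_eq0 !negb_or => /andP[/andP[J1 J2] J3].
suff -> : H u = 0 by rewrite mul0r.
have b0 j : s (bt u j) != 0.
  by move: J1; rewrite prodf_seq_neq0 => /allP /(_ j); rewrite mem_index_enum; apply.
have bb i j : i != j -> s (bt u i - bt u j) != 0.
  by move=> ij; move: J2; rewrite prodf_seq_neq0 => /allP /(_ (i, j)); rewrite mem_index_enum /= ij; apply.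
rewrite /H sum_extend opprD addrA.
by rewrite -(lastdet_step b0 bb J3 x (IH (bt u))) subrr.
Qed.

End DeterminantIdentity.

Theorem theorem9 (R : realType) (w1 w2 : R[i]) (n : nat) (e : R[i])
    (alpha : 'I_n -> R[i]) :
  0 < complex.Im (w2 / w1) ->
  (1 <= n)%N ->
  wsigma w1 w2 e != 0 ->
  (forall i, wsigma w1 w2 (alpha i) != 0) ->
  wsigma w1 w2 (e - \sum_(j < n) alpha j)
    * (\prod_(i < n) \prod_(j < n | (i < j)%N) wsigma w1 w2 (alpha i - alpha j))
    / (wsigma w1 w2 e * \prod_(i < n) wsigma w1 w2 (alpha i) ^+ n.-1)
  = \det (\matrix_(i < n, j < n) phitilde w1 w2 e i (alpha j)).
Proof.
move=> im0 n1 se sa; have [k1 [A1 [k2 [A2 [rho sl]]]]] := wsigma_like im0.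
pose s : R[i] -> R[i] := wsigma w1 w2.
have es : entire s := sl_entire sl.
(* Undoes the column scaling built into [sigmamx]; its determinant is the denominator on the
   left. *)
have -> : \matrix_(i < n, j < n) phitilde w1 w2 e i (alpha j) =
    sigmamx s e alpha *m diag_mx (\row_j (s (alpha j) ^+ n.-1)^-1).
  apply/matrixP => i j; rewrite mul_mx_diag !mxE (phitilde_psi es) //; rewrite -/s.
  have -> : s (alpha j) ^+ n.-1 = s (alpha j) ^+ i * s (alpha j) ^+ (n.-1 - i).
    by rewrite -exprD subnKC //; have := ltn_ord i; lia.
  have s0 : s (alpha j) != 0 by exact: sa.
  have se' : s e != 0 by exact: se.
  rewrite /Phi.
  move: (psi _ _ _ _) (expf_neq0 i s0) (expf_neq0 (n.-1 - i) s0) (expf_neq0 i.+1 se').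
  move: (_ ^+ i) (_ ^+ (n.-1 - i)) (_ ^+ i.+1) => a b c p a0 b0 c0.
  by field; rewrite a0 b0 c0.
rewrite det_mulmx det_diag (det_sigmamx sl se).
have -> : \prod_(i < n) (\row_j (s (alpha j) ^+ n.-1)^-1) 0 i = (\prod_(i < n) s (alpha i) ^+ n.-1)^-1.
  by rewrite -prodfV; apply: eq_bigr => i _; rewrite mxE.
by rewrite invfM !mulrA.
Qed.
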